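(* Let $n>1$ and $m>1$ be integers, let $r>0$, and let $Z=\left[-\tfrac12,\tfrac12\right]^n\times rB_2^m\subset\mathbb{R}^{n+m}$. Then for all $a\in\mathbb{R}^{n+m}$ with $\|a\|=1$, $$\operatorname{vol}_{n+m-1}(H_a\cap Z)\le\begin{cases} r^m\,\dfrac{\pi^{\frac m2}}{\Gamma\left(\frac m2+1\right)}\cdot\sqrt2, & r\ge\dfrac{\Gamma\left(\frac m2+1\right)}{\Gamma\left(\frac m2+\frac12\right)}\dfrac1{\sqrt\pi},\\[3mm] r^{m-1}\,\dfrac{\pi^{\frac{m-1}2}}{\Gamma\left(\frac{m-1}2+1\right)}\cdot\sqrt2, & r<\dfrac{\Gamma\left(\frac m2+1\right)}{\Gamma\left(\frac m2+\frac12\right)}\dfrac1{\sqrt\pi}.\end{cases}$$ Moreover, for $r\ge\frac{\Gamma\left(\frac m2+1\right)}{\Gamma\left(\frac m2+\frac12\right)}\frac1{\sqrt\pi}$ the bound is attained for $a=\left(\frac1{\sqrt2},\frac1{\sqrt2},0,\dots,0\right)$.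
   Context: $\|\cdot\|$ is the Euclidean norm and $\langle\cdot,\cdot\rangle$ the standard scalar product. $B_2^m=\{x\in\mathbb{R}^m : \|x\|\le 1\}$. $H_a=\{x\in\mathbb{R}^{n+m} : \langle a,x\rangle=0\}$ is the hyperplane through the origin orthogonal to $a$. For a subset of a $k$-dimensional subspace, $\operatorname{vol}_k$ is the $k$-dimensional Lebesgue measure induced on that subspace. *)

(* Defs.v *)
From HB Require Import structures.
From mathcomp Require Import all_boot all_order all_algebra.
From mathcomp Require Import all_classical all_reals all_analysis.

Set Implicit Arguments.
Unset Strict Implicit.
Unset Printing Implicit Defensive.

Import Order.TTheory GRing.Theory Num.Theory.
Import numFieldNormedType.Exports.

Local Open Scope classical_set_scope.
Local Open Scope ring_scope.

Section Euclidean.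
Context {R : realType}.

Definition dot N (x y : 'rV[R]_N) : R := \sum_(i < N) x 0 i * y 0 i.

(* The norm `|x| of the library on 'rV[R]_N is the sup norm. *)
Definition enorm N (x : 'rV[R]_N) : R := Num.sqrt (dot x x).

Definition hyperplane N (a : 'rV[R]_N) : set 'rV[R]_N := [set x | dot a x = 0].

Definition cube n : set 'rV[R]_n :=
  [set x | forall i, x 0 i \in `[- (1 / 2), 1 / 2]].

Definition eball m (r : R) : set 'rV[R]_m := [set x | enorm x <= r].

(* [-1/2, 1/2]^n x r B_2^m, with R^(n+m) read as R^n x R^m *)
Definition cylinder n m (r : R) : set 'rV[R]_(n + m) :=
  [set x | cube (lsubmx x) /\ eball r (rsubmx x)].

Definition Gamma (s : R) : R :=
  \int[@lebesgue_measure R]_(t in `]0, +oo[) (t `^ (s - 1) * expR (- t)).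

End Euclidean.

Section Volume.
Context {R : realType}.
Local Notation mR := (measurableTypeR R).
Local Open Scope ereal_scope.

Let consp k (p : mR * k.-tuple mR) : k.+1.-tuple mR := [tuple of p.1 :: p.2].

(* The k-fold product of the Lebesgue measure of R. *)
Fixpoint lebesgue_tuple k : set (k.-tuple mR) -> \bar R :=
  match k with
  | 0%N => \d_ [tuple]
  | k'.+1 => pushforward (@lebesgue_measure R \x @lebesgue_tuple k')
               (@consp k')
  end.

Let measurable_consp k : measurable_fun setT (@consp k).
Proof. exact: measurable_cons. Qed.

Let unconsp k (t : k.+1.-tuple mR) : mR * k.-tuple mR :=
  (thead t, [tuple of behead t]).

Let measurable_unconsp k : measurable_fun setT (@unconsp k).
Proof.
apply/measurable_fun_pairP; split; first exact: measurable_tnth.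
exact: measurable_behead.
Qed.

Let conspK k : cancel (@consp k) (@unconsp k).
Proof. by move=> [x t]; rewrite /unconsp /consp theadE; congr pair; exact/val_inj. Qed.

Section sigma_finite_alias.
Context k (nu : {measure set (k.-tuple mR) -> \bar R}).
Context (nuF : sigma_finite setT nu).

Definition sigma_finite_alias of sigma_finite setT nu
  : set (k.-tuple mR) -> \bar R := nu.
HB.instance Definition _ := Measure.on (sigma_finite_alias nuF).
HB.instance Definition _ := Measure_isSigmaFinite.Build _ _ _
  (sigma_finite_alias nuF) nuF.
End sigma_finite_alias.

Let lebesgue_tuple_sigma_finite_measure k :
  exists mu : {sigma_finite_measure set (k.-tuple mR) -> \bar R},
    @lebesgue_tuple k = mu.
Proof.
elim: k => [|k [mu muE]]; first by exists (\d_ ([tuple] : 0.-tuple mR)).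
pose lam : {measure set (mR * k.-tuple mR)%type -> \bar R} :=
  @lebesgue_measure R \x mu.
have [nu nuE] : exists nu : {measure set (k.+1.-tuple mR) -> \bar R},
    nu = pushforward lam (@consp k) :> (set _ -> _).
  unshelve eexists (pushforward lam (@consp k) :
    {measure set (k.+1.-tuple mR) -> \bar R}); last by [].
  exact: measurable_consp.
have nuF : sigma_finite setT nu.
  have /sigma_finiteP[F [FT ndF Foo]] := sigma_finiteT (@lebesgue_measure R).
  have /sigma_finiteP[G [GT ndG Goo]] := sigma_finiteT mu.
  exists (fun i => @unconsp k @^-1` (F i `*` G i)).
    rewrite -preimage_bigcup (_ : \bigcup_i _ = setT) ?preimage_setT//.
    apply/seteqP; split=> // -[x t] _.
    have [i _ Fx] : (\bigcup_i F i) x by rewrite -FT.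
    have [j _ Gt] : (\bigcup_i G i) t by rewrite -GT.
    exists (maxn i j) => //; split.
    - by move: x Fx; exact/subsetPset/ndF/leq_maxl.
    - by move: t Gt; exact/subsetPset/ndG/leq_maxr.
  move=> i; have [mF Fi] := Foo i; have [mG Gi] := Goo i; split.
    rewrite -[X in measurable X]setTI; apply: measurable_unconsp => //.
    exact: measurableX.
  rewrite nuE /pushforward -comp_preimage (_ : _ \o _ = id); last first.
    by apply/funext => p /=; rewrite conspK.
  rewrite preimage_id /lam/= product_measure1E//.
  by rewrite lte_mul_pinfty// ge0_fin_numE.
exists (sigma_finite_alias nuF).
by rewrite /= muE nuE.
Qed.

Let lebesgue_tuple0 k : @lebesgue_tuple k set0 = 0.
Proof.
have [mu ->] := lebesgue_tuple_sigma_finite_measure k.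
exact: measure0.
Qed.

Let lebesgue_tuple_ge0 k A : 0 <= @lebesgue_tuple k A.
Proof.
have [mu ->] := lebesgue_tuple_sigma_finite_measure k.
exact: measure_ge0.
Qed.

Let lebesgue_tuple_semi_sigma_additive k :
  semi_sigma_additive (@lebesgue_tuple k).
Proof.
have [mu ->] := lebesgue_tuple_sigma_finite_measure k.
exact: measure_semi_sigma_additive.
Qed.

HB.instance Definition _ k := isMeasure.Build _ _ _ (@lebesgue_tuple k)
  (@lebesgue_tuple0 k) (@lebesgue_tuple_ge0 k)
  (@lebesgue_tuple_semi_sigma_additive k).

Let lebesgue_tuple_sigma_finite k : sigma_finite setT (@lebesgue_tuple k).
Proof.
have [mu ->] := lebesgue_tuple_sigma_finite_measure k.
exact: sigma_finiteT.
Qed.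

HB.instance Definition _ k := Measure_isSigmaFinite.Build _ _ _
  (@lebesgue_tuple k) (@lebesgue_tuple_sigma_finite k).

Lemma lebesgue_tuple_box k (A : 'I_k -> set mR) :
  (forall i, measurable (A i)) ->
  lebesgue_tuple [set t : k.-tuple mR | forall i, A i (tnth t i)] =
  \prod_(i < k) @lebesgue_measure R (A i).
Proof.
elim: k A => [|k IH] A mA.
  rewrite big_ord0 /= diracE mem_set//.
  by case.
rewrite big_ord_recl -(IH (fun i => A (lift ord0 i)))//=.
rewrite /pushforward -product_measure1E//; last first.
  rewrite (_ : [set _ | _] =
    \bigcap_(i in [set: 'I_k]) ((@tnth k mR)^~ i @^-1` A (lift ord0 i))).
    apply: fin_bigcap_measurable => // i _.
    by rewrite -[X in measurable X]setTI; exact: measurable_tnth.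
  by apply/seteqP; split => t /= tA i; [move=> _|]; exact: tA.
congr (_ _); apply/seteqP; split => -[x t] /=.
  move=> tA; split; first by have := tA ord0; rewrite tnth0.
  by move=> i; have := tA (lift ord0 i); rewrite tnthS.
move=> [xA tA] i; case: (unliftP ord0 i) => [j|] ->; first by rewrite tnthS.
by rewrite tnth0.
Qed.

(* The k-dimensional Lebesgue measure induced on a k-dimensional linear
   subspace V of R^N: the subspace is identified with R^k through an orthonormal
   basis, the rows of a matrix U.  This basis is chosen arbitrarily: as the
   Lebesgue measure of R^k is invariant under orthogonal maps, the value does
   not depend on it. *)
Definition orthonormal_basis k N (V : set 'rV[R]_N) : set 'M[R]_(k, N) :=
  [set U | U *m U^T = 1%:M /\ range (fun c : 'rV[R]_k => c *m U) = V].

Definition vol k N (V A : set 'rV[R]_N) : \bar R :=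
  let U := xget 0%R (@orthonormal_basis k N V) in
  lebesgue_tuple [set t : k.-tuple mR | A ((\row_i tnth t i) *m U)].

End Volume.

(* Main.v *)
(** A section [H_a] of the convex body [Z] is compared with the slab
    [{x in Z : |<a,x>| <= eps}]: because [Z] is convex and contains a ball, the
    volume of the slab divided by [2 eps] tends to the volume of the section.

    By Tonelli the volume of the slab is an iterated average over the cube
    coordinates of a function of one variable [s], weighted by the volumes
    [kappa(s)] of the sections of [r B_2^m] orthogonal to a direction.  Let
    [Q] be the total mass of [kappa], that is the volume of [r B_2^m], let
    [kappa(0) = B] be its maximum, and [M = max(Q, B)].  The cube coordinates have a
    symmetric unimodal law, so by the bathtub principle the slab volume grows
    when [kappa] is replaced by [M] times the indicator of an interval of
    length [Q / M].  What results is the slab problem for a cube with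
    coefficient vector of norm at least [Q / M], and Ball's cube slicing
    inequality gives the bound [M sqrt 2]; the threshold decides whether [M]
    is [Q] or [B].

    In Ball's inequality, a coefficient larger than [1 / sqrt 2] times the norm
    of the vector settles the matter at once.  Otherwise the slab volume is
    bounded through its Fourier transform, a product of [sinc] functions, which
    the weighted inequality of arithmetic and geometric means separates; what
    is left is Ball's integral inequality for [|sin x / x|^p], [p > 2].  It
    follows from [int (f - s)_+ <= int (g - s)_+] for all levels [s], where
    [f x = (sin x / x)^2] and [g x = exp (- x^2 / pi)] have the same integral. *)

Require Import Defs.
From mathcomp Require Import all_boot all_order all_algebra.
From mathcomp Require Import all_classical all_reals all_analysis.
From mathcomp Require Import ring lra measurable_realfun gauss_integral.

Set Implicit Arguments.
Unset Strict Implicit.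
Unset Printing Implicit Defensive.

Import Order.TTheory GRing.Theory Num.Theory.
Import numFieldNormedType.Exports.

Local Open Scope classical_set_scope.
Local Open Scope ring_scope.

(** * Integration on the real line *)

Section LebesgueAffine.
Context {R : realType}.
Local Notation mR := (measurableTypeR R).
Local Notation lam := (@lebesgue_measure R).
Local Open Scope ereal_scope.

(** Only nonnegative functions are integrated against each other, so Tonelli always applies. In
    particular there is no Fourier inversion: a multiple of the indicator of an interval is
    dominated by an averaged Poisson kernel, which is a cosine integral damped by [exp (- e t)], and
    the damping is removed in the final inequality.

    Slabs replace sections because they are sets of full dimension, on which Tonelli and orthogonal
    invariance act directly; a section is squeezed between two multiples of a slab volume.

    [M] has to be the maximum of [Q] and [B] for two separate reasons. The bathtub principle needs
    [kappa <= M], which is [B <= M]. The interval it produces acts as one more uniform variable,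
    with coefficient [(Q / M) |b|], where [b] is the ball part of the unit normal; the new
    coefficient vector has squared norm [(Q / M)^2 |b|^2 + 1 - |b|^2], and this is at least
    [(Q / M)^2] because [Q <= M].

    In the weighted mean inequality the weights are the squared coefficients divided by their sum.
    The exponents are then the inverse weights; they exceed 2 exactly when no coefficient is large,
    and every factor receives the same bound. *)

Lemma measurable_affine (c b : R) :
  measurable_fun [set: mR] (fun x : mR => (c * x + b)%R : mR).
Proof. by apply: measurable_funD => //; exact: measurable_funM. Qed.

(** [c] times the image of Lebesgue measure under the affine map has the right value on half-open
    intervals, and these determine the measure. *)
Lemma lebesgue_measure_affine (c b : R) (A : set mR) : (0 < c)%R ->
  measurable A ->
  lam ((fun x => (c * x + b)%R) @^-1` A) = c^-1%:E * lam A.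
Proof.
move=> c0 mA.
have c0' : (0 <= c)%R by exact: ltW.
pose f : mR -> mR := fun x => (c * x + b)%R.
have mf : measurable_fun setT f by exact: measurable_affine.
have [nu nuE] : exists nu : {measure set mR -> \bar R},
    nu = mscale (NngNum c0') (pushforward lam f) :> (set _ -> _).
  unshelve eexists (mscale (NngNum c0') (pushforward lam f) :
    {measure set mR -> \bar R}); last by [].
  exact: mf.
have : lam A = nu A.
  apply: lebesgue_measure_unique => // _ [[x y]] /= _ <-.
  rewrite nuE /mscale/= /pushforward.
  have -> : f @^-1` `]x, y] = `]((x - b) / c)%R, ((y - b) / c)%R]%classic.
    apply/seteqP; split => z /=; rewrite !in_itv/= /f => /andP[h1 h2];
      apply/andP; split.
    - by rewrite ltr_pdivrMr// mulrC ltrBlDr.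
    - by rewrite ler_pdivlMr// mulrC lerBrDr.
    - by move: h1; rewrite ltr_pdivrMr// mulrC ltrBlDr.
    - by move: h2; rewrite ler_pdivlMr// mulrC lerBrDr.
  rewrite !lebesgue_measure_itv/= !lte_fin ltr_pM2r ?invr_gt0// ltrD2r.
  case: ifPn => xy; last by rewrite mule0.
  by rewrite -!EFinD -EFinM; congr EFin; field; rewrite gt_eqF.
rewrite nuE /mscale/= /pushforward => ->.
by rewrite muleA -EFinM mulVf ?gt_eqF// mul1e.
Qed.

Lemma ge0_integral_affine (c b : R) (f : R -> \bar R) : (0 < c)%R ->
  measurable_fun [set: mR] f -> (forall x, 0 <= f x) ->
  \int[lam]_x f (c * x + b)%R = c^-1%:E * \int[lam]_x f x.
Proof.
move=> c0 mf f0.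
have c0' : (0 <= c^-1)%R by rewrite invr_ge0 ltW.
have := ge0_integral_pushforward (measurable_affine c b) lam measurableT mf
  (fun y _ => f0 y).
rewrite preimage_setT => <-.
rewrite (eq_measure_integral (mscale (NngNum c0') lam)); last first.
  by move=> mf' A mA _; rewrite /= /mscale/= -(lebesgue_measure_affine b c0 mA).
  exact: measurable_affine.
by rewrite ge0_integral_mscale.
Qed.

Lemma ge0_integral_shift (b : R) (f : R -> \bar R) :
  measurable_fun [set: mR] f -> (forall x, 0 <= f x) ->
  \int[lam]_x f (x + b)%R = \int[lam]_x f x.
Proof.
move=> mf f0; have := ge0_integral_affine b ltr01 mf f0.
by rewrite invr1 mul1e => <-; under [RHS]eq_integral do rewrite mul1r.
Qed.

Lemma ge0_integral_opp (f : R -> \bar R) :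
  measurable_fun [set: mR] f -> (forall x, 0 <= f x) ->
  \int[lam]_x f (- x)%R = \int[lam]_x f x.
Proof.
move=> mf f0.
have mN : measurable_fun setT (-%R : mR -> mR) by exact: oppr_measurable.
have := ge0_integral_pushforward mN lam measurableT mf (fun y _ => f0 y).
rewrite preimage_setT => <-.
by apply: eq_measure_integral => A mA _; exact: lebesgue_measureN.
Qed.

Lemma ge0_integral_scale0y (c : R) (f : R -> \bar R) : (0 < c)%R ->
  measurable_fun [set: mR] f -> (forall x, (0 <= x)%R -> 0 <= f x) ->
  \int[lam]_(x in `[0%R, +oo[) f (c * x)%R =
  c^-1%:E * \int[lam]_(x in `[0%R, +oo[) f x.
Proof.
move=> c0 mf f0; rewrite integral_mkcond [in RHS]integral_mkcond.
rewrite -(ge0_integral_affine 0 c0).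
- apply: eq_integral => x _; rewrite addr0 !patchE !mem_setE.
  by rewrite !in_itv/= !andbT pmulr_rge0.
- by apply/(measurable_restrictT _ _).1 => //; exact: measurable_funTS.
- move=> x; rewrite patchE mem_setE in_itv/= andbT.
  by case: ifPn => // x0; exact: f0.
Qed.

End LebesgueAffine.

Section RestrictedTonelli.
Local Open Scope ereal_scope.
Context d1 d2 (T1 : measurableType d1) (T2 : measurableType d2) (R : realType).
Context (m1 : {sigma_finite_measure set T1 -> \bar R})
  (m2 : {sigma_finite_measure set T2 -> \bar R}).

(** Restricting [f] to [D x E] reduces this to the whole product, so the sign of [f] matters only
    there; integrands such as [t exp (- t x)] are nonnegative only for [t >= 0]. *)
Lemma restricted_tonelli (D : set T1) (E : set T2) (f : T1 * T2 -> \bar R) :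
  measurable D -> measurable E -> measurable_fun setT f ->
  (forall x y, D x -> E y -> 0 <= f (x, y)) ->
  \int[m1]_(x in D) \int[m2]_(y in E) f (x, y) =
  \int[m2]_(y in E) \int[m1]_(x in D) f (x, y).
Proof.
move=> mD mE mf f0.
pose g := f \_ (D `*` E).
have mg : measurable_fun setT g.
  apply/(measurable_restrictT _ _).1; first exact: measurableX.
  exact: measurable_funTS.
have g0 z : 0 <= g z.
  rewrite /g patchE; case: ifPn => //; rewrite inE => -[]; case: z => x y /=.
  exact: f0.
rewrite integral_mkcond [RHS]integral_mkcond.
transitivity (\int[m1]_x \int[m2]_y g (x, y)).
  apply: eq_integral => x _; rewrite patchE; case: ifPn => [xD|xD].
    rewrite integral_mkcond; apply: eq_integral => y _.
    by rewrite /g !patchE in_setX /= xD.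
  apply/esym/integral0_eq => y _.
  by rewrite /g patchE in_setX /= (negbTE xD).
rewrite fubini_tonelli//.
apply: eq_integral => y _; rewrite patchE; case: ifPn => [yE|yE].
  rewrite [RHS]integral_mkcond; apply: eq_integral => x _.
  by rewrite /g !patchE in_setX /= yE andbT.
apply/integral0_eq => x _.
by rewrite /g patchE in_setX /= (negbTE yE) andbF.
Qed.

End RestrictedTonelli.

Section MeasurableComp.
Context d (T : measurableType d) {R : realType}.
Implicit Types (D : set T) (f : T -> R).

Lemma measurable_fun_comp_real D (g : R -> R) f :
  measurable_fun setT g -> measurable_fun D f ->
  measurable_fun D (fun x => g (f x)).
Proof. exact: measurableT_comp. Qed.

Lemma measurable_fun_expR D f :
  measurable_fun D f -> measurable_fun D (fun x => expR (f x)).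
Proof. by apply: measurable_fun_comp_real; exact: measurable_expR. Qed.

Lemma measurable_fun_sin D f :
  measurable_fun D f -> measurable_fun D (fun x => sin (f x)).
Proof.
apply: measurable_fun_comp_real; apply: continuous_measurable_fun.
exact: continuous_sin.
Qed.

Lemma measurable_fun_cos D f :
  measurable_fun D f -> measurable_fun D (fun x => cos (f x)).
Proof.
apply: measurable_fun_comp_real; apply: continuous_measurable_fun.
exact: continuous_cos.
Qed.

End MeasurableComp.

Section FTC.
Context {R : realType}.
Local Notation lam := (@lebesgue_measure R).
Implicit Types f F : R -> R.

Lemma is_derive_continuous f (x df : R) :
  is_derive x 1 f df -> {for x, continuous f}.
Proof.
by move=> dfx; apply: differentiable_continuous; apply/derivable1_diffP.
Qed.

Lemma integral_segment_derive f F (a b : R) : a <= b ->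
  (forall x, a <= x <= b -> is_derive x 1 F (f x)) ->
  (forall x, a <= x <= b -> {for x, continuous f}) ->
  (\int[lam]_(x in `[a, b]) (f x)%:E = (F b - F a)%:E)%E.
Proof.
rewrite le_eqVlt => /predU1P[->|ab] dF cf.
  by rewrite set_itv1 integral_set1 subrr.
have cF x : a <= x <= b -> {for x, continuous F}.
  by move=> xab; apply: is_derive_continuous (dF _ xab).
rewrite (@continuous_FTC2 _ f F)//.
- apply: continuous_in_subspaceT => x; rewrite inE/= in_itv/=; exact: cf.
- split.
  + move=> x; rewrite in_itv/= => /andP[ax xb].
    have H : a <= x <= b by rewrite !ltW.
    by have [] := dF _ H.
  + by apply: cvg_at_right_filter; apply: cF; rewrite lexx ltW.
  + by apply: cvg_at_left_filter; apply: cF; rewrite lexx ltW.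
- move=> x; rewrite in_itv/= => /andP[ax xb].
  have H : a <= x <= b by rewrite !ltW.
  by rewrite derive1E; have [] := dF _ H.
Qed.

Lemma integral_itvy_derive f F (a l c : R) :
  (forall x, a <= x -> is_derive x 1 F (f x)) ->
  (forall x, a <= x -> {for x, continuous f}) ->
  (forall x, a <= x -> 0 <= f x) ->
  F x @[x --> +oo] --> l ->
  l - F a = c ->
  (\int[lam]_(x in `[a, +oo[) (f x)%:E = c%:E)%E.
Proof.
move=> dF cf f0 Fl <-.
rewrite (@ge0_continuous_FTC2y _ f F a l)//.
- apply: continuous_in_subspaceT => x; rewrite inE/= in_itv/= andbT; exact: cf.
- by move=> x /ltW/dF[].
- apply: cvg_at_right_filter; apply: is_derive_continuous (dF _ _); exact: lexx.
- by move=> x; rewrite in_itv/= andbT => /ltW/dF[? <-]; rewrite derive1E.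
Qed.

(** Decay of order [1 / x] is crude, but it covers most primitives below, whose exponentials are
    bounded by [expRN_le_inv]. *)
Lemma cvgy0_le f (C : R) : (forall x, 1 <= x -> `|f x| <= C / x) ->
  f x @[x --> +oo] --> (0 : R).
Proof.
move=> fC; apply/cvgr0Pnorm_le => e e0; near=> x.
have x1 : 1 <= x by near: x; apply: nbhs_pinfty_ge; rewrite num_real.
rewrite (le_trans (fC _ x1))// ler_pdivrMr// mulrC -ler_pdivrMr//.
Unshelve. all: by end_near. Qed.

End FTC.

Section ExplicitIntegrals.
Context {R : realType}.
Local Notation lam := (@lebesgue_measure R).

Lemma expRN_le_inv (x : R) : 0 < x -> expR (- x) <= x^-1.
Proof.
move=> x0; rewrite expRN lef_pV2 ?posrE ?expR_gt0//.
by rewrite (le_trans _ (expR_ge1Dx x))// lerDr.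
Qed.

Lemma expR_ge1D2 (x : R) : 0 <= x -> 1 + x ^+ 2 / 2 <= expR x.
Proof. by move=> x0; have := expR_ge1Dxn 1 x0. Qed.

Lemma integral_t_expRNM (x : R) : 0 < x ->
  (\int[lam]_(t in `[0%R, +oo[) (t * expR (- (t * x)))%:E = (x ^- 2)%:E)%E.
Proof.
move=> x0.
pose F (t : R) := - ((t / x + x ^- 2) * expR (- (t * x))).
have xn0 : x != 0 by rewrite gt_eqF.
apply: (@integral_itvy_derive R _ F 0 0).
- move=> t _; rewrite /F; apply: is_derive_eq; rewrite /GRing.scale/=.
  by field.
- move=> t _.
  apply: is_derive_continuous; apply: is_derive_eq; reflexivity.
- by move=> t t0; rewrite mulr_ge0// expR_ge0.
- rewrite -oppr0; apply: cvgN.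
  (* The linear prefactor needs [exp y >= 1 + y^2 / 2] and contributes [2 / (x^3 t)]; for the
     constant one [exp (- y) <= 1 / y] gives [1 / (x^3 t)]. *)
  apply: (@cvgy0_le _ _ (2 / x ^+ 3 + x ^- 3)) => t t1.
  have t0 : 0 < t by rewrite (lt_le_trans ltr01).
  have tx0 : 0 < t * x by rewrite mulr_gt0.
  have q0 : 0 < t / x + x ^- 2.
    by rewrite addr_gt0 ?divr_gt0// invr_gt0 exprn_gt0.
  rewrite ger0_norm; last by rewrite mulr_ge0 ?expR_ge0 1?ltW.
  rewrite mulrDl [leRHS]mulrDl; apply: lerD.
  + rewrite expRN ler_pdivrMr ?expR_gt0//.
    apply: (@le_trans _ _ (2 / x ^+ 3 / t * (1 + (t * x) ^+ 2 / 2))).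
      have -> : 2 / x ^+ 3 / t * (1 + (t * x) ^+ 2 / 2) = 2 / x ^+ 3 / t + t / x.
        by field; rewrite xn0 gt_eqF.
      by rewrite lerDr !divr_ge0// ?exprn_ge0// ltW.
    by rewrite ler_wpM2l ?expR_ge1D2// ?divr_ge0// ?exprn_ge0// ltW.
  + apply: (@le_trans _ _ (x ^- 2 * (t * x)^-1)).
      by rewrite ler_wpM2l ?expRN_le_inv// invr_ge0 exprn_ge0// ltW.
    by rewrite le_eqVlt; apply/orP; left; apply/eqP; field; rewrite xn0 gt_eqF.
- by rewrite /F !mul0r oppr0 expR0; ring.
Qed.

Lemma integral_sin2_expRNM (t : R) : 0 < t ->
  (\int[lam]_(x in `[0%R, +oo[) (sin x ^+ 2 * (t * expR (- (t * x))))%:E =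
   (2 / (t ^+ 2 + 4))%:E)%E.
Proof.
move=> t0.
have d0 : t ^+ 2 + 4 != 0 by rewrite gt_eqF// ltr_wpDl// sqr_ge0.
pose F (x : R) := - (expR (- (t * x)) * (1 / 2 +
  (t / 2) * ((2 * sin (2 * x) - t * cos (2 * x)) / (t ^+ 2 + 4)))).
apply: (@integral_itvy_derive R _ F 0 0).
- move=> x _; rewrite /F; apply: is_derive_eq; rewrite /GRing.scale/=.
  have -> : cos (2 * x) = 1 - 2 * sin x ^+ 2.
    rewrite mulr_natl cos_mulr2n cos2sin2; ring.
  by field.
- move=> x _.
  apply: is_derive_continuous; apply: is_derive_eq; reflexivity.
- by move=> x x0; rewrite mulr_ge0 ?sqr_ge0// mulr_ge0 ?expR_ge0// ltW.
- rewrite -oppr0; apply: cvgN.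
  apply: (@cvgy0_le _ _ ((1 / 2 + (t / 2) * ((2 + t) / (t ^+ 2 + 4))) / t)) => x x1.
  have x0 : 0 < x by rewrite (lt_le_trans ltr01).
  rewrite normrM (ger0_norm (expR_ge0 _)) mulrC -[leRHS]mulrA -invfM.
  rewrite ler_pM// ?expR_ge0// ?expRN_le_inv ?mulr_gt0//.
  rewrite (le_trans (ler_normD _ _))// lerD//.
    by rewrite ger0_norm.
  have d00 : 0 < t ^+ 2 + 4 by rewrite ltr_wpDl// sqr_ge0.
  have t0' := ltW t0; have d0' : 0 <= (t ^+ 2 + 4)^-1 by rewrite invr_ge0 ltW.
  rewrite normrM ger0_norm ?divr_ge0// ler_wpM2l ?divr_ge0//.
  rewrite normrM (ger0_norm d0') ler_wpM2r//.
  rewrite (le_trans (ler_normB _ _))// lerD// normrM ger0_norm//.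
    by rewrite ler_piMr// sin_max.
  by rewrite ler_piMr// ?cos_max// ltW.
- rewrite /F !mulr0 oppr0 expR0 sin0 cos0.
  by field.
Qed.

(** As a function of [x] this is the Poisson kernel [e / (e^2 + x^2)], raised by the contribution
    [1 / e] of the summand 1. *)
Lemma integral_expRNM_cos (e x : R) : 0 < e ->
  (\int[lam]_(t in `[0%R, +oo[) (expR (- (e * t)) * (1 + cos (t * x)))%:E =
   (1 / e + e / (e ^+ 2 + x ^+ 2))%:E)%E.
Proof.
move=> e0.
have d0 : e ^+ 2 + x ^+ 2 != 0 by rewrite gt_eqF// ltr_pwDl ?sqr_ge0 ?exprn_gt0.
pose F (t : R) := - (expR (- (e * t)) * (1 / e +
  (e * cos (t * x) - x * sin (t * x)) / (e ^+ 2 + x ^+ 2))).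
have en0 : e != 0 by rewrite gt_eqF.
apply: (@integral_itvy_derive R _ F 0 0).
- move=> t _; rewrite /F; apply: is_derive_eq; rewrite /GRing.scale/=.
  by field; rewrite d0 en0.
- move=> t _.
  apply: is_derive_continuous; apply: is_derive_eq; reflexivity.
- move=> t t0; rewrite mulr_ge0 ?expR_ge0//; have := cos_geN1 (t * x); lra.
- rewrite -oppr0; apply: cvgN.
  apply: (@cvgy0_le _ _ ((1 / e + (e + `|x|) / (e ^+ 2 + x ^+ 2)) / e)) => t t1.
  have t0 : 0 < t by rewrite (lt_le_trans ltr01).
  rewrite normrM (ger0_norm (expR_ge0 _)) mulrC -[leRHS]mulrA -invfM.
  rewrite ler_pM// ?expR_ge0// ?expRN_le_inv ?mulr_gt0//.
  rewrite (le_trans (ler_normD _ _))// lerD//.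
    by rewrite ger0_norm// divr_ge0// ltW.
  have d00 : 0 < e ^+ 2 + x ^+ 2 by rewrite ltr_pwDl ?sqr_ge0 ?exprn_gt0.
  have d0' : 0 <= (e ^+ 2 + x ^+ 2)^-1 by rewrite invr_ge0 ltW.
  rewrite normrM (ger0_norm d0') ler_wpM2r//.
  rewrite (le_trans (ler_normB _ _))// lerD// normrM.
    by rewrite (gtr0_norm e0) ler_piMr ?cos_max // ltW.
  by rewrite ler_piMr// sin_max.
- rewrite /F !mulr0 mul0r oppr0 expR0 sin0 cos0.
  by field; rewrite d0 en0.
Qed.

End ExplicitIntegrals.

(** * Ball's integral inequality *)

Section SinBounds.
Context {R : realType}.

Lemma is_derive_ge0_le (F f : R -> R) (a b : R) : a <= b ->
  (forall x, a <= x <= b -> is_derive x 1 F (f x)) ->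
  (forall x, a <= x <= b -> 0 <= f x) -> F a <= F b.
Proof.
move=> ab dF f0.
have [||c /= cab E] := @MVT_segment R F f a b ab.
- move=> x; rewrite in_itv/= => /andP[ax xb]; apply: dF.
  by rewrite !ltW.
- apply: continuous_in_subspaceT => x; rewrite inE/= in_itv/= => /dF.
  exact: is_derive_continuous.
by rewrite -subr_ge0 E mulr_ge0 ?subr_ge0// f0//; move: cab; rewrite in_itv.
Qed.

(** This bound and the next two are Taylor estimates, each obtained by integrating the preceding one
    from 0. *)
Lemma sin_le (x : R) : 0 <= x -> sin x <= x.
Proof.
move=> x0; rewrite -subr_ge0.
pose F (y : R) := y - sin y.
have dF (y : R) : is_derive y 1 F (1 - cos y).
  by rewrite /F; apply: is_derive_eq; rewrite /GRing.scale/=; ring.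
have : F 0 <= F x; last by rewrite /F sin0 subrr.
apply: (is_derive_ge0_le x0 (fun y _ => dF y)).
by move=> y _; rewrite subr_ge0 cos_le1.
Qed.

Lemma cos_ge1B (x : R) : 0 <= x -> 1 - x ^+ 2 / 2 <= cos x.
Proof.
move=> x0; rewrite -subr_ge0.
pose F (y : R) := cos y - (1 - y ^+ 2 / 2).
have dF (y : R) : is_derive y 1 F (y - sin y).
  by rewrite /F; apply: is_derive_eq; rewrite /GRing.scale/=; field.
have : F 0 <= F x; last by rewrite /F cos0 expr0n/= mul0r subr0 subrr.
apply: (is_derive_ge0_le x0 (fun y _ => dF y)).
by move=> y /andP[y0 _]; rewrite subr_ge0 sin_le.
Qed.

Lemma sin_geB (x : R) : 0 <= x -> x - x ^+ 3 / 6 <= sin x.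
Proof.
move=> x0; rewrite -subr_ge0.
pose F (y : R) := sin y - (y - y ^+ 3 / 6).
have dF (y : R) : is_derive y 1 F (cos y - (1 - y ^+ 2 / 2)).
  by rewrite /F; apply: is_derive_eq; rewrite /GRing.scale/=; field.
have : F 0 <= F x; last by rewrite /F sin0 expr0n/= mul0r !subr0.
apply: (is_derive_ge0_le x0 (fun y _ => dF y)).
by move=> y /andP[y0 _]; rewrite subr_ge0 cos_ge1B.
Qed.

Lemma expR_ge_quadratic (x : R) : 0 <= x -> 1 + x + x ^+ 2 / 2 <= expR x.
Proof.
move=> x0; rewrite -subr_ge0.
pose F (y : R) := expR y - (1 + y + y ^+ 2 / 2).
have dF (y : R) : is_derive y 1 F (expR y - (1 + y)).
  by rewrite /F; apply: is_derive_eq; rewrite /GRing.scale/=; field.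
have : F 0 <= F x; last by rewrite /F expR0 expr0n/= mul0r !addr0 subrr.
apply: (is_derive_ge0_le x0 (fun y _ => dF y)).
by move=> y _; rewrite subr_ge0 expR_ge1Dx.
Qed.

(** By the triple angle formula [s = sin (pi / 6)] is a root of
    [4 s^3 - 3 s + 1 = (s + 1) (2 s - 1)^2]. The value yields the numerical bounds on [pi]. *)
Lemma sin_pi6 : sin (pi / 6) = 1 / 2 :> R.
Proof.
have s0 : 0 < sin (pi / 6 : R).
  by apply: sin_gt0_pi; have := pi_gt0 R => h; apply/andP; split; lra.
have : sin (pi / 6 *+ 2 + pi / 6) = 1 :> R.
  by rewrite -[RHS]sin_pihalf; congr sin; rewrite -mulr_natr; field.
rewrite sinD sin_mulr2n cos_mulr2n => E.
have E2 : cos (pi / 6) ^+ 2 = 1 - sin (pi / 6) ^+ 2 :> R by exact: cos2sin2.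
set s := sin (pi / 6) in s0 E E2 *; set c := cos (pi / 6) in E E2 *.
have E3 : (s + 1) * (2 * s - 1) ^+ 2 = 0.
  have -> : (s + 1) * (2 * s - 1) ^+ 2 =
    1 - ((c * s) *+ 2 * c + (c ^+ 2 *+ 2 - 1) * s) +
    4 * s * (c ^+ 2 - (1 - s ^+ 2)) by ring.
  by rewrite E E2; ring.
move/eqP: E3; rewrite mulf_eq0 => /orP[/eqP|]; first lra.
by rewrite sqrf_eq0 => /eqP; lra.
Qed.

Lemma pi_ge3 : 3 <= pi :> R.
Proof.
have := @sin_le (pi / 6); rewrite sin_pi6 => h.
by have := pi_gt0 R; move: h => /[swap] p0; lra.
Qed.

Lemma pi_le32 : pi <= 16 / 5 :> R.
Proof.
rewrite leNgt; apply/negP => h.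
have := pi_gt0 R; have := pihalf_lt2 R => p2 p0.
(* [8 / 15] is a sixth of [16 / 5], and the cubic Taylor bound already puts its sine above
   [1 / 2]. *)
have : sin (8 / 15) < sin (pi / 6) :> R.
  by rewrite ltr_sin ?in_itv/=; [lra|apply/andP; split; lra|apply/andP; split; lra].
rewrite sin_pi6; have := @sin_geB (8 / 15); lra.
Qed.

Lemma sin_ge_mulcos (x : R) : 0 <= x <= pi -> 0 <= sin x - x * cos x.
Proof.
move=> /andP[x0 xp].
pose F (y : R) := sin y - y * cos y.
have dF (y : R) : is_derive y 1 F (y * sin y).
  by rewrite /F; apply: is_derive_eq; rewrite /GRing.scale/=; ring.
have : F 0 <= F x; last by rewrite /F sin0 mul0r subrr.
apply: (is_derive_ge0_le x0 (fun y _ => dF y)).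
move=> y /andP[y0 yx]; rewrite mulr_ge0// sin_ge0_pi// y0/=.
exact: le_trans xp.
Qed.

(** Up to a positive factor this expression is minus the derivative of [sin x exp (x^2 / 6) / x]. *)
Lemma sin_mulcos_le (x : R) : 0 <= x <= pi ->
  0 <= sin x - x * cos x - x ^+ 2 / 3 * sin x.
Proof.
move=> /andP[x0 xp].
pose F (y : R) := sin y - y * cos y - y ^+ 2 / 3 * sin y.
have dF (y : R) : is_derive y 1 F (y / 3 * (sin y - y * cos y)).
  by rewrite /F; apply: is_derive_eq; rewrite /GRing.scale/=; field.
have : F 0 <= F x; last by rewrite /F sin0 mul0r mulr0 !subr0.
apply: (is_derive_ge0_le x0 (fun y _ => dF y)).
move=> y /andP[y0 yx]; rewrite mulr_ge0 ?divr_ge0// sin_ge_mulcos// y0/=.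
exact: le_trans xp.
Qed.

(* [sin x exp(x^2/6) / x] decreases on (0, pi), and tends to 1 at 0. *)
Lemma sin_le_gauss (x : R) : 0 < x <= pi -> sin x <= x * expR (- (x ^+ 2 / 6)).
Proof.
move=> /andP[x0 xp].
pose D (y : R) := sin y * expR (y ^+ 2 / 6) / y.
have Dle t : 0 < t -> t <= x -> D x <= expR (t ^+ 2 / 6).
  move=> t0 tx; apply: (@le_trans _ _ (D t)); last first.
    rewrite /D ler_pdivrMr// mulrC ler_wpM2l ?expR_ge0// sin_le// ltW//.
  have dD (y : R) : t <= y <= x -> is_derive y 1 (fun y => - D y)
      (expR (y ^+ 2 / 6) / y ^+ 2 * (sin y - y * cos y - y ^+ 2 / 3 * sin y)).
    move=> /andP[ty yx]; have y0 : y != 0 by rewrite gt_eqF// (lt_le_trans t0).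
    have dV := is_deriveV y0 (is_derive_id y (1 : R)).
    rewrite /D; apply: is_derive_eq; rewrite /GRing.scale/=.
    by field.
  rewrite -lerN2; apply: (is_derive_ge0_le tx dD).
  move=> y /andP[ty yx]; rewrite mulr_ge0 ?divr_ge0 ?expR_ge0 ?exprn_ge0//.
    by rewrite (le_trans _ ty)// ltW.
  by apply: sin_mulcos_le; rewrite (le_trans (ltW t0) ty) (le_trans yx xp).
have D1 : D x <= 1.
  apply/ler_addgt0Pr => e e0.
  (* This point replaces the limit at 0: [t^2 <= e] and [t^2 e <= e] give
     [exp (t^2 / 6) <= 1 + e]. *)
  pose t := Num.min x (Num.min 1 e).
  have t0 : 0 < t by rewrite /t !lt_min x0 ltr01 e0.
  have tx : t <= x by rewrite ge_min lexx.
  have t1 : t <= 1 by rewrite !ge_min lexx orbT.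
  have te : t <= e by rewrite !ge_min lexx !orbT.
  apply: le_trans (Dle t t0 tx) _.
  have tt : t ^+ 2 <= t by rewrite expr2 ler_piMr// ltW.
  rewrite -[expR _]invrK -expRN -[leRHS]invrK lef_pV2 ?posrE ?expR_gt0//; last first.
    by rewrite invr_gt0 addr_gt0.
  apply: le_trans (expR_ge1Dx _).
  rewrite -div1r ler_pdivrMr ?addr_gt0//.
  have t21 : t ^+ 2 * e <= e by rewrite ler_piMl ?(le_trans tt)// ltW.
  rewrite mulrBl mul1r mulrDr mulr1; lra.
rewrite expRN ler_pdivlMr ?expR_gt0//.
by move: D1; rewrite /D ler_pdivrMr// mul1r.
Qed.

End SinBounds.

(** * The integrals of [(sin x / x)^2] and of Gaussians *)

Section SincIntegrals.
Context {R : realType}.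
Local Notation lam := (@lebesgue_measure R).

Lemma measurable_invr : measurable_fun [set: R] (fun x : R => x^-1).
Proof.
(* [powR] is measurable on the whole line; the factor [x] restores the sign, and both sides are 0 at
   0. *)
rewrite (_ : (fun x => _) = (fun x : R => x * (x ^+ 2) `^ (-1))).
  apply: measurable_funM => //.
  apply: (measurableT_comp (measurable_powR (-1))); exact: measurable_funX.
apply/funext => x; rewrite powR_inv1 ?sqr_ge0//.
have [->|x0] := eqVneq x 0; first by rewrite mul0r invr0.
by field.
Qed.

Lemma measurable_sinc : measurable_fun [set: R] (fun x : R => sin x / x).
Proof.
apply: measurable_funM; last exact: measurable_invr.
by apply: continuous_measurable_fun; exact: continuous_sin.
Qed.

(** As [x^-2] is the integral of [t exp (- t x)] over [t > 0], Tonelli turns the integral into that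
    of [2 / (t^2 + 4)], whose primitive is [atan (t / 2)]. *)
Lemma integral_sinc2_le :
  (\int[lam]_(x in `]0%R, +oo[) ((sin x / x) ^+ 2)%:E <= (pi / 2)%:E)%E.
Proof.
pose f (z : R * R) := (sin z.1 ^+ 2 * (z.2 * expR (- (z.2 * z.1))))%:E.
have mf : measurable_fun setT f.
  apply/measurable_EFinP; apply: measurable_funM.
    by apply: measurable_funX; exact: measurable_fun_sin.
  apply: measurable_funM => //.
  apply: measurable_fun_expR.
  by apply: measurable_funN; exact: measurable_funM.
have f0 (x y : R) : `]0, +oo[%classic x -> `]0, +oo[%classic y -> (0 <= f (x, y))%E.
  rewrite /= !in_itv/= !andbT => x0 y0.
  by rewrite lee_fin mulr_ge0 ?sqr_ge0// mulr_ge0 ?expR_ge0// ltW.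
have m1 (x : R) : measurable_fun [set: R] (fun t : R => t * expR (- (t * x))).
  apply: measurable_funM => //; apply: measurable_fun_expR.
  by apply: measurable_funN; exact: measurable_funM.
have -> : (\int[lam]_(x in `]0%R, +oo[) ((sin x / x) ^+ 2)%:E =
    \int[lam]_(x in `]0%R, +oo[) \int[lam]_(y in `]0%R, +oo[) f (x, y))%E.
  apply: eq_integral => x; rewrite inE/= in_itv/= andbT => x0.
  rewrite /f/=; under eq_integral do rewrite EFinM.
  rewrite ge0_integralZl ?lee_fin ?sqr_ge0//.
  - rewrite integral_itv_obnd_cbnd; last exact/measurable_EFinP/measurable_funTS.
    by rewrite integral_t_expRNM// -EFinM exprMn exprVn.
  - by apply/measurable_EFinP/measurable_funTS; exact: m1.
  - move=> t/=; rewrite in_itv/= andbT => t0.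
    by rewrite lee_fin mulr_ge0 ?expR_ge0// ltW.
rewrite restricted_tonelli//.
have d4 (t : R) : 0 < t ^+ 2 + 4 by rewrite ltr_wpDl ?sqr_ge0.
have cF (t : R) : {for t, continuous (fun t : R => 2 / (t ^+ 2 + 4))}.
  apply: is_derive_continuous.
  have h' := lt0r_neq0 (d4 t).
  have dG : is_derive t 1 (fun t : R => t ^+ 2 + 4) (2 * t).
    by apply: is_derive_eq; rewrite /GRing.scale/=; ring.
  by apply: is_derive_eq.
have <- : (\int[lam]_(t in `[0%R, +oo[) (2 / (t ^+ 2 + 4))%:E = (pi / 2)%:E)%E.
  have dF (t : R) : is_derive t 1 (fun t : R => atan (t / 2)) (2 / (t ^+ 2 + 4)).
    apply: is_derive_eq; rewrite /GRing.scale/=.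
    have -> : 1 + (t / 2) ^+ 2 = (t ^+ 2 + 4) / 4 by field.
    by have h' := lt0r_neq0 (d4 t); field; rewrite h'.
  apply: (@integral_itvy_derive R _ (fun t : R => atan (t / 2)) 0 (pi / 2)).
  - by move=> t t0; exact: cF.
  - by move=> t t0; rewrite divr_ge0// ltW.
  - have h : (t : R) / 2 @[t --> +oo] --> +oo.
      by apply: gt0_cvgMly => //; exact: cvg_id.
    apply: cvg_comp h _; exact: cvgy_atan.
  - by rewrite mul0r atan0 subr0.
rewrite -[leRHS]integral_itv_obnd_cbnd; last first.
  apply/measurable_EFinP/measurable_funTS.
  by apply: continuous_measurable_fun => t; exact: cF.
rewrite le_eqVlt; apply/orP; left; apply/eqP.
apply: eq_integral => t; rewrite inE/= in_itv/= andbT => t0.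
rewrite integral_itv_obnd_cbnd ?integral_sin2_expRNM//.
apply/measurable_EFinP/measurable_funTS; apply: measurable_funM => //.
  by apply: measurable_funX => /=; exact: measurable_fun_sin.
apply: measurable_funM => //; apply: measurable_fun_expR.
by apply: measurable_funN => /=; exact: measurable_funM.
Qed.

Lemma integral_gauss_scaled (c : R) : 0 < c ->
  (\int[lam]_(x in `]0%R, +oo[) (expR (- (c * x ^+ 2)))%:E =
   (Num.sqrt (pi / c) / 2)%:E)%E.
Proof.
move=> c0; have s0 : 0 < Num.sqrt c by rewrite sqrtr_gt0.
have mg : measurable_fun [set: R] (fun x : R => (gauss_fun x)%:E).
  by apply/measurable_EFinP; exact: measurable_gauss_fun.
rewrite integral_itv_obnd_cbnd; last first.
  apply/measurable_EFinP/measurable_funTS.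
  apply: measurable_fun_expR.
  by apply: measurable_funN; apply: measurable_funM => //; exact: measurable_funX.
have := @ge0_integral_scale0y R (Num.sqrt c) (fun x => (gauss_fun x)%:E) s0 mg
  (fun x _ => gauss_fun_ge0 x).
rewrite integral0y_gauss.
under eq_integral do rewrite /gauss_fun exprMn (sqr_sqrtr (ltW c0)).
move=> ->; rewrite -EFinM sqrtrM ?pi_ge0// sqrtrV ?ltW//; congr EFin.
by rewrite mulrCA mulrA.
Qed.

End SincIntegrals.

(** * Comparison of [(sin x / x)^2] with the Gaussian, level by level *)

Section SincLevels.
Context {R : realType}.
Local Notation lam := (@lebesgue_measure R).

(* The comparison at level [exp (- v)] of the explicit bounds for the truncated
   integrals of the Gaussian and of [(sin x / x) ^ 2]. *)
Lemma gauss_level_numeric (v : R) : expR (- v) < 1 / 16 ->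
  Num.sqrt (pi * v) + pi / (2 * Num.sqrt (pi * v)) + 1 / 4 <= expR (v / 2).
Proof.
move=> ve.
have p3 := @pi_ge3 R; have p32 := @pi_le32 R.
have e16 : 16 < expR v.
  by move: ve; rewrite expRN div1r ltf_pV2 ?posrE ?expR_gt0.
have v52 : 5 / 2 <= v.
  rewrite leNgt; apply/negP => v52.
  (* Since [5 / 2 = 20 / 8] and [exp (1 / 8) <= 8 / 7], a smaller [v] would give
     [exp v <= (8 / 7)^20 < 16]. *)
  have : expR v <= expR (8^-1 * 20).
    by rewrite ler_expR; lra.
  have h : expR (8^-1 : R) <= 8 / 7.
    rewrite -[expR _]invrK -expRN -[leRHS]invrK lef_pV2 ?posrE ?expR_gt0 ?invr_gt0//.
    by apply: le_trans (expR_ge1Dx _); lra.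
  rewrite expRM_natr.
  have : expR (8^-1 : R) ^+ 20 <= (8 / 7) ^+ 20.
    by rewrite lerXn2r ?nnegrE ?expR_ge0//.
  lra.
have w4 : 4 <= expR (v / 2).
  rewrite -(@ler_pXn2r _ 2) ?nnegrE ?expR_ge0//.
  by rewrite -expRM_natr divfK//; lra.
(* Essentially the tangent at [v / 2 = 142 / 100], where the exponential is just above 4: [2 v - 42
   / 25 = 4 (1 + v / 2 - 142 / 100)]. *)
have w2 : 2 * v - 42 / 25 <= expR (v / 2).
  have -> : v / 2 = (71 / 200) * 4 + (v / 2 - 142 / 100) by field.
  rewrite expRD expRM_natr.
  have h1 : 17 / 12 <= expR (71 / 200 : R).
    by apply: le_trans (expR_ge_quadratic _); lra.
  have h4 : 4 <= expR (71 / 200 : R) ^+ 4.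
    have : (17 / 12) ^+ 4 <= expR (71 / 200 : R) ^+ 4.
      by rewrite lerXn2r ?nnegrE ?expR_ge0//; lra.
    by lra.
  have h2 := expR_ge1Dx (v / 2 - 142 / 100).
  have -> : 2 * v - 42 / 25 = 4 * (1 + (v / 2 - 142 / 100)) by field.
  by rewrite ler_pM//; lra.
have v0 : 0 < pi * v by rewrite mulr_gt0 ?pi_gt0//; lra.
set Y := Num.sqrt (pi * v).
have Y0 : 0 < Y by rewrite sqrtr_gt0.
have Y2 : Y ^+ 2 = pi * v by rewrite sqr_sqrtr// ltW.
have piv : pi * v <= 16 / 5 * v by rewrite ler_wpM2r//; lra.
have piv' : 3 * v <= pi * v by rewrite ler_wpM2r//; lra.
(* The square root is linearised by [6 Y <= Y^2 + 9]; near the critical [v = 71 / 25] the value of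
   [Y] is close to 3. *)
have Yle : Y <= (16 / 15 * v + 3) / 2.
  have : 0 <= (Y - 3) ^+ 2 by exact: sqr_ge0.
  by rewrite sqrrB -mulr_natr Y2; lra.
have Yge : 27 / 10 <= Y.
  rewrite leNgt; apply/negP => Yl.
  have : Y ^+ 2 <= (27 / 10) ^+ 2 by rewrite lerXn2r ?nnegrE ?ltW//; lra.
  by rewrite Y2; lra.
have piY : pi / (2 * Y) <= 3 / 5.
  by rewrite ler_pdivrMr ?mulr_gt0//; lra.
(* The lower bounds 4 and [2 v - 42 / 25] for [exp (v / 2)] agree at [71 / 25]. *)
have [vl|vl] := leP v (71 / 25); lra.
Qed.

Lemma ge0_integral_oy_split (a b : R) (f : R -> \bar R) : a <= b ->
  measurable_fun [set: R] f -> (forall x, a < x -> (0 <= f x)%E) ->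
  (\int[lam]_(x in `]a, +oo[) f x =
   \int[lam]_(x in `]a, b]) f x + \int[lam]_(x in `]b, +oo[) f x)%E.
Proof.
move=> ab mf f0.
have E : (`]a, b] `|` `]b, +oo[ = `]a, +oo[)%classic.
  by rewrite -itv_bndbnd_setU ?bnd_simp.
rewrite -E ge0_integral_setU//.
- by rewrite E; exact: measurable_funTS.
- by move=> x; rewrite E/= in_itv/= andbT; exact: f0.
- apply/disj_setPS => x [] /=; rewrite !in_itv/= andbT => /andP[_ xb].
  by rewrite ltNge xb.
Qed.

Local Notation f2 := (fun x : R => (sin x / x) ^+ 2).
Local Notation g2 := (fun x : R => expR (- (pi^-1 * x ^+ 2))).

Lemma measurable_sinc2 : measurable_fun [set: R] f2.
Proof. by apply: measurable_funX; exact: measurable_sinc. Qed.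

Lemma measurable_gauss2 : measurable_fun [set: R] g2.
Proof.
apply: measurable_fun_expR; apply: measurable_funN.
by apply: measurable_funM => //; exact: measurable_funX.
Qed.

Lemma sinc2_le_inv (x : R) : f2 x <= x ^- 2.
Proof.
rewrite /= exprMn exprVn ler_piMl ?invr_ge0 ?sqr_ge0 // -cos2Dsin2 lerDr sqr_ge0.
Qed.

(** Integrating [(1 - cos (2 x)) / (2 x^2)] by parts leaves the remainder [sin (2 x) / (2 x^3)].
    Adding [1 / (2 x^3)] makes it the nonnegative [h], which is at most [x^-3]. The term in
    [sin (2 X)] is kept because it cancels against the contribution of [[0, X]] in
    [integral_min_sinc2_ge]. *)
Lemma integral_sinc2_tail (X : R) : 0 < X ->
  (((2 * X)^-1 + sin (2 * X) / (4 * X ^+ 2) - (4 * X ^+ 2)^-1)%:E <=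
   \int[lam]_(x in `[X, +oo[) (f2 x)%:E)%E.
Proof.
move=> X0.
pose h (x : R) := (1 + sin (2 * x)) / (2 * x ^+ 3).
pose F (x : R) := - ((2 * x)^-1 + sin (2 * x) / (4 * x ^+ 2) + (4 * x ^+ 2)^-1).
have mh : measurable_fun [set: R] h.
  apply: measurable_funM.
    by apply: measurable_funD => //; apply: measurable_fun_sin; exact: measurable_funM.
  apply: (measurable_fun_comp_real measurable_invr).
  by apply: measurable_funM => //; exact: measurable_funX.
have h0 (x : R) : X <= x -> 0 <= h x.
  move=> Xx; have x0 : 0 < x by exact: lt_le_trans Xx.
  have x0' := ltW x0; rewrite divr_ge0 ?mulr_ge0 ?exprn_ge0//.
have dV (x : R) : X <= x -> is_derive x 1 (fun x => x^-1) (- x ^- 2).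
  move=> Xx; have x0 : x != 0 by rewrite gt_eqF// (lt_le_trans X0).
  have := is_deriveV x0 (is_derive_id x (1 : R)).
  by rewrite /GRing.scale/= mulr1.
have Eh : (\int[lam]_(x in `[X, +oo[) (f2 x + h x)%:E = (- F X)%:E)%E.
  have dF (x : R) : X <= x -> is_derive x 1 F (f2 x + h x).
    move=> Xx; have x0 : x != 0 by rewrite gt_eqF// (lt_le_trans X0).
    have dx := dV x Xx.
    have -> : F = (fun x => - (2^-1 * x^-1 + sin (2 * x) * 4^-1 * x^-1 ^+ 2 + 4^-1 * x^-1 ^+ 2)).
      by apply/funext => y; rewrite /F !invfM !expr2 ?invfM !mulrA.
    apply: is_derive_eq; rewrite /GRing.scale/=.
    rewrite /h exprMn sin2cos2.
    have -> : cos (2 * x) = 2 * cos x ^+ 2 - 1.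
      by rewrite mulr_natl cos_mulr2n mulr_natl.
    by field.
  apply: (integral_itvy_derive dF) (sub0r _).
  - move=> x Xx; have x0 : x != 0 by rewrite gt_eqF// (lt_le_trans X0).
    have dx := dV x Xx; apply: is_derive_continuous.
    have -> : (fun x => f2 x + h x) = (fun x => (sin x * x^-1) ^+ 2 +
        (1 + sin (2 * x)) * 2^-1 * x^-1 ^+ 3).
      by apply/funext => y; rewrite /h invfM [y^-1 ^+ 3]exprVn mulrA.
    by apply: is_derive_eq.
  - by move=> x Xx; rewrite addr_ge0 ?sqr_ge0 ?h0.
  - rewrite -oppr0; apply: cvgN; apply: (@cvgy0_le _ _ 1) => x x1.
    have x0 : 0 < x by exact: lt_le_trans x1.
    have xx : x <= x ^+ 2 by rewrite expr2 ler_peMl// ltW.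
    have ix : (4 * x ^+ 2)^-1 <= 4^-1 * x^-1.
      by rewrite invfM ler_wpM2l// lef_pV2 ?posrE ?exprn_gt0.
    have i0 : 0 <= (4 * x ^+ 2)^-1 by rewrite invr_ge0 mulr_ge0 ?sqr_ge0.
    have j0 : 0 <= (2 * x)^-1 by rewrite invr_ge0 mulr_ge0// ltW.
    rewrite (le_trans (ler_normD _ _))// (ger0_norm i0).
    rewrite (le_trans (lerD (ler_normD _ _) (lexx _)))// (ger0_norm j0).
    rewrite normrM (ger0_norm i0).
    have : `|sin (2 * x)| * (4 * x ^+ 2)^-1 <= 4^-1 * x^-1.
      by apply: le_trans ix; rewrite ler_piMl// sin_max.
    by rewrite invfM in j0 *; rewrite mul1r; move: ix; lra.
have Eh' : (\int[lam]_(x in `[X, +oo[) (h x)%:E <= ((2 * X ^+ 2)^-1)%:E)%E.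
  have <- : (\int[lam]_(x in `[X, +oo[) (x ^- 3)%:E = ((2 * X ^+ 2)^-1)%:E)%E.
    have dG (x : R) : X <= x -> is_derive x 1 (fun x => - (2^-1 * x^-1 ^+ 2)) (x ^- 3).
      move=> Xx; have x0 : x != 0 by rewrite gt_eqF// (lt_le_trans X0).
      have dx := dV x Xx.
      apply: is_derive_eq; rewrite /GRing.scale/=.
      by field.
    apply: (integral_itvy_derive (l := 0) dG).
    - move=> x Xx; have dx := dV x Xx; apply: is_derive_continuous.
      have -> : (fun x => x ^- 3) = (fun x => x^-1 ^+ 3 : R).
        by apply/funext => y; rewrite exprVn.
      by apply: is_derive_eq.
    - by move=> x Xx; rewrite invr_ge0 exprn_ge0// (le_trans _ Xx)// ltW.
    - rewrite -oppr0; apply: cvgN; apply: (@cvgy0_le _ _ 1) => x x1.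
      have x0 : 0 < x by exact: lt_le_trans x1.
      have xx : x <= x ^+ 2 by rewrite expr2 ler_peMl// ltW.
      have ix : (x ^+ 2)^-1 <= x^-1 by rewrite lef_pV2 ?posrE ?exprn_gt0.
      rewrite exprVn ger0_norm ?mulr_ge0 ?invr_ge0 ?sqr_ge0//.
      have : 0 <= (x ^+ 2)^-1 by rewrite invr_ge0 sqr_ge0.
      by lra.
    - by rewrite sub0r opprK invfM exprVn.
  apply: ge0_le_integral => //.
  - by move=> x /=; rewrite in_itv/= andbT => Xx; rewrite lee_fin h0.
  - by apply/measurable_EFinP; exact: measurable_funTS.
  - apply/measurable_EFinP; apply: measurable_funTS.
    apply: (measurable_fun_comp_real measurable_invr); exact: measurable_funX.
  - move=> x /=; rewrite in_itv/= andbT => Xx; rewrite lee_fin.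
    have x0 : 0 < x by exact: lt_le_trans Xx.
    have x0' := ltW x0; rewrite /h invfM mulrA ler_piMl ?invr_ge0 ?exprn_ge0//.
    by have := sin_le1 (2 * x); lra.
have : (\int[lam]_(x in `[X, +oo[) (f2 x)%:E + \int[lam]_(x in `[X, +oo[) (h x)%:E =
    (- F X)%:E)%E.
  rewrite -Eh; under [RHS]eq_integral do rewrite EFinD.
  rewrite ge0_integralD//.
  - by move=> x _; rewrite lee_fin sqr_ge0.
  - by apply/measurable_EFinP; apply: measurable_funTS; exact: measurable_sinc2.
  - by move=> x /=; rewrite in_itv/= andbT => Xx; rewrite lee_fin h0.
  - by apply/measurable_EFinP; exact: measurable_funTS.
move=> E.
have : ((- F X)%:E <= \int[lam]_(x in `[X, +oo[) (f2 x)%:E + ((2 * X ^+ 2)^-1)%:E)%E.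
  by rewrite -E leeD2l.
rewrite -leeBlDr// -EFinB; apply: le_trans; rewrite lee_fin /F.
rewrite le_eqVlt; apply/orP; left; apply/eqP.
by field; rewrite gt_eqF.
Qed.

(** On [[0, X]] the minimum is at least [(sin x)^2 / X^2]; beyond [X] it is [(sin x / x)^2] itself,
    as this is at most [x^-2]. *)
Lemma integral_min_sinc2_ge (X : R) : 0 < X ->
  ((X^-1 - X ^- 2 / 4)%:E <=
   \int[lam]_(x in `]0%R, +oo[) (Num.min (f2 x) (X ^- 2))%:E)%E.
Proof.
move=> X0; have X0' := ltW X0.
have mm : measurable_fun [set: R] (fun x => (Num.min (f2 x) (X ^- 2))%:E).
  by apply/measurable_EFinP/measurable_minr => //; exact: measurable_sinc2.
have m0 (x : R) : 0 < x -> (0 <= (Num.min (f2 x) (X ^- 2))%:E)%E.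
  by move=> _; rewrite lee_fin le_min sqr_ge0 invr_ge0 sqr_ge0.
rewrite (ge0_integral_oy_split X0' mm)//.
have -> : (X^-1 - X ^- 2 / 4)%:E = (((X ^- 2 * (X / 2 - sin (2 * X) / 4)))%:E +
    ((2 * X)^-1 + sin (2 * X) / (4 * X ^+ 2) - (4 * X ^+ 2)^-1)%:E)%E :> \bar R.
  by rewrite -EFinD; congr EFin; field; rewrite gt_eqF.
apply: leeD.
- have dF (x : R) : 0 <= x <= X -> is_derive x 1
      (fun x => X ^- 2 * (x / 2 - sin (2 * x) / 4)) (X ^- 2 * sin x ^+ 2).
    move=> _; apply: is_derive_eq; rewrite /GRing.scale/=.
    have -> : cos (2 * x) = 1 - 2 * sin x ^+ 2.
      by rewrite mulr_natl cos_mulr2n cos2sin2; ring.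
    by field; rewrite gt_eqF.
  have := integral_segment_derive X0' dF.
  rewrite mul0r mulr0 sin0 mul0r subr0 mulr0 subr0 => <-; last first.
    by move=> x _; apply: is_derive_continuous; apply: is_derive_eq.
  rewrite -integral_itv_obnd_cbnd; last first.
    apply/measurable_EFinP; apply: measurable_funTS; apply: measurable_funM => //.
    by apply: measurable_funX; exact: measurable_fun_sin.
  apply: ge0_le_integral => //.
  + by move=> x _; rewrite lee_fin mulr_ge0 ?invr_ge0 ?sqr_ge0.
  + apply/measurable_EFinP; apply: measurable_funTS; apply: measurable_funM => //.
    by apply: measurable_funX; exact: measurable_fun_sin.
  + exact: measurable_funTS.
  + move=> x /=; rewrite in_itv/= => /andP[x0 xX]; rewrite lee_fin le_min.
    apply/andP; split; last first.
      rewrite ler_piMr ?invr_ge0 ?sqr_ge0//.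
    rewrite exprMn exprVn mulrC ler_wpM2l ?sqr_ge0// lef_pV2 ?posrE ?exprn_gt0//.
    by rewrite lerXn2r ?nnegrE// ltW.
- apply: le_trans (integral_sinc2_tail X0) _.
  rewrite -integral_itv_obnd_cbnd; last first.
    by apply/measurable_EFinP; apply: measurable_funTS; exact: measurable_sinc2.
  apply: ge0_le_integral => //.
  + by move=> x _; rewrite lee_fin sqr_ge0.
  + by apply/measurable_EFinP; apply: measurable_funTS; exact: measurable_sinc2.
  + exact: measurable_funTS.
  + move=> x /=; rewrite in_itv/= andbT => Xx; rewrite lee_fin le_min lexx/=.
    apply: le_trans (sinc2_le_inv x) _.
    have x0 : 0 < x by exact: lt_trans Xx.
    by rewrite lef_pV2 ?posrE ?exprn_gt0// lerXn2r ?nnegrE// ltW.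
Qed.

(** Up to [Y] the minimum is at most the constant [g2 Y]; beyond [Y] the extra factor [x / Y >= 1]
    makes the Gaussian tail explicitly integrable. *)
Lemma integral_min_gauss2_le (Y : R) : 0 < Y ->
  (\int[lam]_(x in `]0%R, +oo[) (Num.min (g2 x) (g2 Y))%:E <=
   (g2 Y * (Y + pi / (2 * Y)))%:E)%E.
Proof.
move=> Y0; have Y0' := ltW Y0.
have p0 := pi_gt0 R; have pn0 : pi != 0 :> R by rewrite gt_eqF.
have mm : measurable_fun [set: R] (fun x => (Num.min (g2 x) (g2 Y))%:E).
  by apply/measurable_EFinP/measurable_minr => //; exact: measurable_gauss2.
have m0 (x : R) : 0 < x -> (0 <= (Num.min (g2 x) (g2 Y))%:E)%E.
  by move=> _; rewrite lee_fin le_min !expR_ge0.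
rewrite (ge0_integral_oy_split Y0' mm)//.
rewrite mulrDr EFinD; apply: leeD.
- apply: (@le_trans _ _ (\int[lam]_(x in `]0%R, Y]) (g2 Y)%:E)%E).
    apply: ge0_le_integral => //.
    + exact: measurable_funTS.
    + by move=> x _; rewrite lee_fin ge_min lexx orbT.
  rewrite integral_cst//= lebesgue_measure_itv/= lte_fin Y0 -EFinD subr0.
  by rewrite -EFinM.
- have dF (x : R) : Y <= x -> is_derive x 1 (fun x => - (pi / (2 * Y) * g2 x))
      (x / Y * g2 x).
    move=> _; apply: is_derive_eq; rewrite /GRing.scale/=.
    by clear mm m0 p0; move: (pi : R) pn0 => p pn0; field; rewrite pn0 gt_eqF.
  have mx : measurable_fun [set: R] (fun x => (x / Y * g2 x)%:E).
    apply/measurable_EFinP; apply: measurable_funM; first exact: measurable_funM.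
    exact: measurable_gauss2.
  have <- : (\int[lam]_(x in `[Y, +oo[) (x / Y * g2 x)%:E =
      (g2 Y * (pi / (2 * Y)))%:E)%E.
    apply: (integral_itvy_derive (l := 0) dF).
    + by move=> x _; apply: is_derive_continuous; apply: is_derive_eq.
    + by move=> x Yx; rewrite mulr_ge0 ?divr_ge0 ?expR_ge0// (le_trans _ Yx).
    + rewrite -oppr0; apply: cvgN; apply: (@cvgy0_le _ _ (pi / (2 * Y) * pi)) => x x1.
      have x0 : 0 < x by exact: lt_le_trans x1.
      have xx : x <= x ^+ 2 by rewrite expr2 ler_peMl// ltW.
      have c0 : 0 <= pi / (2 * Y) by rewrite divr_ge0 ?mulr_ge0// ltW.
      rewrite ger0_norm; last by rewrite mulr_ge0 ?expR_ge0.
      rewrite -[leRHS]mulrA ler_wpM2l//.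
      apply: le_trans (expRN_le_inv _) _; first by rewrite mulr_gt0 ?invr_gt0 ?exprn_gt0.
      rewrite invfM invrK ler_wpM2l ?(ltW p0)//.
      by rewrite lef_pV2 ?posrE ?exprn_gt0.
    + by rewrite sub0r opprK mulrC.
  rewrite -integral_itv_obnd_cbnd; last exact: measurable_funTS.
  apply: ge0_le_integral => //.
  + exact: measurable_funTS.
  + exact: measurable_funTS.
  + move=> x /=; rewrite in_itv/= andbT => Yx; rewrite lee_fin ge_min.
    apply/orP; left; rewrite ler_peMl ?expR_ge0//.
    by rewrite ler_pdivlMr// mul1r ltW.
Qed.

Lemma integral_gauss2 :
  (\int[lam]_(x in `]0%R, +oo[) (g2 x)%:E = (pi / 2)%:E)%E.
Proof.
have p0 := pi_gt0 R.
rewrite integral_gauss_scaled ?invr_gt0// invrK -expr2 sqrtr_sqr.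
by rewrite ger0_norm// ltW.
Qed.

Lemma sinc2_level_le (v : R) : 0 <= v ->
  (\int[lam]_(x in `]0%R, +oo[) (Num.max (f2 x - expR (- v)) 0)%:E <=
   \int[lam]_(x in `]0%R, +oo[) (Num.max (g2 x - expR (- v)) 0)%:E)%E.
Proof.
move=> v0; set s := expR (- v).
have p3 := @pi_ge3 R.
have mf : measurable_fun [set: R] (fun x => (Num.max (f2 x - s) 0)%:E).
  apply/measurable_EFinP/measurable_maxr => //.
  by apply: measurable_funB => //; exact: measurable_sinc2.
have mg : measurable_fun [set: R] (fun x => (Num.max (g2 x - s) 0)%:E).
  apply/measurable_EFinP/measurable_maxr => //.
  by apply: measurable_funB => //; exact: measurable_gauss2.
have [s16|s16] := leP (1 / 16) s.
  (* Only the main lobe of the sine reaches this level, and there the comparison is pointwise. *)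
  apply: ge0_le_integral => //.
  - by move=> x _; rewrite lee_fin le_max lexx orbT.
  - exact: measurable_funTS.
  - exact: measurable_funTS.
  - move=> x /=; rewrite in_itv/= andbT => x0; rewrite lee_fin.
    have [xpi|pix] := leP x pi.
      rewrite ge_max !le_max lexx orbT andbT lerD2r; apply/orP; left.
      have sx : 0 <= sin x by apply: sin_ge0_pi; rewrite ltW.
      (* The square of this bound is [exp (- x^2 / 3)], which lies below the Gaussian because
         [pi >= 3]. *)
      have h : sin x / x <= expR (- (x ^+ 2 / 6)).
        by rewrite ler_pdivrMr// mulrC sin_le_gauss// x0.
      apply: (@le_trans _ _ (expR (- (x ^+ 2 / 6)) ^+ 2)).
        by rewrite lerXn2r ?nnegrE ?expR_ge0// divr_ge0// ltW.
      rewrite -expRM_natr ler_expR mulNr lerN2.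
      rewrite -mulrA [leRHS]mulrC.
      have -> : 6^-1 * 2 = 3^-1 :> R by field.
      by rewrite ler_wpM2r ?sqr_ge0// lef_pV2 ?posrE//; lra.
    rewrite ge_max !le_max lexx orbT andbT; apply/orP; right.
    rewrite subr_le0; apply: le_trans s16.
    (* Beyond [pi] one has [|sin x| <= x / 4]: trivially for [x >= 4], and otherwise by
       [|sin x| <= x - pi] and [pi >= 3]. *)
    have -> : 1 / 16 = (1 / 4) ^+ 2 :> R by field.
    rewrite -[f2 x]real_normK ?num_real// lerXn2r ?nnegrE//.
    rewrite normrM normfV (gtr0_norm x0) ler_pdivrMr//.
    have [x4|x4] := leP 4 x.
      by have := sin_max x; lra.
    have -> : `|sin x| = sin (x - pi).
      have h : sin x = - sin (x - pi) by rewrite -{1}(subrK pi x) sinDpi.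
      rewrite h normrN ger0_norm// sin_ge0_pi//.
      by apply/andP; split; lra.
    have := @sin_le R (x - pi); lra.
have s0 : 0 < s by rewrite expR_gt0.
(* [X] and [Y] are the points where the envelope [x^-2] and the Gaussian come down to the level
   [s]. *)
pose X := expR (v / 2).
have X0 : 0 < X by rewrite expR_gt0.
have Xs : X ^- 2 = s by rewrite -expRM_natr divfK// -expRN.
have numv := gauss_level_numeric s16.
set Y := Num.sqrt (pi * v) in numv.
have vv : 0 < v.
  rewrite lt_neqAle v0 andbT; apply/eqP => v00.
  by move: s16; rewrite /s -v00 oppr0 expR0; lra.
have Y0 : 0 < Y by rewrite sqrtr_gt0 mulr_gt0 ?pi_gt0.
have Ys : g2 Y = s.
  rewrite /= /Y sqr_sqrtr ?mulr_ge0 ?pi_ge0// mulrA mulVf ?mul1r//.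
  by rewrite gt_eqF ?pi_gt0.
(* As the total integrals agree, it suffices to compare the integrals of the minima with [s]. *)
have If := integral_min_sinc2_ge X0; rewrite Xs in If.
have Ig := integral_min_gauss2_le Y0; rewrite Ys in Ig.
(* This is the inequality of [gauss_level_numeric] multiplied by [s]. *)
have cle : s * (Y + pi / (2 * Y)) <= X^-1 - s / 4.
  have -> : X^-1 - s / 4 = s * (X - 1 / 4).
    by rewrite -Xs; field; rewrite gt_eqF.
  by rewrite ler_wpM2l ?(ltW s0)// lerBrDr.
have split_max (h : R -> R) : measurable_fun [set: R] h -> (forall x, 0 <= h x) ->
  (\int[lam]_(x in `]0%R, +oo[) (Num.max (h x - s) 0)%:E +
   \int[lam]_(x in `]0%R, +oo[) (Num.min (h x) s)%:E =
   \int[lam]_(x in `]0%R, +oo[) (h x)%:E)%E.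
  move=> mh h0; rewrite -ge0_integralD//.
  - apply: eq_integral => x _; rewrite -EFinD; congr EFin.
    by rewrite maxEle minEle subr_le0; case: ifP => _; rewrite ?add0r// subrK.
  - by move=> x _; rewrite lee_fin le_max lexx orbT.
  - apply/measurable_EFinP; apply: measurable_funTS.
    by apply: measurable_maxr => //; exact: measurable_funB.
  - by move=> x _; rewrite lee_fin le_min h0 ltW.
  - by apply/measurable_EFinP; apply: measurable_funTS; exact: measurable_minr.
have Ef := split_max _ measurable_sinc2 (fun x => sqr_ge0 _).
have Eg := split_max _ measurable_gauss2 (fun x => expR_ge0 _).
rewrite integral_gauss2 in Eg.
have Ef2 := @integral_sinc2_le R; rewrite -Ef -Eg in Ef2.
set a := (X in (X + _ <= _)%E) in Ef2 *; set b := (X in (_ <= X + _)%E) in Ef2 *.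
rewrite -(@leeD2rE _ (s * (Y + pi / (2 * Y)))%:E)//.
apply: le_trans (leeD2l b Ig).
apply: le_trans Ef2; apply: leeD2l.
by apply: le_trans If; rewrite lee_fin.
Qed.

End SincLevels.

(** * From levels to powers *)

Section BallIntegral.
Context {R : realType}.
Local Notation lam := (@lebesgue_measure R).

(** Taylor's formula with integral remainder, [u^q = int_0^u q (q - 1) s^(q - 2) (u - s) ds], after
    the substitution [s = exp (- v)]. The weight is nonnegative for [q > 1], so a comparison at all
    levels passes to [q]-th powers. *)
Lemma powR_mixture (u q : R) : 0 <= u <= 1 -> 1 < q ->
  (\int[lam]_(v in `[0%R, +oo[)
     (q * (q - 1) * expR (- ((q - 1) * v)) * Num.max (u - expR (- v)) 0)%:E =
   (u `^ q)%:E)%E.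
Proof.
move=> /andP[u0 u1] q1.
have q0 : 0 < q by lra.
have q10 : 0 < q - 1 by lra.
move: u0; rewrite le_eqVlt => /predU1P[<-|u0].
  rewrite powR0 ?gt_eqF//; apply: integral0_eq => v _.
  by rewrite sub0r max_r ?mulr0// oppr_le0 expR_ge0.
set a := - ln u.
have a0 : 0 <= a by rewrite oppr_ge0 ln_le0.
have ea : expR (- a) = u by rewrite opprK lnK.
pose h v := q * (q - 1) * expR (- ((q - 1) * v)) * (u - expR (- v)).
have dF (v : R) : a <= v -> is_derive v 1
    (fun v => - (q * u * expR (- ((q - 1) * v)) - (q - 1) * expR (- (q * v)))) (h v).
  move=> _; apply: is_derive_eq; rewrite /GRing.scale/= /h.
  have -> : expR (- (q * v)) = expR (- ((q - 1) * v)) * expR (- v).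
    by rewrite -expRD; congr expR; ring.
  by ring.
transitivity (\int[lam]_(v in `[a, +oo[) (h v)%:E)%E.
  rewrite integral_mkcond [RHS]integral_mkcond.
  apply: eq_integral => v _; rewrite !patchE !mem_setE !in_itv/= !andbT.
  have [av|va] := leP a v.
    rewrite (le_trans a0 av) max_l// subr_ge0 -ea ler_expR.
    by rewrite lerN2.
  case: ifP => // _; rewrite max_r ?mulr0//.
  by rewrite subr_le0 -ea ler_expR lerN2 ltW.
apply: (integral_itvy_derive (l := 0) dF).
- by move=> v _; apply: is_derive_continuous; rewrite /h; apply: is_derive_eq.
- move=> v av; apply: mulr_ge0; last by rewrite subr_ge0 -ea ler_expR lerN2.
  by rewrite mulr_ge0 ?expR_ge0// mulr_ge0 ?(ltW q0) ?(ltW q10).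
- rewrite -oppr0; apply: cvgN.
  apply: (@cvgy0_le _ _ (q * u / (q - 1) + (q - 1) / q)) => v v1.
  have v0 : 0 < v by exact: lt_le_trans v1.
  rewrite (le_trans (ler_normB _ _))// [leRHS]mulrDl.
  have qu0 : 0 <= q * u by rewrite mulr_ge0// ltW.
  rewrite !ger0_norm ?mulr_ge0 ?expR_ge0 ?(ltW q10) ?(ltW q0) ?(ltW u0)//.
  rewrite lerD//.
    rewrite -[leRHS]mulrA -invfM ler_wpM2l//.
    by apply: expRN_le_inv; rewrite mulr_gt0.
  rewrite -[leRHS]mulrA -invfM ler_wpM2l ?(ltW q10)//.
  by apply: expRN_le_inv; rewrite mulr_gt0.
- have e1 : expR (- ((q - 1) * a)) * u = u `^ q.
    by rewrite -[X in _ * X]ea -expRD /powR gt_eqF//; congr expR; rewrite /a; ring.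
  have e2 : expR (- (q * a)) = u `^ q.
    by rewrite /powR gt_eqF//; congr expR; rewrite /a; ring.
  rewrite e2 sub0r opprK -mulrA [u * _]mulrC e1; ring.
Qed.

Lemma powR_level_integral (h : R -> R) (q : R) : 1 < q ->
  measurable_fun [set: R] h -> (forall x, 0 < x -> 0 <= h x <= 1) ->
  (\int[lam]_(x in `]0%R, +oo[) (h x `^ q)%:E =
   \int[lam]_(v in `[0%R, +oo[) ((q * (q - 1) * expR (- ((q - 1) * v)))%:E *
     \int[lam]_(x in `]0%R, +oo[) (Num.max (h x - expR (- v)) 0)%:E))%E.
Proof.
move=> q1 mh h01.
pose f (z : R * R) :=
  (q * (q - 1) * expR (- ((q - 1) * z.2)) * Num.max (h z.1 - expR (- z.2)) 0)%:E.
have mf : measurable_fun setT f.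
  apply/measurable_EFinP; apply: measurable_funM.
    apply: measurable_funM => //; apply: measurable_fun_expR.
    by apply: measurable_funN; exact: measurable_funM.
  apply: measurable_maxr => //; apply: measurable_funB.
    exact: measurableT_comp.
  by apply: measurable_fun_expR; exact: measurable_funN.
have w0 (v : R) : 0 <= q * (q - 1) * expR (- ((q - 1) * v)).
  by rewrite mulr_ge0 ?expR_ge0// mulr_ge0//; lra.
transitivity (\int[lam]_(x in `]0%R, +oo[) \int[lam]_(v in `[0%R, +oo[) f (x, v))%E.
  apply: eq_integral => x; rewrite inE/= in_itv/= andbT => x0.
  by rewrite /f/= powR_mixture ?h01.
rewrite restricted_tonelli//.
  apply: eq_integral => v _; rewrite /f/=; under eq_integral do rewrite EFinM.
  rewrite ge0_integralZl ?lee_fin//.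
  - apply/measurable_EFinP; apply: measurable_funTS.
    by apply: measurable_maxr => //; exact: measurable_funB.
  - by move=> x _; rewrite lee_fin le_max lexx orbT.
by move=> x v _ _; rewrite lee_fin mulr_ge0 ?w0// le_max lexx orbT.
Qed.

(** With [q = p / 2] the left side is the integral of the [q]-th power of [(sin x / x)^2], and the
    right side is exactly that of the [q]-th power of the Gaussian. *)
Lemma ball_integral (p : R) : 2 < p ->
  (\int[lam]_(x in `]0%R, +oo[) (`|sin x / x| `^ p)%:E <=
   (pi / 2 * Num.sqrt (2 / p))%:E)%E.
Proof.
move=> p2; have q1 : 1 < p / 2 by rewrite ltr_pdivlMr// mul1r.
set q := p / 2 in q1.
have p0 := pi_gt0 R; have pp0 : 0 < p by lra.
have -> : (\int[lam]_(x in `]0%R, +oo[) (`|sin x / x| `^ p)%:E =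
    \int[lam]_(x in `]0%R, +oo[) (((sin x / x) ^+ 2) `^ q)%:E)%E.
  apply: eq_integral => x _; rewrite -[(sin x / x) ^+ 2]real_normK ?num_real//.
  rewrite -powR_mulrn// -powRrM; congr (_ `^ _)%:E.
  by rewrite /q; field.
have -> : (pi / 2 * Num.sqrt (2 / p))%:E = (\int[lam]_(x in `]0%R, +oo[)
    ((expR (- (pi^-1 * x ^+ 2))) `^ q)%:E)%E.
  under eq_integral do rewrite -expRM mulNr mulrAC.
  have c0 : 0 < pi^-1 * q by rewrite mulr_gt0 ?invr_gt0// (lt_trans ltr01).
  rewrite integral_gauss_scaled//.
  have -> : pi / (pi^-1 * q) = pi ^+ 2 * (2 / p).
    by rewrite /q invfM invrK invfM invrK expr2; ring.
  by rewrite [in RHS]sqrtrM ?sqr_ge0// sqrtr_sqr ger0_norm ?(ltW p0)//; congr EFin; ring.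
rewrite !powR_level_integral//; last 4 first.
- exact: measurable_gauss2.
- move=> x _; rewrite expR_ge0 expR_le1 oppr_le0 mulr_ge0 ?sqr_ge0//.
  by rewrite invr_ge0 ltW.
- exact: measurable_sinc2.
- move=> x x0; rewrite sqr_ge0 -[leLHS]real_normK ?num_real//.
  rewrite -(expr1n _ 2) lerXn2r ?nnegrE// normrM normfV (gtr0_norm x0).
  rewrite ler_pdivrMr// mul1r.
  have [x1|x1] := leP 1 x; first by apply: le_trans x1; exact: sin_max.
  rewrite ger0_norm ?sin_le ?ltW//.
  have := @pi_ge3 R => p3.
  by apply: sin_gt0_pi; rewrite x0/=; lra.
have w0 (v : R) : 0 <= q * (q - 1) * expR (- ((q - 1) * v)).
  by rewrite mulr_ge0 ?expR_ge0// mulr_ge0//; lra.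
have mq (h : R -> R) : measurable_fun [set: R] h ->
    measurable_fun [set: R] (fun v => (q * (q - 1) * expR (- ((q - 1) * v)))%:E *
     \int[lam]_(x in `]0%R, +oo[) (Num.max (h x - expR (- v)) 0)%:E)%E.
  move=> mh; apply: emeasurable_funM.
    apply/measurable_EFinP; apply: measurable_funM => //; apply: measurable_fun_expR.
    by apply: measurable_funN; exact: measurable_funM.
  rewrite (_ : (fun v => _) = (fun v =>
    \int[lam]_x ((fun z : R * R => (Num.max (h z.1 - expR (- z.2)) 0)%:E) \_
      (`]0%R, +oo[%classic `*` setT)) (x, v))%E); last first.
    apply/funext => v; rewrite integral_mkcond; apply: eq_integral => x _.
    by rewrite !patchE in_setX /= in_setT andbT.
  apply: (measurable_fun_fubini_tonelli_G (m1 := lam)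
    ((fun z : R * R => (Num.max (h z.1 - expR (- z.2)) 0)%:E) \_
      (`]0%R, +oo[%classic `*` setT))).
  - apply/(measurable_restrictT _ _).1; first exact: measurableX.
    apply: measurable_funTS; apply/measurable_EFinP.
    apply: measurable_maxr => //; apply: measurable_funB.
      exact: measurableT_comp.
    by apply: measurable_fun_expR; exact: measurable_funN.
  - move=> z; rewrite patchE; case: ifPn => // _.
    by rewrite lee_fin le_max lexx orbT.
apply: ge0_le_integral => //.
- move=> v _; rewrite mule_ge0 ?lee_fin ?w0// integral_ge0// => x _.
  by rewrite lee_fin le_max lexx orbT.
- by apply: measurable_funTS; apply: mq; exact: measurable_sinc2.
- by apply: measurable_funTS; apply: mq; exact: measurable_gauss2.
- move=> v /=; rewrite in_itv/= andbT => v0.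
  by rewrite lee_wpmul2l ?lee_fin ?w0// sinc2_level_le.
Qed.

End BallIntegral.

(** * Small ball probabilities of weighted sums of uniform variables *)

Section UniformAverage.
Context {R : realType}.
Local Notation lam := (@lebesgue_measure R).
Local Open Scope ereal_scope.

(** The expectation of [g (x + a U)] for [U] uniform on [[-1/2, 1/2]]. Hence [foldr unif_avg g s x]
    is the expectation of [g] at [x] plus a sum of independent uniform variables weighted by [s], in
    a form suited to induction on [s]. *)
Definition unif_avg (a : R) (g : R -> \bar R) (x : R) : \bar R :=
  \int[lam]_(u in `[(- (1 / 2))%R, (1 / 2)%R]) g (x + a * u)%R.

Lemma lebesgue_unit_itv :
  lam (`[(- (1 / 2))%R, (1 / 2)%R]%classic : set R) = 1.
Proof.
rewrite lebesgue_measure_itv/= lte_fin ifT; last by lra.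
by rewrite -EFinD; congr EFin; field.
Qed.

Lemma measurable_shift_pair (a : R) (g : R -> \bar R) :
  measurable_fun [set: R] g ->
  measurable_fun [set: R * R] (fun z => g (z.1 + a * z.2)%R).
Proof.
move=> mg; apply: (measurableT_comp mg).
by apply: measurable_funD => //; exact: measurable_funM.
Qed.

Lemma measurable_shift (a x : R) (g : R -> \bar R) :
  measurable_fun [set: R] g ->
  measurable_fun [set: R] (fun u => g (x + a * u)%R).
Proof.
move=> mg; apply: (measurableT_comp mg).
by apply: measurable_funD => //; exact: measurable_funM.
Qed.

Lemma unif_avg_ge0 (a x : R) (g : R -> \bar R) :
  (forall y, 0 <= g y) -> 0 <= unif_avg a g x.
Proof. by move=> g0; apply: integral_ge0 => u _. Qed.

Lemma measurable_unif_avg (a : R) (g : R -> \bar R) :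
  measurable_fun [set: R] g -> (forall y, 0 <= g y) ->
  measurable_fun [set: R] (unif_avg a g).
Proof.
move=> mg g0.
pose f := (fun z : R * R => g (z.1 + a * z.2)%R) \_
   (setT `*` `[(- (1 / 2))%R, (1 / 2)%R]%classic).
have -> : unif_avg a g = fun x => \int[lam]_u f (x, u).
  apply/funext => x; rewrite /unif_avg integral_mkcond.
  by apply: eq_integral => u _; rewrite /f !patchE in_setX /= in_setT.
apply: (measurable_fun_fubini_tonelli_F (m2 := lam) f).
- apply/(measurable_restrictT _ _).1; first exact: measurableX.
  by apply: measurable_funTS; exact: measurable_shift_pair.
- by move=> z; rewrite /f patchE; case: ifPn.
Qed.

Lemma le_unif_avg (a x : R) (g h : R -> \bar R) :
  measurable_fun [set: R] g -> measurable_fun [set: R] h ->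
  (forall y, 0 <= g y) -> (forall y, g y <= h y) ->
  unif_avg a g x <= unif_avg a h x.
Proof.
move=> mg mh g0 gh; apply: ge0_le_integral => //.
- by apply: measurable_funTS; exact: measurable_shift.
- by apply: measurable_funTS; exact: measurable_shift.
Qed.

Lemma unif_avgN (a x : R) (g : R -> \bar R) :
  measurable_fun [set: R] g -> (forall y, 0 <= g y) ->
  unif_avg (- a) g x = unif_avg a g x.
Proof.
move=> mg g0; rewrite /unif_avg integral_mkcond [RHS]integral_mkcond.
rewrite -[RHS]ge0_integral_opp.
- apply: eq_integral => u _; rewrite !patchE mulrN mulNr !mem_setE !in_itv/=.
  by congr (if _ then _ else _); apply/idP/idP => /andP[? ?]; apply/andP; split; lra.
- apply/(measurable_restrictT _ _).1 => //.
  by apply: measurable_funTS; exact: measurable_shift.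
- by move=> u; rewrite patchE; case: ifPn.
Qed.

Lemma unif_avg_norm (a x : R) (g : R -> \bar R) :
  measurable_fun [set: R] g -> (forall y, 0 <= g y) ->
  unif_avg `|a|%R g x = unif_avg a g x.
Proof.
move=> mg g0; have [a0|a0] := leP 0%R a; first by rewrite ger0_norm.
by rewrite ltr0_norm// unif_avgN.
Qed.

Lemma unif_avg_le_integral (a x : R) (g : R -> \bar R) : a != 0%R ->
  measurable_fun [set: R] g -> (forall y, 0 <= g y) ->
  unif_avg a g x <= (`|a|^-1)%:E * \int[lam]_y g y.
Proof.
move=> a0 mg g0; rewrite -unif_avg_norm//.
rewrite -(ge0_integral_affine x)// ?normr_gt0//.
under [leRHS]eq_integral do rewrite addrC.
apply: ge0_subset_integral => //; exact: measurable_shift.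
Qed.

Lemma integral_unif_avg (a : R) (g : R -> \bar R) :
  measurable_fun [set: R] g -> (forall y, 0 <= g y) ->
  \int[lam]_x unif_avg a g x = \int[lam]_x g x.
Proof.
move=> mg g0; rewrite /unif_avg.
have mI : measurable (`[(- (1 / 2))%R, (1 / 2)%R]%classic : set R) by [].
have /= -> := restricted_tonelli lam lam measurableT mI
  (measurable_shift_pair a mg) (fun x y _ _ => g0 _).
transitivity (\int[lam]_(u in `[(- (1 / 2))%R, (1 / 2)%R]) \int[lam]_x g x).
  by apply: eq_integral => u _; rewrite /= ge0_integral_shift.
rewrite (integral_cst lam mI (\int[lam]_x g x)) -[RHS]mule1.
by congr (_ * _); exact: lebesgue_unit_itv.
Qed.

Lemma unif_avg_affine (c k a x : R) (g : R -> \bar R) : (0 <= c)%R -> (0 <= k)%R ->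
  measurable_fun [set: R] g -> (forall y, 0 <= g y) ->
  unif_avg a (fun y => c%:E + k%:E * g y) x = c%:E + k%:E * unif_avg a g x.
Proof.
move=> c0 k0 mg g0; have ms := measurable_shift a x mg.
have mI : measurable (`[(- (1 / 2))%R, (1 / 2)%R]%classic : set R) by [].
rewrite /unif_avg ge0_integralD//.
- by rewrite (integral_cst lam mI c%:E) [X in _ * X]lebesgue_unit_itv mule1 ge0_integralZl_EFin//; exact: measurable_funTS.
- by move=> u _; rewrite mule_ge0.
- by apply: measurable_funTS; apply: measurable_funeM.
Qed.

Implicit Type s : seq R.

Lemma foldr_unif_avg_ge0 s (g : R -> \bar R) x :
  (forall y, 0 <= g y) -> 0 <= foldr unif_avg g s x.
Proof. by move=> g0; elim: s x => //= a s IH x; apply: unif_avg_ge0. Qed.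

Lemma measurable_foldr_unif_avg s (g : R -> \bar R) :
  measurable_fun [set: R] g -> (forall y, 0 <= g y) ->
  measurable_fun [set: R] (foldr unif_avg g s).
Proof.
move=> mg g0; elim: s => //= a s IH; apply: measurable_unif_avg => // y.
exact: foldr_unif_avg_ge0.
Qed.

Lemma le_foldr_unif_avg s (g h : R -> \bar R) x :
  measurable_fun [set: R] g -> measurable_fun [set: R] h ->
  (forall y, 0 <= g y) -> (forall y, g y <= h y) ->
  foldr unif_avg g s x <= foldr unif_avg h s x.
Proof.
move=> mg mh g0 gh; elim: s x => //= a s IH x.
have h0 y : 0 <= h y by apply: le_trans (gh y).
apply: le_unif_avg => //; try exact: measurable_foldr_unif_avg.
by move=> y; exact: foldr_unif_avg_ge0.
Qed.

Lemma foldr_unif_avg_affine (c k : R) s (g : R -> \bar R) x :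
  (0 <= c)%R -> (0 <= k)%R ->
  measurable_fun [set: R] g -> (forall y, 0 <= g y) ->
  foldr unif_avg (fun y => c%:E + k%:E * g y) s x =
  c%:E + k%:E * foldr unif_avg g s x.
Proof.
move=> c0 k0 mg g0; elim: s x => //= a s IH x.
rewrite -unif_avg_affine//.
- by apply: eq_integral => u _; rewrite IH.
- exact: measurable_foldr_unif_avg.
- by move=> y; exact: foldr_unif_avg_ge0.
Qed.

Lemma integral_foldr_unif_avg s (g : R -> \bar R) :
  measurable_fun [set: R] g -> (forall y, 0 <= g y) ->
  \int[lam]_x foldr unif_avg g s x = \int[lam]_x g x.
Proof.
move=> mg g0; elim: s => //= a s IH; rewrite integral_unif_avg//.
- exact: measurable_foldr_unif_avg.
- by move=> y; exact: foldr_unif_avg_ge0.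
Qed.

(** The density of [a U] is at most [1 / |a|], and neither earlier nor later averages spoil this
    bound. It settles the case of one large coefficient. *)
Lemma foldr_unif_avg_le s (a x : R) (g : R -> \bar R) : a \in s -> a != 0%R ->
  measurable_fun [set: R] g -> (forall y, 0 <= g y) ->
  foldr unif_avg g s x <= (`|a|^-1)%:E * \int[lam]_y g y.
Proof.
move=> + a0 mg g0; elim: s x => //= b s IH x.
have mG := measurable_foldr_unif_avg s mg g0.
have G0 y := foldr_unif_avg_ge0 s y g0.
rewrite inE => /predU1P[<-|sa].
  by rewrite -(integral_foldr_unif_avg s mg g0); exact: unif_avg_le_integral.
have i0 : 0 <= \int[lam]_y g y by exact: integral_ge0.
have c0 : 0 <= (`|a|^-1)%:E * \int[lam]_y g y.
  by rewrite mule_ge0// lee_fin invr_ge0.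
have mI : measurable (`[(- (1 / 2))%R, (1 / 2)%R]%classic : set R) by [].
rewrite -[leRHS]mule1 -lebesgue_unit_itv -(integral_cst lam mI).
apply: ge0_le_integral => //.
- by apply: measurable_funTS; exact: measurable_shift.
- by move=> u _; exact: IH.
Qed.

End UniformAverage.

(** * Averages of damped cosine integrals *)

Section PoissonKernel.
Context {R : realType}.
Local Notation lam := (@lebesgue_measure R).

(** The value at 0 matters: [sin y / y] would be 0 there, whereas a zero coefficient must contribute
    the factor 1. *)
Definition sinc (y : R) : R := if y == 0 then 1 else sin y / y.

Lemma measurable_fun_sincE : measurable_fun [set: R] sinc.
Proof.
apply: measurable_fun_ifT => //; last exact: measurable_sinc.
exact: measurable_fun_eqr.
Qed.

Lemma sinc_le1 (y : R) : `|sinc y| <= 1.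
Proof.
rewrite /sinc; case: eqVneq => [|y0]; first by rewrite normr1.
rewrite normrM normfV ler_pdivrMr ?normr_gt0// mul1r.
have h (z : R) : 0 <= z -> `|sin z| <= z.
  move=> z0; have [z1|z1] := leP 1 z; first exact: le_trans (sin_max _) z1.
  rewrite ger0_norm ?sin_le// sin_ge0_pi// z0/=.
  by have := @pi_ge3 R; lra.
have [y1|y1] := leP 0 y; first by rewrite [leRHS]ger0_norm// h.
by rewrite [leRHS]ltr0_norm// -normrN -sinN h// oppr_ge0 ltW.
Qed.

(** Averaging multiplies the cosine of frequency [t] by the characteristic function [sinc (a t / 2)]
    of [a U]. *)
Lemma integral_cos_unit_itv (a t x c k : R) :
  (\int[lam]_(u in `[(- (1 / 2))%R, (1 / 2)%R])
     (c * (1 + k * cos (t * (x + a * u))))%:E =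
   (c * (1 + k * sinc (a * t / 2) * cos (t * x)))%:E)%E.
Proof.
have h2 : - (1 / 2) <= 1 / 2 :> R by lra.
have cf (u : R) : - (1 / 2) <= u <= 1 / 2 ->
    {for u, continuous (fun u => c * (1 + k * cos (t * (x + a * u))))}.
  by move=> _; apply: is_derive_continuous; apply: is_derive_eq.
rewrite /sinc; case: eqVneq => [at0|at0].
  have dF (u : R) : - (1 / 2) <= u <= 1 / 2 ->
      is_derive u 1 (fun u => c * (1 + k * cos (t * x)) * u)
        (c * (1 + k * cos (t * (x + a * u)))).
    move=> _; apply: is_derive_eq; rewrite /GRing.scale/=.
    have -> : t * (x + a * u) = t * x + 2 * (a * t / 2) * u by field.
    by rewrite at0 mulr0 mul0r addr0; ring.
  by rewrite (integral_segment_derive h2 dF cf); congr EFin; field.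
have at0' : t * a != 0.
  by apply: contraNneq at0 => h; rewrite mulrC (mulrC a) h mulr0.
have dF (u : R) : - (1 / 2) <= u <= 1 / 2 ->
    is_derive u 1 (fun u => c * (u + k * (sin (t * (x + a * u)) / (t * a))))
      (c * (1 + k * cos (t * (x + a * u)))).
  move=> _; apply: is_derive_eq; rewrite /GRing.scale/=.
  by move: at0'; rewrite mulf_eq0 negb_or => /andP[t0 a0]; field; rewrite t0 a0.
rewrite (integral_segment_derive h2 dF cf); congr EFin.
have -> : t * (x + a * (1 / 2)) = t * x + a * t / 2 by field.
have -> : t * (x + a * - (1 / 2)) = t * x - a * t / 2 by field.
rewrite sinB sinD.
move: at0'; rewrite mulf_eq0 negb_or => /andP[t0 a0]; field.
by rewrite t0 a0.
Qed.

(* The summand 1 makes the integrand nonnegative, so that Tonelli is enough. *)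
Definition poisson (e : R) (phi : R -> R) (x : R) : \bar R :=
  (\int[lam]_(t in `[0%R, +oo[) (expR (- (e * t)) * (1 + phi t * cos (t * x)))%:E)%E.

Lemma poisson_integrand_ge0 (e t x f : R) : `|f| <= 1 ->
  0 <= expR (- (e * t)) * (1 + f * cos (t * x)).
Proof.
move=> f1; rewrite mulr_ge0 ?expR_ge0//.
have : `|f * cos (t * x)| <= 1.
  by rewrite normrM mulr_ile1// cos_max.
by rewrite ler_norml => /andP[h _]; lra.
Qed.

Lemma unif_avg_poisson (e a x : R) (phi : R -> R) :
  measurable_fun [set: R] phi -> (forall t, `|phi t| <= 1) ->
  unif_avg a (poisson e phi) x =
  poisson e (fun t => phi t * sinc (a * t / 2)) x.
Proof.
move=> mphi phi1; rewrite /unif_avg /poisson.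
have mI : measurable (`[(- (1 / 2))%R, (1 / 2)%R]%classic : set R) by [].
have mJ : measurable (`[0%R, +oo[%classic : set R) by [].
pose f (z : R * R) := (expR (- (e * z.2)) * (1 + phi z.2 * cos (z.2 * (x + a * z.1))))%:E.
have mf : measurable_fun setT f.
  apply/measurable_EFinP; apply: measurable_funM.
    by apply: measurable_fun_expR; apply: measurable_funN; exact: measurable_funM.
  apply: measurable_funD => //; apply: measurable_funM.
    exact: measurableT_comp.
  apply: measurable_fun_cos; apply: measurable_funM => //.
  by apply: measurable_funD => //; exact: measurable_funM.
have /= -> := restricted_tonelli lam lam mI mJ mf
  (fun u t _ _ => poisson_integrand_ge0 e t (x + a * u) (phi1 t)).
by apply: eq_integral => t _; rewrite /f/= integral_cos_unit_itv.
Qed.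

Lemma foldr_unif_avg_poisson (e : R) (s : seq R) (x : R) :
  foldr unif_avg (poisson e (fun=> 1)) s x =
  poisson e (fun t => \prod_(a <- s) sinc (a * t / 2)) x.
Proof.
elim: s x => [|a s IH] x /=.
  by rewrite /poisson; apply: eq_integral => t _; rewrite big_nil.
rewrite [LHS](_ : _ = unif_avg a (poisson e (fun t => \prod_(b <- s) sinc (b * t / 2))) x); last first.
  by apply: eq_integral => u _; rewrite IH.
rewrite unif_avg_poisson.
- by rewrite /poisson; apply: eq_integral => t _; rewrite big_cons (mulrC (sinc _)).
- apply: measurable_prod => b bs.
  apply: (measurable_fun_comp_real measurable_fun_sincE).
  by apply: measurable_funM => //; exact: measurable_funM.
- move=> t; elim/big_ind: _; first by rewrite normr1.
    by move=> y z y1 z1; rewrite normrM mulr_ile1.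
  by move=> b _; exact: sinc_le1.
Qed.

End PoissonKernel.

Section SmallBall.
Context {R : realType}.
Local Notation lam := (@lebesgue_measure R).

Definition ball_indic (e x : R) : \bar R := ((`|x| <= e)%R%:R)%:E.

Lemma ball_indic_ge0 (e x : R) : (0 <= ball_indic e x)%E.
Proof. by rewrite lee_fin ler0n. Qed.

Lemma ball_indic_le1 (e x : R) : (ball_indic e x <= 1)%E.
Proof. by rewrite lee_fin (ler_nat R _ 1) leq_b1. Qed.

Lemma measurable_ball_indic (e : R) : measurable_fun [set: R] (ball_indic e).
Proof.
apply/measurable_EFinP.
rewrite (_ : (fun x : R => (`|x| <= e)%R%:R) = \1_(`[- e, e]%classic : set R)).
  by apply: measurable_indic.
by apply/funext => x; rewrite indicE mem_setE in_itv/= ler_norml.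
Qed.

Lemma integral_ball_indic (e : R) : 0 <= e ->
  (\int[lam]_x ball_indic e x = (2 * e)%:E)%E.
Proof.
move=> e0.
have E : lam (`[- e, e]%classic : set R) = (2 * e)%:E.
  rewrite lebesgue_measure_itv/= lte_fin.
  move: e0; rewrite le_eqVlt => /predU1P[<-|e0]; first by rewrite oppr0 ltxx mulr0.
  by rewrite ifT; [rewrite -EFinD; congr EFin; ring|lra].
rewrite (_ : ball_indic e = fun x => (\1_(`[- e, e]%classic : set R) x)%:E).
  by rewrite integral_indic// setIT; exact: E.
by apply/funext => x; rewrite /ball_indic indicE mem_setE in_itv/= ler_norml.
Qed.

Lemma poisson1E (e x : R) : 0 < e ->
  poisson e (fun=> 1) x = (1 / e + e / (e ^+ 2 + x ^+ 2))%:E.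
Proof.
move=> e0; rewrite -integral_expRNM_cos//; apply: eq_integral => t _.
by rewrite mul1r.
Qed.

(** For small [e] the difference of arctangents is close to [pi] inside [[-d, d]] and to 0 outside:
    a smooth substitute for the indicator of an interval. *)
Lemma unif_avg_poisson1 (e d x : R) : 0 < e -> 0 < d ->
  unif_avg (2 * d) (poisson e (fun=> 1)) x =
  (1 / e + (2 * d)^-1 * (atan ((x + d) / e) - atan ((x - d) / e)))%:E.
Proof.
move=> e0 d0; rewrite /unif_avg.
under eq_integral do rewrite poisson1E//.
have h2 : - (1 / 2) <= 1 / 2 :> R by lra.
have en0 : e != 0 by rewrite gt_eqF.
have dF (u : R) : - (1 / 2) <= u <= 1 / 2 ->
    is_derive u 1 (fun u => u / e + (2 * d)^-1 * atan ((x + 2 * d * u) / e))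
      (1 / e + e / (e ^+ 2 + (x + 2 * d * u) ^+ 2)).
  move=> _; apply: is_derive_eq; rewrite /GRing.scale/=.
  have h : 0 < e ^+ 2 + (x + 2 * d * u) ^+ 2.
    by rewrite ltr_pwDl ?sqr_ge0 ?exprn_gt0.
  have -> : 1 + ((x + 2 * d * u) / e) ^+ 2 = (e ^+ 2 + (x + 2 * d * u) ^+ 2) / e ^+ 2.
    by field.
  by field; rewrite en0 gt_eqF//= gt_eqF.
have cf (u : R) : - (1 / 2) <= u <= 1 / 2 ->
    {for u, continuous (fun u => 1 / e + e / (e ^+ 2 + (x + 2 * d * u) ^+ 2))}.
  move=> _; apply: is_derive_continuous.
  have h : e ^+ 2 + (x + 2 * d * u) ^+ 2 != 0.
    by rewrite gt_eqF// ltr_pwDl ?sqr_ge0 ?exprn_gt0.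
  have dG : is_derive u 1 (fun u : R => e ^+ 2 + (x + 2 * d * u) ^+ 2)
      (4 * d * (x + 2 * d * u)).
    by apply: is_derive_eq; rewrite /GRing.scale/=; ring.
  by apply: is_derive_eq.
rewrite (integral_segment_derive h2 dF cf); congr EFin.
have -> : x + 2 * d * (1 / 2) = x + d by field.
have -> : x + 2 * d * - (1 / 2) = x - d by field.
by field; rewrite en0 gt_eqF.
Qed.

Lemma integral_expRN (e : R) : 0 < e ->
  (\int[lam]_(t in `[0%R, +oo[) (expR (- (e * t)))%:E = (1 / e)%:E)%E.
Proof.
move=> e0; have en0 : e != 0 by rewrite gt_eqF.
have dF (t : R) : 0 <= t -> is_derive t 1 (fun t => - (expR (- (e * t)) / e))
    (expR (- (e * t))).
  by move=> _; apply: is_derive_eq; rewrite /GRing.scale/=; field.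
apply: (integral_itvy_derive (l := 0) dF).
- by move=> t _; apply: is_derive_continuous; apply: is_derive_eq.
- by move=> t _; exact: expR_ge0.
- rewrite -oppr0; apply: cvgN; apply: (@cvgy0_le _ _ (e^-1 / e)) => t t1.
  have t0 : 0 < t by exact: lt_le_trans t1.
  rewrite ger0_norm; last by rewrite divr_ge0 ?expR_ge0// ltW.
  rewrite mulrAC ler_wpM2r ?invr_ge0 ?(ltW e0)// -invfM.
  by apply: expRN_le_inv; rewrite mulr_gt0.
- by rewrite mulr0 oppr0 expR0 sub0r opprK.
Qed.

Lemma foldr_unif_avg_cst (c : R) (s : seq R) (x : R) : 0 <= c ->
  foldr unif_avg (fun=> c%:E) s x = c%:E.
Proof.
move=> c0; have := @foldr_unif_avg_affine _ c 0 s (fun=> 0%E) x c0 (lexx _).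
by rewrite !mul0e !adde0; apply.
Qed.

Lemma measurable_prod_sinc (s : seq R) :
  measurable_fun [set: R] (fun t => \prod_(a <- s) sinc (a * t / 2)).
Proof.
apply: measurable_prod => b bs.
apply: (measurable_fun_comp_real measurable_fun_sincE).
by apply: measurable_funM => //; exact: measurable_funM.
Qed.

(** On [[-eps, eps]] the averaged Poisson kernel exceeds [1 / e] by at least
    [atan ((d - eps) / e) / d]. On the Fourier side the average of width [2 d] adds one [sinc]
    factor; it and the damping are at most 1 in absolute value and are dropped. The terms [1 / e] on
    the two sides cancel. *)
Lemma foldr_unif_avg_atan (s : seq R) (eps d e : R) : 0 < e -> 0 <= eps < d ->
  ((d^-1 * atan ((d - eps) / e))%:E * foldr unif_avg (ball_indic eps) s 0%R <=
   \int[lam]_(t in `[0%R, +oo[) (`|\prod_(a <- s) sinc (a * t / 2)|)%:E)%E.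
Proof.
move=> e0 /andP[eps0 epsd]; have d0 : 0 < d by exact: le_lt_trans epsd.
set k := d^-1 * _; set J := (X in (_ <= X)%E).
have k0 : 0 <= k.
  rewrite mulr_ge0 ?invr_ge0 ?(ltW d0)// -(@atan0 R) le_atan// divr_ge0 ?(ltW e0)//.
  by rewrite subr_ge0 ltW.
have mb := measurable_ball_indic eps; have b0 := ball_indic_ge0 eps.
have ie0 : 0 <= 1 / e by rewrite divr_ge0// ltW.
have mp : measurable_fun [set: R] (poisson e (fun=> 1%R)).
  rewrite (_ : poisson e _ = fun x => (1 / e + e / (e ^+ 2 + x ^+ 2))%:E); last first.
    by apply/funext => x; rewrite poisson1E.
  apply/measurable_EFinP; apply: measurable_funD => //; apply: measurable_funM => //.
  apply: (measurable_fun_comp_real measurable_invr).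
  by apply: measurable_funD => //; exact: measurable_funX.
have p0 x : (0 <= poisson e (fun=> 1%R) x)%E.
  by rewrite poisson1E// lee_fin addr_ge0// divr_ge0 ?addr_ge0 ?sqr_ge0// ltW.
have : ((1 / e)%:E + k%:E * foldr unif_avg (ball_indic eps) s 0%R <= (1 / e)%:E + J)%E.
  rewrite -foldr_unif_avg_affine//.
  apply: (@le_trans _ _ (foldr unif_avg (unif_avg (2 * d)%R (poisson e (fun=> 1%R))) s 0%R)).
    apply: le_foldr_unif_avg.
    - by apply: emeasurable_funD => //; exact: measurable_funeM.
    - exact: measurable_unif_avg.
    - move=> y; apply: adde_ge0; first by rewrite lee_fin.
      by apply: mule_ge0 => //; rewrite lee_fin.
    - move=> y; rewrite unif_avg_poisson1// /ball_indic -EFinM -EFinD lee_fin lerD2l.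
      have [yeps|yeps] := leP `|y| eps; last first.
        rewrite mulr0 mulr_ge0 ?invr_ge0 ?mulr_ge0 ?(ltW d0)// subr_ge0 le_atan//.
        by rewrite ler_wpM2r ?invr_ge0 ?(ltW e0)//; lra.
      move: yeps; rewrite ler_norml => /andP[y1 y2].
      have h1 : atan ((d - eps) / e) <= atan ((y + d) / e).
        by apply: le_atan; rewrite ler_wpM2r ?invr_ge0 ?(ltW e0)//; lra.
      have h2 : atan ((y - d) / e) <= - atan ((d - eps) / e).
        rewrite -atanN -mulNr; apply: le_atan.
        by rewrite ler_wpM2r ?invr_ge0 ?(ltW e0)//; lra.
      rewrite mulr1 /k.
      set T := atan _ in h1 h2 *.
      have -> : d^-1 * T = (2 * d)^-1 * (2 * T) by field; rewrite gt_eqF.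
      by rewrite ler_wpM2l ?invr_ge0 ?mulr_ge0 ?(ltW d0)//; lra.
  (* The smoothing average is the innermost one, so its coefficient goes to the end of the list. *)
  rewrite -foldr_rcons foldr_unif_avg_poisson /poisson /J -integral_expRN//.
  have mJ : measurable_fun [set: R] (fun t => (`|\prod_(a <- s) sinc (a * t / 2)|)%:E).
    by apply/measurable_EFinP; apply: measurableT_comp => //; exact: measurable_prod_sinc.
  have mE : measurable_fun [set: R] (fun t => (expR (- (e * t)))%:E).
    apply/measurable_EFinP; apply: measurable_fun_expR; apply: measurable_funN.
    exact: measurable_funM.
  rewrite -ge0_integralD//; [|exact: measurable_funTS|exact: measurable_funTS].
  apply: ge0_le_integral => //.
  - move=> t _; rewrite lee_fin; apply: poisson_integrand_ge0.
    elim/big_ind: _; first by rewrite normr1.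
      by move=> y z y1 z1; rewrite normrM mulr_ile1.
    by move=> b _; exact: sinc_le1.
  - apply: measurable_funTS; apply/measurable_EFinP; apply: measurable_funM.
      exact/measurable_EFinP.
    apply: measurable_funD => //; apply: measurable_funM; first exact: measurable_prod_sinc.
    by apply: measurable_fun_cos; exact: measurable_funM.
  - by apply: emeasurable_funD; exact: measurable_funTS.
  - move=> t /=; rewrite in_itv/= andbT => t0; rewrite -EFinD lee_fin.
    rewrite mulrDr mulr1 lerD2l mulr0 cos0 mulr1 big_rcons/=.
    apply: (@le_trans _ _ (1 * `|\prod_(a <- s) sinc (a * t / 2)|)); last by rewrite mul1r.
    apply: le_trans (ler_norm _) _; rewrite !normrM ler_pM//.
      by rewrite ger0_norm ?expR_ge0// expR_le1 oppr_le0 mulr_ge0// ltW.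
    by rewrite ler_piMr ?sinc_le1.
by rewrite leeD2lE.
Qed.

(** The damping [e] tends to 0 first, so that the arctangent tends to [pi / 2], and then [d]
    decreases to [eps]. *)
Lemma foldr_unif_avg_fourier (s : seq R) (eps C : R) : 0 < eps ->
  (\int[lam]_(t in `[0%R, +oo[) (`|\prod_(a <- s) sinc (a * t / 2)|)%:E <= C%:E)%E ->
  (foldr unif_avg (ball_indic eps) s 0%R <= (2 * eps * C / pi)%:E)%E.
Proof.
move=> eps0 JC; have p0 := pi_gt0 R.
set P := foldr _ _ _ _.
have P0 : (0 <= P)%E by apply: foldr_unif_avg_ge0; exact: ball_indic_ge0.
have P1 : (P <= 1)%E.
  rewrite -[1%E](foldr_unif_avg_cst s 0 ler01); apply: le_foldr_unif_avg => //.
  - exact: measurable_ball_indic.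
  - exact: ball_indic_ge0.
  - exact: ball_indic_le1.
have Pfin : P \is a fin_num by rewrite ge0_fin_numE// (le_lt_trans P1) ?ltry.
set p := fine P; have PE : P = p%:E by rewrite fineK.
(* The choice [e = (d - eps) / y] makes [y] the argument of the arctangent, so [e -> 0] becomes
   [y -> +oo]. *)
have h d (y : R) : eps < d -> 0 < y -> p * atan y <= d * C.
  move=> epsd y0; have d0 : 0 < d by exact: lt_trans epsd.
  have e0 : 0 < (d - eps) / y by rewrite divr_gt0// subr_gt0.
  have ed : 0 <= eps < d by rewrite epsd ltW.
  have := le_trans (foldr_unif_avg_atan s e0 ed) JC.
  rewrite -/P PE -EFinM lee_fin invf_div mulrCA mulfV ?mulr1; last first.
    by rewrite gt_eqF// subr_gt0.
  by rewrite -mulrA ler_pdivrMl// mulrC.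
have h' d : eps < d -> p * (pi / 2) <= d * C.
  move=> epsd; apply: (@cvgr_to_le _ (+oo%R : set_system R) _ R (fun y => p * atan y)).
    by apply: cvgMr; exact: cvgy_atan.
  near=> y; apply: h => //; near: y; apply: nbhs_pinfty_gt; exact: num_real.
have C0 : 0 <= C.
  rewrite -lee_fin; apply: le_trans JC; apply: integral_ge0 => t _.
  by rewrite lee_fin.
rewrite PE lee_fin ler_pdivlMr//.
have : p * (pi / 2) <= eps * C.
  apply/ler_addgt0Pr => e e0.
  (* The denominator is [C + 1] because [C] may be 0. *)
  have := @h' (eps + e / (C + 1)).
  have C1 : 0 < C + 1 by rewrite ltr_wpDl.
  rewrite ltrDl divr_gt0// => /(_ isT) /le_trans; apply.
  rewrite mulrDl lerD2l mulrAC ler_pdivrMr// ler_wpM2l ?(ltW e0)//.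
  by rewrite lerDl.
by lra.
Unshelve. all: by end_near. Qed.

End SmallBall.

(** * Ball's cube slicing inequality *)

Section CubeSlicing.
Context {R : realType}.
Local Notation lam := (@lebesgue_measure R).
Implicit Type s : seq R.

(* For [w i = 0] the exponent is the junk value [0^-1 = 0], and the term vanishes. *)
Lemma prod_le_sum_powR s (w x : R -> R) :
  (forall i, 0 <= w i) -> \sum_(i <- s) w i = 1 -> (forall i, 0 <= x i <= 1) ->
  \prod_(i <- s) x i <= \sum_(i <- s) w i * x i `^ (w i)^-1.
Proof.
move=> w0 w1 x01.
set m := \sum_(i <- s) _.
have [/hasP[i si /eqP xi]|/hasPn x0] := boolP (has (fun i => x i == 0) s).
  have -> : \prod_(i <- s) x i = 0.
    by apply/eqP; rewrite prodf_seq_eq0; apply/hasP; exists i; rewrite ?xi ?eqxx.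
  by apply: sumr_ge0 => j _; rewrite mulr_ge0 ?powR_ge0.
have xgt0 i : i \in s -> 0 < x i.
  by move=> si; rewrite lt_neqAle eq_sym x0//; case/andP: (x01 i).
have m0 : 0 < m.
  have [i si wi] : exists2 i, i \in s & w i != 0.
    apply/hasP; apply: contraT => /hasPn h; have := w1.
    rewrite big_seq big1 => [/esym/eqP|i si]; first by rewrite oner_eq0.
    by have := h i si; rewrite negbK => /eqP.
  rewrite lt_neqAle eq_sym; apply/andP; split; last first.
    by apply: sumr_ge0 => j _; rewrite mulr_ge0 ?powR_ge0.
  rewrite psumr_neq0 => [|j _]; last by rewrite mulr_ge0 ?powR_ge0.
  apply/hasP; exists i => //=.
  by rewrite mulr_gt0 ?powR_gt0 ?xgt0// lt_neqAle eq_sym wi w0.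
have -> : \prod_(i <- s) x i = expR (\sum_(i <- s) ln (x i)).
  rewrite expR_sum big_seq [RHS]big_seq; apply: eq_bigr => i si.
  by rewrite lnK// posrE xgt0.
rewrite -[leRHS]lnK ?posrE// ler_expR.
(* The logarithm is bounded by its tangent at the weighted mean [m]; the linear corrections sum to
   0. *)
apply: (@le_trans _ _ (\sum_(i <- s)
    (w i * ln m + (w i * x i `^ (w i)^-1 / m - w i)))).
  rewrite big_seq [leRHS]big_seq; apply: ler_sum => i si.
  have [wi|wi] := eqVneq (w i) 0.
    rewrite wi !mul0r subrr addr0; apply: ln_le0.
    by case/andP: (x01 i).
  set y := x i `^ (w i)^-1.
  have y0 : 0 < y by rewrite powR_gt0// xgt0.
  have -> : ln (x i) = w i * ln y by rewrite /y ln_powR mulrA mulfV ?mul1r.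
  rewrite -[ln y](subrK (ln m)) addrC -ln_div ?posrE// mulrDr lerD2l.
  have -> : w i * y / m - w i = w i * (y / m - 1) by ring.
  rewrite ler_wpM2l//.
  have ym : 0 < y / m by rewrite divr_gt0.
  have := expR_ge1Dx (ln (y / m)).
  by rewrite lnK ?posrE//; lra.
rewrite big_split /= -mulr_suml w1 mul1r big_split /= -mulr_suml sumrN w1.
by rewrite divff ?gt_eqF// subrr addr0.
Qed.

Lemma integral_sinc_powR (a p : R) : a != 0 -> 2 < p ->
  (\int[lam]_(t in `[0%R, +oo[) (`|sinc (a * t / 2)| `^ p)%:E <=
   (pi / `|a| * Num.sqrt (2 / p))%:E)%E.
Proof.
move=> a0 p2; have b0 : 0 < `|a| / 2 by rewrite divr_gt0 ?normr_gt0.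
have ms : measurable_fun [set: R] (fun t => (`|sinc t| `^ p)%:E).
  apply/measurable_EFinP; apply: (measurable_fun_comp_real (measurable_powR p)).
  apply: measurableT_comp => //; exact: measurable_fun_sincE.
have sincN (y : R) : sinc (- y) = sinc y.
  by rewrite /sinc oppr_eq0; case: eqP => // _; rewrite sinN invrN mulrNN.
have -> : (\int[lam]_(t in `[0%R, +oo[) (`|sinc (a * t / 2)| `^ p)%:E =
    \int[lam]_(t in `[0%R, +oo[) (`|sinc (`|a| / 2 * t)| `^ p)%:E)%E.
  apply: eq_integral => t _; congr ((`|_| `^ _)%:E).
  have [a1|a1] := leP 0 a.
    by rewrite ger0_norm//; congr sinc; ring.
  by rewrite ltr0_norm// -sincN; congr sinc; ring.
rewrite (ge0_integral_scale0y (f := fun t => (`|sinc t| `^ p)%:E) b0)//.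
rewrite -integral_itv_obnd_cbnd; last exact: measurable_funTS.
have -> : (\int[lam]_(t in `]0%R, +oo[) (`|sinc t| `^ p)%:E =
    \int[lam]_(t in `]0%R, +oo[) (`|sin t / t| `^ p)%:E)%E.
  apply: eq_integral => t; rewrite inE/= in_itv/= andbT => t0.
  by rewrite /sinc gt_eqF.
have -> : (pi / `|a| * Num.sqrt (2 / p))%:E =
    ((`|a| / 2)^-1%:E * (pi / 2 * Num.sqrt (2 / p))%:E)%E.
  by rewrite -EFinM; congr EFin; field; rewrite normr_eq0.
by rewrite lee_wpmul2l ?ball_integral// lee_fin invr_ge0 ltW.
Qed.

(** The small ball form of the inequality: after division by [2 eps], the density at 0 of the
    weighted sum is at most [sqrt 2] over the norm of the coefficients. *)
Lemma cube_small_ball s (eps : R) : 0 < eps -> 0 < \sum_(a <- s) a ^+ 2 ->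
  (foldr unif_avg (ball_indic eps) s 0%R <=
   (2 * Num.sqrt 2 * eps / Num.sqrt (\sum_(a <- s) a ^+ 2))%:E)%E.
Proof.
move=> eps0; set S := \sum_(a <- s) _ => S0.
have p0 := pi_gt0 R.
set sg := Num.sqrt S.
have sg0 : 0 < sg by rewrite sqrtr_gt0.
have sg2 : sg ^+ 2 = S by rewrite sqr_sqrtr// ltW.
have [/hasP[a sa Sa]|/hasPn small] := boolP (has (fun a => S <= 2 * a ^+ 2) s).
  have a0 : a != 0.
    by apply: contraTneq Sa => ->; rewrite expr0n mulr0 -ltNge.
  apply: le_trans (foldr_unif_avg_le 0 sa a0 (measurable_ball_indic eps)
    (ball_indic_ge0 eps)) _.
  rewrite (integral_ball_indic (ltW eps0)) -EFinM lee_fin.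
  have -> : 2 * Num.sqrt 2 * eps / sg = (Num.sqrt 2 / sg) * (2 * eps) by ring.
  rewrite ler_wpM2r ?mulr_ge0 ?(ltW eps0)//.
  rewrite -[leLHS]mul1r ler_pdivrMr ?normr_gt0// mulrAC ler_pdivlMr// mul1r.
  rewrite -(@ler_pXn2r _ 2) ?nnegrE ?mulr_ge0 ?(ltW sg0) ?sqrtr_ge0//.
  by rewrite sg2 exprMn sqr_sqrtr// real_normK ?num_real.
have h : (\int[lam]_(t in `[0%R, +oo[) (`|\prod_(a <- s) sinc (a * t / 2)|)%:E <=
    (pi * Num.sqrt 2 / sg)%:E)%E.
  (* The factor of [a] gets the exponent [p = S / a^2 > 2], and its integral is at most
     [(pi / |a|) sqrt (2 / p) = pi sqrt 2 / sg]. This does not depend on [a], so the weights sum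
     out. *)
  pose w (a : R) := a ^+ 2 / S.
  have w0 a : 0 <= w a by rewrite divr_ge0 ?sqr_ge0// ltW.
  have w1 : \sum_(a <- s) w a = 1 by rewrite -mulr_suml divff ?gt_eqF.
  have mp (a : R) : measurable_fun [set: R]
      (fun t => (w a * `|sinc (a * t / 2)| `^ (w a)^-1)%:E).
    apply/measurable_EFinP; apply: measurable_funM => //.
    apply: (measurable_fun_comp_real (measurable_powR _)).
    apply: measurableT_comp => //.
    apply: (measurable_fun_comp_real measurable_fun_sincE).
    by apply: measurable_funM => //; exact: measurable_funM.
  apply: (@le_trans _ _ (\int[lam]_(t in `[0%R, +oo[)
    (\sum_(a <- s) (w a * `|sinc (a * t / 2)| `^ (w a)^-1)%:E))%E).
    apply: ge0_le_integral => //.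
    - apply: measurable_funTS; apply/measurable_EFinP; apply: measurableT_comp => //.
      exact: measurable_prod_sinc.
    - apply: measurable_funTS; exact: emeasurable_sum.
    - move=> t _; rewrite sumEFin lee_fin normr_prod.
      apply: (@prod_le_sum_powR s w (fun a => `|sinc (a * t / 2)|)) => // a.
      by rewrite normr_ge0 sinc_le1.
  rewrite ge0_integral_sum//; last 2 first.
  - by move=> a; apply: measurable_funTS; exact: mp.
  - by move=> a t _; rewrite lee_fin mulr_ge0 ?powR_ge0.
  have -> : (pi * Num.sqrt 2 / sg)%:E = (\sum_(a <- s) (w a * (pi * Num.sqrt 2 / sg))%:E)%E.
    by rewrite sumEFin -mulr_suml w1 mul1r.
  rewrite big_seq [leRHS]big_seq; apply: lee_sum => a sa.
  under eq_integral do rewrite EFinM.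
  rewrite ge0_integralZl_EFin//; last first.
    apply: measurable_funTS; apply/measurable_EFinP.
    apply: (measurable_fun_comp_real (measurable_powR _)).
    apply: measurableT_comp => //.
    apply: (measurable_fun_comp_real measurable_fun_sincE).
    by apply: measurable_funM => //; exact: measurable_funM.
  rewrite [leRHS]EFinM; have [a0|a0] := eqVneq a 0.
    have -> : w a = 0 by rewrite /w a0 expr0n/= mul0r.
    by rewrite !mul0e.
  rewrite lee_wpmul2l ?lee_fin//.
  have a20 : 0 < a ^+ 2 by rewrite exprn_even_gt0.
  apply: le_trans (integral_sinc_powR a0 _) _.
    rewrite /w invf_div ltr_pdivlMr//.
    by have := small a sa; rewrite -ltNge.
  rewrite lee_fin /w invrK sqrtrM//.
  rewrite sqrtrM ?sqr_ge0// sqrtr_sqr sqrtrV ?(ltW S0)// -/sg.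
  have na0 : `|a| != 0 by rewrite normr_eq0.
  rewrite le_eqVlt; apply/orP; left; apply/eqP.
  by field; rewrite na0 gt_eqF.
apply: le_trans (foldr_unif_avg_fourier eps0 h) _.
rewrite lee_fin le_eqVlt; apply/orP; left; apply/eqP.
have pn0 : pi != 0 :> R by rewrite gt_eqF.
clear h p0; move: (pi : R) pn0 => p pn0; field.
by rewrite pn0 gt_eqF.
Qed.

End CubeSlicing.

(** * Lebesgue measure on tuples *)

Section TupleIntegral.
Context {R : realType}.
Local Notation mR := (measurableTypeR R).
Local Notation lam := (@lebesgue_measure R).
Local Notation L k := (@lebesgue_tuple R k).
Local Open Scope ereal_scope.

Lemma measurable_tcons k :
  measurable_fun setT (fun p : mR * k.-tuple mR => [tuple of p.1 :: p.2]).
Proof. exact: measurable_cons. Qed.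

Lemma ge0_integral_tuple0 (f : 0.-tuple mR -> \bar R) :
  measurable_fun setT f -> (forall t, 0 <= f t) ->
  \int[L 0]_t f t = f [tuple].
Proof.
move=> mf f0; rewrite [LHS](_ : _ = \int[\d_ ([tuple] : 0.-tuple mR)]_t f t)//.
by rewrite integral_dirac// diracT mul1e.
Qed.

Lemma ge0_integral_tupleS k (f : k.+1.-tuple mR -> \bar R) :
  measurable_fun setT f -> (forall t, 0 <= f t) ->
  \int[L k.+1]_t f t = \int[lam]_x \int[L k]_t f [tuple of x :: t].
Proof.
move=> mf f0.
rewrite [LHS](_ : _ = \int[pushforward (lam \x L k)
   (fun p : mR * k.-tuple mR => [tuple of p.1 :: p.2])]_t f t)//.
rewrite ge0_integral_pushforward//; last exact: measurable_tcons.
rewrite preimage_setT fubini_tonelli1//.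
  by apply: measurableT_comp => //; exact: measurable_tcons.
by move=> p; exact: f0.
Qed.

Definition tmap k (phi : 'I_k -> mR -> mR) (t : k.-tuple mR) : k.-tuple mR :=
  [tuple phi i (tnth t i) | i < k].

Lemma measurable_tmap k (phi : 'I_k -> mR -> mR) :
  (forall i, measurable_fun setT (phi i)) -> measurable_fun setT (tmap phi).
Proof.
move=> mphi; apply/measurable_fun_tnthP => i.
rewrite (_ : _ \o _ = (phi i) \o (fun t => tnth t i)).
  by apply: measurableT_comp => //; exact: measurable_tnth.
by apply/funext => t /=; rewrite tnth_mktuple.
Qed.

Lemma tmap_cons k (phi : 'I_k.+1 -> mR -> mR) x (t : k.-tuple mR) :
  tmap phi [tuple of x :: t] =
  [tuple of phi ord0 x :: tmap (fun i => phi (lift ord0 i)) t].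
Proof.
apply: eq_from_tnth => i; rewrite tnth_mktuple.
by case: (unliftP ord0 i) => [j|] ->; rewrite ?tnth0 ?tnthS ?tnth_mktuple.
Qed.

(** A coordinatewise change of variables, stated so as to cover translations, the reflection in the
    origin and dilations at once. *)
Lemma ge0_integral_tmap k (phi : 'I_k -> mR -> mR) (c : R) (f : k.-tuple mR -> \bar R) :
  (0 <= c)%R -> (forall i, measurable_fun setT (phi i)) ->
  (forall i (g : mR -> \bar R), measurable_fun setT g -> (forall x, 0 <= g x) ->
     \int[lam]_x g (phi i x) = c%:E * \int[lam]_x g x) ->
  measurable_fun setT f -> (forall t, 0 <= f t) ->
  \int[L k]_t f (tmap phi t) = (c ^+ k)%:E * \int[L k]_t f t.
Proof.
move=> c0; elim: k phi f => [|k IH] phi f mphi Iphi mf f0.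
  rewrite !ge0_integral_tuple0 ?expr0 ?mul1e//.
  - by congr f; apply: eq_from_tnth => -[].
  - by apply: measurableT_comp => //; exact: measurable_tmap.
have mfc x : measurable_fun setT (fun t : k.-tuple mR => f [tuple of x :: t]).
  apply: measurableT_comp => //.
  exact: (measurable_cons (measurable_cst x) (@measurable_id _ _ setT)).
have mF : measurable_fun setT (fun x : mR => \int[L k]_t f [tuple of x :: t]).
  apply: (measurable_fun_fubini_tonelli_F (m2 := L k)
     (fun p : mR * k.-tuple mR => f [tuple of p.1 :: p.2])) => //.
  by apply: measurableT_comp => //; exact: measurable_tcons.
have F0 x : 0 <= \int[L k]_t f [tuple of x :: t] by exact: integral_ge0.
rewrite ge0_integral_tupleS//; last first.
  by apply: measurableT_comp => //; exact: measurable_tmap.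
transitivity (\int[lam]_x ((c ^+ k)%:E * \int[L k]_t f [tuple of phi ord0 x :: t])).
  apply: eq_integral => x _; under eq_integral do rewrite tmap_cons.
  apply: (IH (fun i => phi (lift ord0 i)) (fun t => f [tuple of phi ord0 x :: t])) => //.
  by move=> i; exact: Iphi.
rewrite ge0_integralZl_EFin//; last 2 first.
- apply: (measurableT_comp mF); exact: mphi.
- by rewrite exprn_ge0.
rewrite (Iphi ord0 (fun x => \int[L k]_t f [tuple of x :: t]))//.
by rewrite -ge0_integral_tupleS// muleA -EFinM exprSr.
Qed.

End TupleIntegral.

(** * Invariance under orthogonal maps *)

Section Orthogonal.
Context {R : realType}.
Local Notation mR := (measurableTypeR R).
Local Notation L k := (@lebesgue_tuple R k).

(** Tuples carry the measure and row vectors the linear algebra; [trow] and [rowt] pass between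
    them. *)
Definition trow k (t : k.-tuple mR) : 'rV[R]_k := \row_i tnth t i.

Definition rowt k (x : 'rV[R]_k) : k.-tuple mR := [tuple x 0 i | i < k].

Lemma rowtK k : cancel (@rowt k) (@trow k).
Proof. by move=> x; apply/rowP => i; rewrite !mxE tnth_mktuple. Qed.

Lemma trowK k : cancel (@trow k) (@rowt k).
Proof. by move=> t; apply: eq_from_tnth => i; rewrite tnth_mktuple mxE. Qed.

Lemma measurable_rowt d (T : measurableType d) k (f : T -> 'rV[R]_k) :
  (forall i, measurable_fun setT (fun z => f z 0 i)) ->
  measurable_fun setT (fun z => rowt (f z)).
Proof.
move=> mf; apply/measurable_fun_tnthP => i.
rewrite (_ : _ \o _ = fun z => f z 0 i); first exact: mf.
by apply/funext => z /=; rewrite tnth_mktuple.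
Qed.

Lemma measurable_trow k (i : 'I_k) : measurable_fun setT (fun t : k.-tuple mR => trow t 0 i).
Proof.
rewrite (_ : (fun t => _) = fun t : k.-tuple mR => tnth t i); first exact: measurable_tnth.
by apply/funext => t; rewrite mxE.
Qed.

Lemma measurable_dot d (T : measurableType d) k (f g : T -> 'rV[R]_k) :
  (forall i, measurable_fun setT (fun z => f z 0 i)) ->
  (forall i, measurable_fun setT (fun z => g z 0 i)) ->
  measurable_fun setT (fun z => dot (f z) (g z)).
Proof.
move=> mf mg; rewrite /dot; apply: measurable_sum => i.
exact: measurable_funM.
Qed.

Lemma measurable_mulmxr d (T : measurableType d) k n (f : T -> 'rV[R]_k) (A : 'M[R]_(k, n)) i :
  (forall i, measurable_fun setT (fun z => f z 0 i)) ->
  measurable_fun setT (fun z => (f z *m A) 0 i).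
Proof.
move=> mf; under eq_fun do rewrite mxE.
by apply: measurable_sum => j; exact: measurable_funM.
Qed.

Lemma dotE k (x y : 'rV[R]_k) : dot x y = (x *m y^T) 0 0.
Proof. by rewrite mxE; apply: eq_bigr => i _; rewrite mxE. Qed.

Lemma dot_orthogonal k n (A : 'M[R]_(k, n)) (x y : 'rV[R]_k) :
  A *m A^T = 1%:M -> dot (x *m A) (y *m A) = dot x y.
Proof.
by move=> AA; rewrite !dotE trmx_mul mulmxA -(mulmxA x) AA mulmx1.
Qed.

Lemma dot_ge0 k (x : 'rV[R]_k) : 0 <= dot x x.
Proof. by apply: sumr_ge0 => i _; rewrite -expr2 sqr_ge0. Qed.

Local Open Scope ereal_scope.
Implicit Type k : nat.

Lemma ge0_integral_tuple_shift k (v : 'rV[R]_k) (f : k.-tuple mR -> \bar R) :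
  measurable_fun setT f -> (forall t, 0 <= f t) ->
  \int[L k]_t f (rowt (trow t + v)%R) = \int[L k]_t f t.
Proof.
move=> mf f0.
have := @ge0_integral_tmap R k (fun i x => x + v 0 i)%R 1 f ler01.
rewrite expr1n mul1e => <-//.
- apply: eq_integral => t _; congr f; apply: eq_from_tnth => i.
  by rewrite !tnth_mktuple !mxE.
- by move=> i; exact: measurable_funD.
- by move=> i g mg g0; rewrite mul1e ge0_integral_shift.
Qed.

Lemma ge0_integral_tupleN k (f : k.-tuple mR -> \bar R) :
  measurable_fun setT f -> (forall t, 0 <= f t) ->
  \int[L k]_t f (rowt (- trow t)%R) = \int[L k]_t f t.
Proof.
move=> mf f0.
have := @ge0_integral_tmap R k (fun i x => - x)%R 1 f ler01.
rewrite expr1n mul1e => <-//.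
- apply: eq_integral => t _; congr f; apply: eq_from_tnth => i.
  by rewrite !tnth_mktuple !mxE.
- by move=> i; exact: oppr_measurable.
- by move=> i g mg g0; rewrite mul1e ge0_integral_opp.
Qed.

Lemma ge0_integral_tuple_scale k (c : R) (f : k.-tuple mR -> \bar R) : (0 < c)%R ->
  measurable_fun setT f -> (forall t, 0 <= f t) ->
  \int[L k]_t f (rowt (c *: trow t)%R) = (c ^- k)%:E * \int[L k]_t f t.
Proof.
move=> c0 mf f0.
have c0' : (0 <= c^-1)%R by rewrite invr_ge0 ltW.
have := @ge0_integral_tmap R k (fun i x => c * x)%R c^-1 f c0'.
rewrite exprVn => <-//.
- apply: eq_integral => t _; congr f; apply: eq_from_tnth => i.
  by rewrite !tnth_mktuple !mxE.
- by move=> i; exact: measurable_funM.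
- move=> i g mg g0; rewrite -(ge0_integral_affine 0 c0)//.
  by apply: eq_integral => x _; rewrite addr0.
Qed.

Definition eball_tuple k (r : R) : set (k.-tuple mR) :=
  [set t | dot (trow t) (trow t) <= r ^+ 2]%R.

Lemma measurable_eball_tuple k (r : R) : measurable (@eball_tuple k r).
Proof.
have m : measurable_fun setT (fun t : k.-tuple mR => dot (trow t) (trow t)).
  by apply: measurable_dot => i; exact: measurable_trow.
have -> : @eball_tuple k r =
    setT `&` (fun t : k.-tuple mR => dot (trow t) (trow t)) @^-1` `]-oo, (r ^+ 2)%R]%classic.
  by apply/seteqP; split => t /=; rewrite in_itv/= => // -[].
by apply: m => //; exact: measurable_itv.
Qed.

Lemma lebesgue_eball_tuple_lty k : L k (eball_tuple 1) < +oo.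
Proof.
have mbox : measurable [set t : k.-tuple mR | forall i : 'I_k,
    (`[(-1)%R, 1%R]%classic : set mR) (tnth t i)].
  rewrite (_ : [set t | _] = \bigcap_(i in [set: 'I_k])
      ((fun t : k.-tuple mR => tnth t i) @^-1` (`[(-1)%R, 1%R]%classic : set mR))).
    apply: fin_bigcap_measurable => // i _.
    by rewrite -[X in measurable X]setTI; apply: measurable_tnth => //; exact: measurable_itv.
  by apply/seteqP; split => t /= tA i; [move=> _|]; exact: tA.
apply: (@le_lt_trans _ _ (L k [set t : k.-tuple mR | forall i : 'I_k,
    (`[(-1)%R, 1%R]%classic : set mR) (tnth t i)])).
  apply: le_measure; rewrite ?inE//; first exact: measurable_eball_tuple.
  move=> t /= t1 i; rewrite in_itv/= -ler_norml.
  rewrite -(@ler_pXn2r _ 2) ?nnegrE// real_normK ?num_real//.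
  apply: le_trans t1; rewrite /dot (bigD1 i)//= !mxE -expr2 lerDl.
  by apply: sumr_ge0 => j _; rewrite mxE -expr2 sqr_ge0.
rewrite (@lebesgue_tuple_box R k (fun=> (`[(-1)%R, 1%R]%classic : set mR)))//.
set P := \prod_(i < k) _.
suff /andP[] : (0 <= P) && (P < +oo) by [].
rewrite /P; elim/big_ind: _ => //.
- by rewrite ltry lee_fin ler01.
- move=> x y /andP[x0 xy] /andP[y0 yy]; rewrite mule_ge0//.
  by rewrite lte_mul_pinfty// ge0_fin_numE.
- move=> i _; rewrite measure_ge0 lebesgue_measure_itv/=.
  by case: ifP => _; rewrite ?ltry.
Qed.

Lemma lebesgue_eball_tuple_gt0 k : 0 < L k (eball_tuple 1).
Proof.
(* The cube of half-side [c] lies in the unit ball because [k c^2 <= k c <= 1]; the successor keeps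
   [c] meaningful for [k = 0]. *)
pose c : R := (k.+1%:R^-1)%R.
have c0 : (0 < c)%R by rewrite invr_gt0.
have mbox : measurable [set t : k.-tuple mR | forall i : 'I_k,
    (`[(-c)%R, c]%classic : set mR) (tnth t i)].
  rewrite (_ : [set t | _] = \bigcap_(i in [set: 'I_k])
      ((fun t : k.-tuple mR => tnth t i) @^-1` (`[(-c)%R, c]%classic : set mR))).
    apply: fin_bigcap_measurable => // i _.
    by rewrite -[X in measurable X]setTI; apply: measurable_tnth => //; exact: measurable_itv.
  by apply/seteqP; split => t /= tA i; [move=> _|]; exact: tA.
apply: (@lt_le_trans _ _ (L k [set t : k.-tuple mR | forall i : 'I_k,
    (`[(-c)%R, c]%classic : set mR) (tnth t i)])).
  rewrite (@lebesgue_tuple_box R k (fun=> (`[(-c)%R, c]%classic : set mR)))//.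
  elim/big_ind: _ => //.
  - by move=> x y x0 y0; rewrite mule_gt0.
  - move=> i _; rewrite lebesgue_measure_itv/= lte_fin.
    by rewrite ifT -?EFinD ?lte_fin; lra.
apply: le_measure; rewrite ?inE//; first exact: measurable_eball_tuple.
move=> t /= tc; rewrite /eball_tuple/= /dot expr1n.
apply: (@le_trans _ _ (\sum_(i < k) c)%R).
  apply: ler_sum => i _; rewrite mxE -expr2.
  have := tc i; rewrite in_itv/= -ler_norml => tci.
  have c1 : (c <= 1)%R by rewrite invf_le1// ler1n.
  rewrite -real_normK ?num_real// expr2 -[leRHS]mulr1.
  by rewrite ler_pM// (le_trans tci).
rewrite sumr_const card_ord -mulr_natl /c ler_pdivrMr// mul1r ler_nat.
exact: leqnSn.
Qed.

(* Uniqueness of Haar measure: with [g] the indicator of the unit ball and [T] the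
   orthogonal map, translation invariance turns [int g * int (f \o T)] into
   [int (g \o T) * int f = int g * int f]. *)
Lemma ge0_integral_tuple_orthogonal k (A : 'M[R]_k) (f : k.-tuple mR -> \bar R) :
  A *m A^T = 1%:M -> measurable_fun setT f -> (forall t, 0 <= f t) ->
  \int[L k]_t f (rowt (trow t *m A)) = \int[L k]_t f t.
Proof.
move=> AA mf f0; have AA' := mulmx1C AA.
pose g (t : k.-tuple mR) : \bar R := (\1_(eball_tuple 1) t)%:E.
have mg : measurable_fun setT g.
  by apply/measurable_EFinP; apply: measurable_indic; exact: measurable_eball_tuple.
have g0 t : 0 <= g t by rewrite lee_fin.
pose T (t : k.-tuple mR) := rowt (trow t *m A).
have mT : measurable_fun setT T.
  by apply: measurable_rowt => i; apply: measurable_mulmxr => j; exact: measurable_trow.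
have gT t : g (T t) = g t.
  rewrite /g !indicE; suff -> : (T t \in eball_tuple 1) = (t \in eball_tuple 1) by [].
  by apply/idP/idP; rewrite !inE /eball_tuple/= /T rowtK dot_orthogonal.
have Ig : \int[L k]_t g t = L k (eball_tuple 1).
  by rewrite integral_indic ?setIT//; exact: measurable_eball_tuple.
have mfT : measurable_fun setT (f \o T) by exact: measurableT_comp.
have mcoord1 i : measurable_fun setT (fun z : k.-tuple mR * k.-tuple mR => (trow z.1 0 i)%R).
  exact: (measurableT_comp (measurable_trow i) measurable_fst).
have mcoord2 i : measurable_fun setT (fun z : k.-tuple mR * k.-tuple mR => (trow z.2 0 i)%R).
  exact: (measurableT_comp (measurable_trow i) measurable_snd).
have E : (\int[L k]_t g t) * (\int[L k]_t f (T t)) = (\int[L k]_t g t) * \int[L k]_t f t.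
  transitivity (\int[L k]_x \int[L k]_y (f (T x) * g (rowt (trow y + trow (T x))%R))).
    rewrite muleC -ge0_integralZr//; last by rewrite integral_ge0.
    apply: eq_integral => x _; rewrite ge0_integralZl//.
    - by rewrite (ge0_integral_tuple_shift (trow (T x)) mg).
    - apply: (measurableT_comp mg); apply: measurable_rowt => i.
      under eq_fun do rewrite mxE.
      by apply: measurable_funD => //; exact: measurable_trow.
  rewrite (fubini_tonelli (fun z : k.-tuple mR * k.-tuple mR =>
     f (T z.1) * g (rowt (trow z.2 + trow (T z.1))%R)))/=; last 2 first.
  - apply: emeasurable_funM.
      by apply: (measurableT_comp mfT); exact: measurable_fst.
    apply: (measurableT_comp mg); apply: measurable_rowt => i.
    under eq_fun do rewrite mxE.
    apply: measurable_funD => //; rewrite /T; under eq_fun do rewrite rowtK.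
    exact: measurable_mulmxr.
  - by move=> z; rewrite mule_ge0.
  transitivity (\int[L k]_y \int[L k]_x (f (rowt (trow (T x) - trow y)%R) * g (T x))).
    apply: eq_integral => y _.
    pose h (x : k.-tuple mR) := f (T x) * g (rowt (trow y + trow (T x))%R).
    have mh : measurable_fun setT h.
      apply: emeasurable_funM => //.
      apply: (measurableT_comp mg); apply: measurable_rowt => i.
      under eq_fun do rewrite mxE.
      apply: measurable_funD => //; rewrite /T; under eq_fun do rewrite rowtK.
      by apply: measurable_mulmxr => j; exact: measurable_trow.
    have h0 x : 0 <= h x by rewrite /h mule_ge0.
    (* Translating [x] by [- y A^T] moves [T x] by [- y], so that [y] leaves the argument of [g] and
       enters that of [f]. *)
    rewrite -[LHS](ge0_integral_tuple_shift (- (trow y *m A^T)) mh h0).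
    apply: eq_integral => x _; rewrite /h.
    have -> : T (rowt (trow x - trow y *m A^T)) = rowt (trow (T x) - trow y).
      by rewrite /T !rowtK mulmxBl -mulmxA AA' mulmx1.
    congr (_ * g _).
    by rewrite rowtK addrC subrK trowK.
  rewrite (fubini_tonelli (fun z : k.-tuple mR * k.-tuple mR =>
     f (rowt (trow (T z.2) - trow z.1)%R) * g (T z.2)))/=; last 2 first.
  - apply: emeasurable_funM; last first.
      by apply: (measurableT_comp mg); exact: (measurableT_comp mT).
    apply: (measurableT_comp mf); apply: measurable_rowt => i.
    under eq_fun do rewrite !mxE.
    rewrite /T; under eq_fun do rewrite tnth_mktuple.
    apply: measurable_funB; first exact: measurable_mulmxr.
    by have := mcoord1 i; under eq_fun do rewrite mxE.
  - by move=> z; rewrite mule_ge0.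
  transitivity (\int[L k]_x (g x * \int[L k]_y f y)).
    apply: eq_integral => x _; rewrite ge0_integralZr//.
    - rewrite gT muleC; congr (_ * _).
      pose h (y : k.-tuple mR) := f (rowt (trow (T x) + trow y)%R).
      have mh : measurable_fun setT h.
        apply: (measurableT_comp mf); apply: measurable_rowt => i.
        under eq_fun do rewrite mxE.
        by apply: measurable_funD => //; exact: measurable_trow.
      have h0 y : 0 <= h y by exact: f0.
      rewrite -(ge0_integral_tuple_shift (trow (T x)) mf f0).
      transitivity (\int[L k]_y h y); last first.
        by apply: eq_integral => y _; rewrite /h addrC.
      rewrite -(ge0_integral_tupleN mh h0).
      by apply: eq_integral => y _; rewrite /h rowtK.
    - apply: (measurableT_comp mf); apply: measurable_rowt => i.
      under eq_fun do rewrite mxE.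
      apply: measurable_funD => //; under eq_fun do rewrite mxE.
      by apply: measurable_funN; exact: measurable_trow.
  by rewrite ge0_integralZr// integral_ge0.
move: E; rewrite Ig.
(* The volume of the ball can be cancelled because it is finite and positive. *)
have Bfin : L k (eball_tuple 1) \is a fin_num.
  by rewrite ge0_fin_numE// lebesgue_eball_tuple_lty.
have B0 : (fine (L k (eball_tuple 1)) != 0)%R.
  by rewrite fine_eq0// gt_eqF// lebesgue_eball_tuple_gt0.
rewrite -(fineK Bfin) => /(congr1 (fun z => ((fine (L k (eball_tuple 1)))^-1)%:E * z)).
by rewrite !muleA -EFinM mulVf// !mul1e.
Qed.

End Orthogonal.

(** * Volumes of slabs *)

Section Householder.
Context {R : realType}.

(** The reflection in the hyperplane orthogonal to [v = e - e0] exchanges [e] and the first basis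
    vector [e0]; the identity behind it is [|v|^2 = - 2 v_0]. *)
Lemma householder k (e : 'rV[R]_k.+1) : dot e e = 1 ->
  exists2 A : 'M[R]_k.+1, A *m A^T = 1%:M & row 0 A = e.
Proof.
move=> e1; pose e0 : 'rV[R]_k.+1 := delta_mx 0 0.
have [->|ee0] := eqVneq e e0.
  by exists 1%:M; [rewrite trmx1 mulmx1|rewrite rowE mulmx1].
pose v := e - e0.
have vE i : v 0 i = e 0 i - e0 0 i by rewrite /v mxE [(- e0) _ _]mxE.
have v00 : v 0 0 = e 0 0 - 1 by rewrite !mxE !eqxx.
have qE : dot v v = - (2 * v 0 0).
  have -> : dot v v = dot e e - 2 * e 0 0 + 1.
    rewrite /dot.
    have E1 : \sum_(i < k.+1) e 0 i * e0 0 i = e 0 0.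
      rewrite (bigD1 0)//= big1 ?addr0 ?mxE ?eqxx ?mulr1// => i i0.
      by rewrite mxE eqxx (negbTE i0) mulr0.
    have E2 : \sum_(i < k.+1) e0 0 i * e0 0 i = 1.
      rewrite (bigD1 0)//= big1 ?addr0 ?mxE ?eqxx ?mulr1// => i i0.
      by rewrite mxE eqxx (negbTE i0) mulr0.
    transitivity (\sum_(i < k.+1) (e 0 i * e 0 i - 2 * (e 0 i * e0 0 i) + e0 0 i * e0 0 i)).
      by apply: eq_bigr => i _; rewrite vE; ring.
    by rewrite big_split /= sumrB -mulr_sumr E1 E2.
  by rewrite e1 v00; ring.
have q0 : dot v v != 0.
  apply: contra_neq ee0 => /eqP; rewrite psumr_eq0 => [/allP h|i _]; last first.
    by rewrite -expr2 sqr_ge0.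
  apply/eqP; rewrite -subr_eq0; apply/eqP/rowP => i.
  have := h i (mem_index_enum _); rewrite mulf_eq0 orbb => /eqP.
  by rewrite -/v => ->; rewrite mxE.
have ev : e = v + e0 by rewrite subrK.
clearbody v.
pose A := 1%:M - (2 / dot v v) *: (v^T *m v).
have At : A^T = A by rewrite /A linearB linearZ /= trmx1 trmx_mul trmxK.
have vv : v *m v^T = (dot v v)%:M by rewrite [LHS]mx11_scalar -dotE.
exists A.
  have PP : v^T *m v *m (v^T *m v) = dot v v *: (v^T *m v).
    by rewrite -mulmxA (mulmxA v) vv mul_scalar_mx -scalemxAr.
  rewrite At /A mulmxBl mul1mx mulmxBr mulmx1 -scalemxAl -scalemxAr PP !scalerA.
  have -> : 2 / dot v v * (2 / dot v v) * dot v v = 2 / dot v v + 2 / dot v v by field.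
  by rewrite scalerDl opprB addrK subrK.
rewrite rowE /A mulmxBr mulmx1 -scalemxAr mulmxA.
have -> : delta_mx 0 0 *m v^T = (v 0 0)%:M.
  by rewrite [LHS]mx11_scalar -rowE !mxE.
rewrite mul_scalar_mx scalerA.
have -> : 2 / dot v v * v 0 0 = -1.
  by apply: (mulIf q0); rewrite mulrAC divfK// mulN1r qE opprK.
by rewrite scaleN1r opprK ev addrC.
Qed.

(** The zero vector has to be included: [b] will be the ball part of a normal vector, and it
    vanishes for the extremal one. *)
Lemma rotate_to_axis k (b : 'rV[R]_k.+1) :
  exists2 A : 'M[R]_k.+1, A *m A^T = 1%:M & b *m A^T = enorm b *: delta_mx 0 0.
Proof.
have [b0|b0] := eqVneq (dot b b) 0.
  exists 1%:M; first by rewrite trmx1 mulmx1.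
  rewrite /enorm b0 sqrtr0 scale0r trmx1 mulmx1; apply/rowP => i.
  move/eqP: b0; rewrite psumr_eq0 => [/allP h|j _]; last by rewrite -expr2 sqr_ge0.
  by have := h i (mem_index_enum _); rewrite mulf_eq0 orbb mxE => /eqP.
have bpos : 0 < enorm b by rewrite sqrtr_gt0 lt_neqAle eq_sym b0 dot_ge0.
have bn0 : enorm b != 0 by rewrite gt_eqF.
pose e := (enorm b)^-1 *: b.
have e1 : dot e e = 1.
  rewrite dotE /e linearZ /= -scalemxAl -scalemxAr scalerA mxE -dotE.
  rewrite -[dot b b](@sqr_sqrtr R) ?dot_ge0// -/(enorm b).
  by field.
have [A AA Ae] := householder e1; exists A => //.
have -> : b = enorm b *: e by rewrite /e scalerA mulfV// scale1r.
have -> : enorm (enorm b *: e) = enorm b.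
  by rewrite /e scalerA mulfV// scale1r.
rewrite -scalemxAl -{1}Ae -row_mul AA; congr (_ *: _).
by rewrite rowE mulmx1.
Qed.

End Householder.

(** * Slab volumes as iterated averages *)

Section Strip.
Context {R : realType}.
Local Notation mR := (measurableTypeR R).
Local Notation L k := (@lebesgue_tuple R k).
Local Notation I := (`[(- (1 / 2))%R, (1 / 2)%R]%classic : set R).
Local Open Scope ereal_scope.

(** Peels off the cube coordinates one by one while [x] accumulates the scalar product, mirroring
    the recursion of [foldr unif_avg]. The value 0 for a list [s] that runs out is a default,
    excluded by [size a <= size s]. *)
Fixpoint strip (g : R -> seq R -> \bar R) (a : seq R) (x : R) (s : seq R) : \bar R :=
  if a isn't a0 :: a' then g x s else
  if s isn't u :: s' then 0 else
  (\1_I u)%:E * strip g a' (x + a0 * u)%R s'.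

Lemma strip_ge0 g a x s : (forall x s, 0 <= g x s) -> 0 <= strip g a x s.
Proof.
move=> g0; elim: a x s => [|a0 a IH] x [|u s] //=; rewrite mule_ge0 ?lee_fin//.
Qed.

Lemma measurable_strip m (g : R -> seq R -> \bar R) (a : seq R) :
  measurable_fun setT (fun p : mR * m.-tuple mR => g p.1 p.2) ->
  measurable_fun setT (fun p : mR * (size a + m).-tuple mR => strip g a p.1 p.2).
Proof.
move=> mg; elim: a => [//|a0 a IH].
pose th (p : mR * (size a + m).+1.-tuple mR) : R := thead p.2.
have mth : measurable_fun setT th.
  exact: (measurableT_comp (measurable_tnth ord0) measurable_snd).
rewrite (_ : (fun p => _) = (fun p : mR * (size a + m).+1.-tuple mR =>
  (\1_I (th p))%:E * strip g a (p.1 + a0 * th p)%R [tuple of behead p.2])).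
  apply: emeasurable_funM.
    apply/measurable_EFinP; apply: (measurable_fun_comp_real (g := \1_I)) => //.
  apply: (measurableT_comp IH (g := fun p : mR * (size a + m).+1.-tuple mR =>
    ((p.1 + a0 * th p)%R, [tuple of behead p.2]))).
  apply: measurable_fun_pair.
    by apply: measurable_funD => //; exact: measurable_funM.
  apply: (@measurableT_comp _ _ _ _ _ _
    (fun x : (size a + m).+1.-tuple mR => [tuple of behead x]) setT snd) => //.
  exact: measurable_behead.
by apply/funext => -[x t]; rewrite /th [in LHS](tuple_eta t).
Qed.

Lemma integral_strip m (g : R -> seq R -> \bar R) (a : seq R) (x : R) :
  measurable_fun setT (fun p : mR * m.-tuple mR => g p.1 p.2) ->
  (forall x s, 0 <= g x s) ->
  \int[L (size a + m)]_t strip g a x t =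
  foldr unif_avg (fun x => \int[L m]_t g x t) a x.
Proof.
move=> mg g0; elim: a x => [//|a0 a IH] x.
have mS : measurable_fun setT (fun t : (size a + m).+1.-tuple mR => strip g (a0 :: a) x t).
  exact: (measurable_fun_pair2 x (@measurable_strip m g (a0 :: a) mg)).
rewrite [LHS](ge0_integral_tupleS mS)//; last first.
  by move=> t; exact: strip_ge0.
rewrite [RHS]/= /unif_avg [RHS]integral_mkcond; apply: eq_integral => u _.
rewrite patchE -/unif_avg /=.
rewrite ge0_integralZl ?lee_fin//.
- rewrite indicE; case: ifPn => uI /=; last by rewrite mul0e.
  by rewrite mul1e IH.
- exact: (measurable_fun_pair2 _ (@measurable_strip m g a mg)).
- by move=> t _; exact: strip_ge0.
Qed.

Lemma stripE g (a : seq R) (x : R) (s : seq R) : (size a <= size s)%N ->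
  strip g a x s = ((all (fun u => u \in `[(- (1 / 2))%R, (1 / 2)%R]) (take (size a) s))%:R)%:E *
    g (x + \sum_(i < size a) a`_i * s`_i)%R (drop (size a) s).
Proof.
elim: a x s => [|a0 a IH] x s; first by rewrite big_ord0 addr0 take0 drop0 mul1e.
case: s => [//|u s] /= sas; rewrite IH// big_ord_recl /= addrA muleA -EFinM.
congr (_%:E * _); rewrite indicE mem_setE -natrM mulnb//.
Qed.

End Strip.

Section SlabVolume.
Context {R : realType}.
Local Notation mR := (measurableTypeR R).
Local Notation lam := (@lebesgue_measure R).
Local Notation L k := (@lebesgue_tuple R k).

Lemma trow_cons0 k x (t : k.-tuple mR) : trow [tuple of x :: t] 0 0 = x.
Proof. by rewrite mxE (tnth_nth 0). Qed.

Lemma dot_trow_cons k x (t : k.-tuple mR) :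
  dot (trow [tuple of x :: t]) (trow [tuple of x :: t]) = x ^+ 2 + dot (trow t) (trow t).
Proof.
rewrite /dot big_ord_recl trow_cons0 expr2; congr (_ + _).
by apply: eq_bigr => i _; rewrite !mxE tnthS.
Qed.

(** The ball coordinates come as a list, since that is what [strip] hands over; [slab_fun] is the
    same indicator on row vectors, where rotations can act. *)
Definition slab_kernel m (b : 'rV[R]_m) (r eps x : R) (s : seq R) : \bar R :=
  (((`|x + \sum_(j < m) b 0 j * s`_j| <= eps)%R &&
    (\sum_(j < m) s`_j ^+ 2 <= r ^+ 2)%R)%:R)%:E.

Definition slab_fun m (b : 'rV[R]_m) (r eps x : R) (y : 'rV[R]_m) : \bar R :=
  (((`|x + dot b y| <= eps)%R && (dot y y <= r ^+ 2)%R)%:R)%:E.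

Lemma slab_kernelE m (b : 'rV[R]_m) r eps x (t : m.-tuple mR) :
  slab_kernel b r eps x t = slab_fun b r eps x (trow t).
Proof.
rewrite /slab_kernel /slab_fun /dot; congr (_%:R%:E); congr (_ && _).
  congr (`|_ + _| <= _)%R; apply: eq_bigr => j _.
  by rewrite mxE (tnth_nth 0).
by congr (_ <= _)%R; apply: eq_bigr => j _; rewrite mxE (tnth_nth 0) expr2.
Qed.

Lemma slab_fun_ge0 m (b : 'rV[R]_m) r eps x y : (0 <= slab_fun b r eps x y)%E.
Proof. by rewrite lee_fin. Qed.

Lemma measurable_slab_fun d (T : measurableType d) m (b : 'rV[R]_m) r eps
    (f : T -> R) (g : T -> 'rV[R]_m) :
  measurable_fun setT f -> (forall i, measurable_fun setT (fun z => g z 0 i)) ->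
  measurable_fun setT (fun z => slab_fun b r eps (f z) (g z)).
Proof.
move=> mf mg; apply/measurable_EFinP.
rewrite (_ : (fun z => _) = fun z =>
    if (`|f z + dot b (g z)| <= eps) && (dot (g z) (g z) <= r ^+ 2) then 1 else 0).
  apply: measurable_fun_ifT => //; apply: measurable_and.
    apply: measurable_fun_ler => //; apply: measurableT_comp => //.
    by apply: measurable_funD => //; apply: measurable_dot.
  by apply: measurable_fun_ler => //; exact: measurable_dot.
by apply/funext => z; case: (_ && _).
Qed.

(** The weight [kappa] of the overview: the section at height [s] of the ball of radius [r] in
    dimension [k + 1]. For [|s| > r] the section is empty. *)
Definition section_vol k (r s : R) : \bar R :=
  L k [set t | s ^+ 2 + dot (trow t) (trow t) <= r ^+ 2].

Lemma section_volE k r s :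
  section_vol k r s =
  (\int[L k]_t (((s ^+ 2 + dot (trow t) (trow t) <= r ^+ 2)%R%:R : R))%:E)%E.
Proof.
pose S : set (k.-tuple mR) := [set t | s ^+ 2 + dot (trow t) (trow t) <= r ^+ 2].
have mS : measurable S.
  have m : measurable_fun setT (fun t : k.-tuple mR => dot (trow t) (trow t)).
    by apply: measurable_dot => i; exact: measurable_trow.
  have -> : S = setT `&` (fun t : k.-tuple mR => dot (trow t) (trow t)) @^-1`
      `]-oo, r ^+ 2 - s ^+ 2]%classic.
    by apply/seteqP; split => t /=; rewrite /S/= in_itv/= lerBrDl => // -[].
  by apply: m => //; exact: measurable_itv.
have -> : section_vol k r s = (\int[L k]_t (\1_S t)%:E)%E.
  by rewrite integral_indic// setIT.
apply: eq_integral => t _; rewrite indicE; congr ((nat_of_bool _)%:R%:E).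
by apply/idP/idP; rewrite inE.
Qed.

Local Open Scope ereal_scope.

(** The ball is invariant under the rotation taking [b] to the first axis; after it the slab
    condition involves the first coordinate only. *)
Lemma integral_slab_kernel k (b : 'rV[R]_k.+1) (r eps x : R) :
  \int[L k.+1]_t slab_kernel b r eps x t =
  \int[lam]_s (section_vol k r s * ball_indic eps (x + enorm b * s)%R).
Proof.
under eq_integral do rewrite slab_kernelE.
have [A AA bA] := rotate_to_axis b.
pose f (t : k.+1.-tuple mR) := slab_fun b r eps x (trow t).
have mf : measurable_fun setT f.
  by apply: measurable_slab_fun => // i; exact: measurable_trow.
rewrite -[LHS](ge0_integral_tuple_orthogonal AA mf)//; last first.
  by move=> t; exact: slab_fun_ge0.
pose h (t : k.+1.-tuple mR) : \bar R := (((`|x + enorm b * trow t ord0 ord0| <= eps)%R &&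
  (dot (trow t) (trow t) <= r ^+ 2)%R)%:R)%:E.
have fh t : f (rowt (trow t *m A)) = h t.
  rewrite /f /h rowtK /slab_fun dot_orthogonal//.
  have -> : dot b (trow t *m A) = (enorm b * trow t ord0 ord0)%R => [|//].
  rewrite dotE trmx_mul mulmxA bA -scalemxAl mxE; congr (_ * _)%R.
  by rewrite -rowE !mxE.
have mh : measurable_fun setT h.
  rewrite (_ : h = f \o (fun t => rowt (trow t *m A))).
    apply: (measurableT_comp mf); apply: measurable_rowt => i.
    by apply: measurable_mulmxr => j; exact: measurable_trow.
  by apply/funext => t /=; rewrite fh.
under eq_integral do rewrite fh.
rewrite ge0_integral_tupleS//; last by move=> t; rewrite lee_fin.
apply: eq_integral => s _.
rewrite section_volE muleC /ball_indic.
rewrite -ge0_integralZl//; last first.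
- apply/measurable_EFinP.
  rewrite (_ : (fun t => _) = fun t : k.-tuple mR =>
    if (s ^+ 2 + dot (trow t) (trow t) <= r ^+ 2)%R then 1%R else 0%R); last first.
    by apply/funext => t; case: (_ <= _)%R.
  apply: measurable_fun_ifT => //; apply: measurable_fun_ler => //.
  by apply: measurable_funD => //; apply: measurable_dot => i; exact: measurable_trow.
- apply: eq_integral => t _; rewrite /h trow_cons0 dot_trow_cons.
  by rewrite -EFinM -natrM mulnb.
Qed.

Lemma integral_strip_size m (g : R -> seq R -> \bar R) n (a : seq R) (x : R) :
  size a = n ->
  measurable_fun setT (fun p : mR * m.-tuple mR => g p.1 p.2) ->
  (forall x s, 0 <= g x s) ->
  \int[L (n + m)]_t strip g a x t =
  foldr unif_avg (fun x => \int[L m]_t g x t) a x.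
Proof. by move=> <-; exact: integral_strip. Qed.

Lemma measurable_strip_size m (g : R -> seq R -> \bar R) n (a : seq R) (x : mR) :
  size a = n ->
  measurable_fun setT (fun p : mR * m.-tuple mR => g p.1 p.2) ->
  measurable_fun setT (fun t : (n + m).-tuple mR => strip g a x t).
Proof.
by move=> <- mg; exact: (measurable_fun_pair2 x (@measurable_strip R m g a mg)).
Qed.

Lemma enorm_le k (x : 'rV[R]_k) (r : R) : (0 <= r)%R ->
  (enorm x <= r)%R = (dot x x <= r ^+ 2)%R.
Proof.
move=> r0; rewrite -(@ler_pXn2r _ 2) ?nnegrE ?sqrtr_ge0//.
by rewrite sqr_sqrtr ?dot_ge0.
Qed.

Definition slab n m (c : 'rV[R]_(n + m)) (r eps : R) : set ((n + m).-tuple mR) :=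
  [set t | cylinder r (trow t) /\ (`|dot c (trow t)| <= eps)%R].

Definition cube_coefs n m (c : 'rV[R]_(n + m)) : seq R :=
  [seq c ord0 (lshift m i) | i <- enum 'I_n].

Lemma size_cube_coefs n m (c : 'rV[R]_(n + m)) : size (cube_coefs c) = n.
Proof. by rewrite size_map size_enum_ord. Qed.

Lemma slab_indicE n k (c : 'rV[R]_(n + k.+1)) (r eps : R) t : (0 < r)%R ->
  (\1_(slab c r eps) t)%:E =
  strip (slab_kernel (rsubmx c) r eps) (cube_coefs c) 0%R t.
Proof.
move=> r0; have sa := size_cube_coefs c; set a := cube_coefs c in sa *.
rewrite stripE sa ?size_tuple ?leq_addr// /slab_kernel -EFinM -natrM mulnb.
rewrite indicE; congr ((nat_of_bool _)%:R%:E).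
have tl (i : 'I_n) : trow t ord0 (lshift k.+1 i) = t`_i.
  by rewrite mxE (tnth_nth 0%R).
have tr (j : 'I_k.+1) : trow t ord0 (rshift n j) = (drop n t)`_j.
  by rewrite mxE (tnth_nth 0%R) nth_drop.
have dotE1 : dot c (trow t) = (0 + \sum_(i < n) a`_i * t`_i +
    \sum_(j < k.+1) rsubmx c ord0 j * (drop n t)`_j)%R.
  rewrite add0r /dot big_split_ord/=; congr (_ + _)%R.
    apply: eq_bigr => i _; rewrite tl; congr (_ * _)%R.
    by rewrite (nth_map i) ?size_enum_ord// nth_ord_enum.
  by apply: eq_bigr => j _; rewrite tr mxE.
have dotE2 : dot (rsubmx (trow t)) (rsubmx (trow t)) =
    (\sum_(j < k.+1) (drop n t)`_j ^+ 2)%R.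
  by apply: eq_bigr => j _; rewrite mxE tr expr2.
apply/idP/idP; rewrite inE /slab/= dotE1.
  move=> [[tcube tball] teps]; rewrite teps /=; apply/andP; split.
    apply/(all_nthP 0%R) => i; rewrite size_take size_tuple.
    have -> : (if (n < n + k.+1)%N then n else (n + k.+1)%N) = n.
      by rewrite -{1}(addn0 n) ltn_add2l.
    move=> ni; rewrite nth_take//.
    by have := tcube (Ordinal ni); rewrite mxE tl.
  by rewrite -dotE2 -enorm_le// ltW.
move=> /andP[/(all_nthP 0%R) tcube /andP[teps tball]]; split => //; split.
  move=> i; rewrite mxE tl; have := tcube i; rewrite nth_take//; apply.
  rewrite size_take size_tuple; case: ifP => // _.
  by rewrite (leq_trans (ltn_ord i))// leq_addr.
by rewrite /eball/= enorm_le ?(ltW r0)// dotE2.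
Qed.

Lemma measurable_slab_kernel m (b : 'rV[R]_m) (r eps : R) :
  measurable_fun setT (fun p : mR * m.-tuple mR => slab_kernel b r eps p.1 p.2).
Proof.
under eq_fun do rewrite slab_kernelE.
apply: measurable_slab_fun => // i.
exact: (measurableT_comp (measurable_trow i) measurable_snd).
Qed.

Lemma measurable_slab n k (c : 'rV[R]_(n + k.+1)) (r eps : R) : (0 < r)%R ->
  measurable (slab c r eps).
Proof.
move=> r0.
have := measurable_strip_size 0%R (size_cube_coefs c)
  (measurable_slab_kernel (rsubmx c) r eps).
rewrite (_ : (fun _ => _) = fun t => (\1_(slab c r eps) t)%:E); last first.
  by apply/funext => t; rewrite slab_indicE.
by move/measurable_EFinP/measurable_indicP.
Qed.

Lemma slab_volume n k (c : 'rV[R]_(n + k.+1)) (r eps : R) : (0 < r)%R ->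
  L (n + k.+1) (slab c r eps) =
  foldr unif_avg (fun x => \int[lam]_s (section_vol k r s *
      ball_indic eps (x + enorm (rsubmx c) * s)%R)) (cube_coefs c) 0%R.
Proof.
move=> r0.
have -> : L (n + k.+1) (slab c r eps) = \int[L (n + k.+1)]_t (\1_(slab c r eps) t)%:E.
  by rewrite integral_indic ?setIT//; exact: measurable_slab.
under eq_integral do rewrite slab_indicE//.
rewrite (integral_strip_size _ (size_cube_coefs c) (measurable_slab_kernel _ _ _)); last first.
  by move=> x s; rewrite lee_fin.
congr (foldr _ _ _ _); apply/funext => x; exact: integral_slab_kernel.
Qed.

End SlabVolume.

(** * Unimodality and the bathtub principle *)

Section Unimodal.
Context {R : realType}.
Local Notation lam := (@lebesgue_measure R).
Local Notation I := (`[(- (1 / 2))%R, (1 / 2)%R]%classic : set R).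
Local Open Scope ereal_scope.

(** Moves the averages onto [g], so that [kap] is integrated against one unimodal function, as the
    bathtub principle requires. *)
Lemma foldr_unif_avg_mixture (kap g : R -> \bar R) (b : R) (s : seq R) (x : R) :
  measurable_fun [set: R] kap -> (forall y, 0 <= kap y) ->
  measurable_fun [set: R] g -> (forall y, 0 <= g y) ->
  foldr unif_avg (fun x => \int[lam]_y (kap y * g (x + b * y)%R)) s x =
  \int[lam]_y (kap y * foldr unif_avg g s (x + b * y)%R).
Proof.
move=> mk k0 mg g0; elim: s x => [//|a s IH] x.
have mG := measurable_foldr_unif_avg s mg g0.
have G0 y := foldr_unif_avg_ge0 s y g0.
rewrite [LHS]/= /unif_avg -/unif_avg.
under eq_integral do rewrite IH.
have mI : measurable I by [].
have mf : measurable_fun [set: R * R] (fun z : R * R =>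
    kap z.2 * foldr unif_avg g s (x + a * z.1 + b * z.2)%R).
  apply: emeasurable_funM; first exact: measurableT_comp.
  apply: (measurableT_comp mG); apply: measurable_funD; last exact: measurable_funM.
  by apply: measurable_funD => //; exact: measurable_funM.
have /= -> := restricted_tonelli lam lam mI measurableT mf
  (fun u y _ _ => mule_ge0 (k0 y) (G0 (x + a * u + b * y)%R)).
apply: eq_integral => y _; rewrite /unif_avg -/unif_avg ge0_integralZl//.
- by congr (_ * _); apply: eq_integral => u _; rewrite addrAC.
- apply: measurable_funTS; apply: (measurableT_comp mG).
  by apply: measurable_funD => //; apply: measurable_funD => //; exact: measurable_funM.
Qed.

(** Comparing absolute values encodes both evenness and monotonicity on the half-line. *)
Definition unimodal (g : R -> \bar R) :=
  forall x y : R, (`|x| <= `|y|)%R -> g y <= g x.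

Lemma unimodal_ball_indic (e : R) : unimodal (ball_indic e).
Proof.
move=> x y xy; rewrite lee_fin ler_nat; have [ye|//] := leP `|y|%R e.
by rewrite (le_trans xy ye).
Qed.

Lemma unimodal_norm (g : R -> \bar R) (x : R) : unimodal g -> g `|x|%R = g x.
Proof. by move=> ug; apply/eqP; rewrite eq_le !ug// normr_id. Qed.

Lemma ge0_integral_itv_shift (c p q : R) (h : R -> \bar R) :
  measurable_fun [set: R] h -> (forall x, 0 <= h x) ->
  \int[lam]_(u in `]p, q]) h (u + c)%R = \int[lam]_(u in `](p + c)%R, (q + c)%R]) h u.
Proof.
move=> mh h0; rewrite integral_mkcond [RHS]integral_mkcond.
rewrite -[RHS](ge0_integral_shift c).
- apply: eq_integral => u _; rewrite !patchE !mem_setE !in_itv/=.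
  by rewrite ltrD2r lerD2r.
- by apply/(measurable_restrictT _ _).1 => //; exact: measurable_funTS.
- by move=> u; rewrite patchE; case: ifPn.
Qed.

(** In units of [a] the two windows of length 1 differ by the shift [d]. If [d >= 1], the values are
    compared pointwise. Otherwise the overlap cancels, and the two remaining pieces of length [d]
    are compared by a translation by 1. *)
Lemma unif_avg_anti (a : R) (g : R -> \bar R) (x y : R) : (0 < a)%R ->
  measurable_fun [set: R] g -> (forall y, 0 <= g y) -> unimodal g ->
  (0 <= x <= y)%R -> unif_avg a g y <= unif_avg a g x.
Proof.
move=> a0 mg g0 ug /andP[x0 xy].
pose d := ((y - x) / a)%R.
have d0 : (0 <= d)%R by rewrite divr_ge0 ?subr_ge0// ltW.
have yE : y = (x + a * d)%R by rewrite /d mulrCA mulfV ?gt_eqF// mulr1 addrC subrK.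
have [d1|d1] := leP 1%R d.
  apply: ge0_le_integral => //.
  - by apply: measurable_funTS; exact: measurable_shift.
  - by apply: measurable_funTS; exact: measurable_shift.
  - move=> u /=; rewrite in_itv/= => /andP[u1 u2]; apply: ug.
    have ad : (a <= a * d)%R by rewrite ler_peMr// ltW.
    have au1 : (a * - (1 / 2) <= a * u)%R by rewrite ler_wpM2l// ltW.
    rewrite [leRHS]ger0_norm; last by rewrite yE; lra.
    by rewrite ler_norml yE; apply/andP; split; lra.
pose h (u : R) := g (x + a * u)%R.
have mh : measurable_fun [set: R] h by exact: measurable_shift.
have h0 u : 0 <= h u by exact: g0.
have split_oc (p q r : R) : (p <= q)%R -> (q <= r)%R ->
    \int[lam]_(u in `]p, r]) h u = \int[lam]_(u in `]p, q]) h u + \int[lam]_(u in `]q, r]) h u.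
  move=> pq qr.
  have E : (`]p, q] `|` `]q, r] = `]p, r])%classic.
    by rewrite -itv_bndbnd_setU ?bnd_simp.
  rewrite -E ge0_integral_setU//.
  - by rewrite E; exact: measurable_funTS.
  - apply/disj_setPS => z [] /=; rewrite !in_itv/= => /andP[_ zq] /andP[qz _].
    by move: qz; rewrite ltNge zq.
have avgE z : unif_avg a g z = \int[lam]_(u in `](- (1 / 2))%R, (1 / 2)%R]) g (z + a * u)%R.
  rewrite /unif_avg integral_itv_obnd_cbnd//.
  by apply: measurable_funTS; exact: measurable_shift.
rewrite !avgE.
have -> : \int[lam]_(u in `](- (1 / 2))%R, (1 / 2)%R]) g (y + a * u)%R =
    \int[lam]_(u in `](- (1 / 2) + d)%R, (1 / 2 + d)%R]) h u.
  rewrite -ge0_integral_itv_shift//; apply: eq_integral => u _.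
  by rewrite /h yE; congr g; ring.
rewrite (@split_oc _ (1 / 2)%R); [|lra|lra].
rewrite -[leRHS]/(\int[lam]_(u in `](- (1 / 2))%R, (1 / 2)%R]) h u).
rewrite (@split_oc (- (1 / 2))%R (- (1 / 2) + d)%R); [|lra|lra].
rewrite addeC leeD2r//.
have E1 : (1 / 2 = - (1 / 2) + 1 :> R)%R by field.
have E2 : (1 / 2 + d = - (1 / 2) + d + 1 :> R)%R by field.
rewrite [in leLHS]E2 {1}E1.
rewrite -ge0_integral_itv_shift//.
apply: ge0_le_integral => //.
- apply: measurable_funTS; apply: (measurableT_comp mh).
  exact: measurable_funD.
- exact: measurable_funTS.
- move=> u /=; rewrite in_itv/= => /andP[u1 u2]; apply: ug.
  have au1 : (a * - (1 / 2) <= a * u)%R by rewrite ler_wpM2l// ltW.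
  rewrite [leRHS]ger0_norm; last by lra.
  by rewrite ler_norml; apply/andP; split; lra.
Qed.

Lemma unimodal_unif_avg (a : R) (g : R -> \bar R) :
  measurable_fun [set: R] g -> (forall y, 0 <= g y) -> unimodal g ->
  unimodal (unif_avg a g).
Proof.
move=> mg g0 ug.
have even z : unif_avg a g `|z|%R = unif_avg a g z.
  have [z0|z0] := leP 0%R z; first by rewrite ger0_norm.
  rewrite ltr0_norm// -[RHS]unif_avgN//; apply: eq_integral => u _.
  rewrite -[LHS]unimodal_norm// -[RHS]unimodal_norm//.
  by rewrite -[in LHS]normrN; congr g; congr (Num.norm _); ring.
move=> x y xy; rewrite -even -[leRHS]even -unif_avg_norm// -[leRHS]unif_avg_norm//.
have [a0|a0] := eqVneq a 0%R; last first.
  by apply: unif_avg_anti => //; rewrite ?normr_gt0// normr_ge0.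
rewrite a0 normr0; apply: ge0_le_integral => //.
- by apply: measurable_funTS; exact: measurable_shift.
- by apply: measurable_funTS; exact: measurable_shift.
- by move=> u _; rewrite mul0r !addr0; apply: ug; rewrite !normr_id.
Qed.

Lemma unimodal_foldr_unif_avg (s : seq R) (g : R -> \bar R) :
  measurable_fun [set: R] g -> (forall y, 0 <= g y) -> unimodal g ->
  unimodal (foldr unif_avg g s).
Proof.
move=> mg g0 ug; elim: s => //= a s IH; apply: unimodal_unif_avg => //.
- exact: measurable_foldr_unif_avg.
- by move=> y; exact: foldr_unif_avg_ge0.
Qed.

(* Bathtub principle: pointwise,
   [(kap - M 1_[-l, l]) (w - w l) <= 0], as both factors change sign at [l]. *)
Lemma bathtub (kap w : R -> R) (M Q l : R) : (0 < l)%R -> (2 * l * M = Q)%R ->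
  measurable_fun [set: R] kap -> (forall x, (0 <= kap x <= M)%R) ->
  \int[lam]_x (kap x)%:E = Q%:E ->
  measurable_fun [set: R] w -> (forall x, (0 <= w x)%R) ->
  (forall x y, (`|x| <= `|y|)%R -> (w y <= w x)%R) ->
  \int[lam]_x (kap x * w x)%:E <= M%:E * \int[lam]_(x in `[(- l)%R, l]) (w x)%:E.
Proof.
move=> l0 lMQ mk kM kQ mw w0 uw.
have k0 x : (0 <= kap x)%R by case/andP: (kM x).
have M0 : (0 <= M)%R by case/andP: (kM 0%R) => /le_trans; apply.
pose J := `[(- l)%R, l]%classic : set R.
have mJ : measurable J by exact: measurable_itv.
have mJi : measurable_fun [set: R] (\1_J : R -> R).
  by apply: measurable_indic; exact: mJ.
have EJ (f : R -> R) : measurable_fun [set: R] f -> (forall x, (0 <= f x)%R) ->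
    M%:E * \int[lam]_(x in J) (f x)%:E = \int[lam]_x (M * \1_J x * f x)%:E.
  move=> mf f0; rewrite -ge0_integralZl_EFin//; last 2 first.
  - by move=> x _; rewrite lee_fin.
  - by apply/measurable_EFinP; exact: measurable_funTS.
  rewrite integral_mkcond; apply: eq_integral => x _.
  rewrite patchE indicE; case: ifPn => _ /=; first by rewrite mulr1 EFinM.
  by rewrite mulr0 mul0r.
have E2 : \int[lam]_x (M * \1_J x * w l)%:E = (Q * w l)%:E.
  have lJ : lam J = (2 * l)%:E.
    rewrite /J lebesgue_measure_itv/= lte_fin ifT; last lra.
    by rewrite -EFinD; congr EFin; ring.
  rewrite -(EJ (fun=> w l))// (integral_cst lam mJ (w l)%:E).
  transitivity (M%:E * ((w l)%:E * (2 * l)%:E)); first by congr (_ * (_ * _)).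
  by rewrite -!EFinM -lMQ; congr EFin; ring.
have E3 : \int[lam]_x (kap x * w l)%:E = (Q * w l)%:E.
  under eq_integral do rewrite EFinM.
  rewrite ge0_integralZr//; first by rewrite kQ.
  - exact/measurable_EFinP.
  - by move=> x _; rewrite lee_fin.
  - by rewrite lee_fin.
rewrite -/J EJ//.
(* The two functions of mass [Q] have the same integral against the constant [w l]. Adding it
   crosswise turns the product inequality into one between sums of nonnegative terms. *)
rewrite -(@leeD2rE _ (Q * w l)%:E)// -[X in _ + X <= _]E2 -E3.
have mMJ (f : R -> R) : measurable_fun [set: R] f ->
    measurable_fun [set: R] (fun x => (M * \1_J x * f x)%:E).
  move=> mf; apply/measurable_EFinP; apply: measurable_funM => //.
  exact: measurable_funM.
have mkf (f : R -> R) : measurable_fun [set: R] f ->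
    measurable_fun [set: R] (fun x => (kap x * f x)%:E).
  by move=> mf; apply/measurable_EFinP; exact: measurable_funM.
rewrite -!ge0_integralD//; try by [exact: mMJ | exact: mkf |
  move=> x _; rewrite lee_fin ?mulr_ge0].
apply: ge0_le_integral => //.
- by move=> x _; rewrite -EFinD lee_fin addr_ge0 ?mulr_ge0.
- by apply: emeasurable_funD; [exact: mkf|exact: mMJ].
- by apply: emeasurable_funD; [exact: mMJ|exact: mkf].
- move=> x _; rewrite -!EFinD lee_fin.
  have /andP[kx0 kxM] := kM x.
  rewrite indicE; have [xJ|xJ] := boolP (x \in J).
    have wl : (w l <= w x)%R.
      apply: uw; move: xJ; rewrite inE /J/= in_itv/= -ler_norml.
      by rewrite (ger0_norm (ltW l0)).
    rewrite mulr1 -subr_ge0.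
    have -> : (M * w x + kap x * w l - (kap x * w x + M * w l) =
      (M - kap x) * (w x - w l))%R by ring.
    by rewrite mulr_ge0 ?subr_ge0.
  have wl : (w x <= w l)%R.
    apply: uw; rewrite (ger0_norm (ltW l0)) leNgt; apply: contra xJ => xl.
    by rewrite inE /J/= in_itv/= -ler_norml ltW.
  by rewrite mulr0 !mul0r add0r addr0 ler_wpM2l.
Qed.

End Unimodal.

(** * The upper bound for slab volumes *)

Section SlabBound.
Context {R : realType}.
Local Notation mR := (measurableTypeR R).
Local Notation lam := (@lebesgue_measure R).
Local Notation L k := (@lebesgue_tuple R k).
Local Open Scope ereal_scope.

Lemma lebesgue_eball_tuple_scale k (r : R) : (0 < r)%R ->
  L k (eball_tuple r) = (r ^+ k)%:E * L k (eball_tuple 1).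
Proof.
move=> r0; have mB := @measurable_eball_tuple R k.
have ri : (0 < r^-1)%R by rewrite invr_gt0.
have E s : L k (eball_tuple s) = \int[L k]_t (\1_(eball_tuple s) t)%:E.
  by rewrite integral_indic ?setIT//; exact: mB.
rewrite !E.
have := @ge0_integral_tuple_scale R k r^-1 (fun t => (\1_(eball_tuple 1) t)%:E) ri.
rewrite exprVn invrK => <-.
- apply: eq_integral => t _; rewrite !indicE; congr ((nat_of_bool _)%:R%:E).
  rewrite /eball_tuple.
  have E1 : dot (trow (rowt (r^-1 *: trow t))) (trow (rowt (r^-1 *: trow t))) =
      (r ^- 2 * dot (trow t) (trow t))%R.
    rewrite rowtK !dotE linearZ /= -scalemxAl -scalemxAr scalerA [LHS]mxE.
    by rewrite -invfM -expr2.
  by apply/idP/idP; rewrite !inE/= E1 expr1n mulrC ler_pdivrMr ?exprn_gt0// mul1r.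
- by apply/measurable_EFinP; apply: measurable_indic; exact: mB.
- by move=> t; rewrite lee_fin.
Qed.

Lemma lebesgue_eball_tuple_fin k (r : R) : (0 < r)%R ->
  exists2 Q : R, (0 < Q)%R & L k (eball_tuple r) = Q%:E.
Proof.
move=> r0; rewrite lebesgue_eball_tuple_scale//.
have := @lebesgue_eball_tuple_lty R k; have := @lebesgue_eball_tuple_gt0 R k.
case: (L k (eball_tuple 1)) => [q|//|//]; rewrite lte_fin => q0 _.
by exists (r ^+ k * q)%R; rewrite ?EFinM// mulr_gt0// exprn_gt0.
Qed.

Lemma section_vol_le k (r s : R) : section_vol k r s <= L k (eball_tuple r).
Proof.
apply: le_measure; rewrite ?inE.
- have -> : [set t : k.-tuple mR | (s ^+ 2 + dot (trow t) (trow t) <= r ^+ 2)%R] =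
      setT `&` (fun t : k.-tuple mR => dot (trow t) (trow t)) @^-1`
      `]-oo, (r ^+ 2 - s ^+ 2)%R]%classic.
    by apply/seteqP; split => t /=; rewrite in_itv/= lerBrDl => // -[].
  have m : measurable_fun setT (fun t : k.-tuple mR => dot (trow t) (trow t)).
    by apply: measurable_dot => i; exact: measurable_trow.
  by apply: m => //; exact: measurable_itv.
- exact: measurable_eball_tuple.
- by move=> t /=; apply: le_trans; rewrite lerDr sqr_ge0.
Qed.

Lemma measurable_section_vol k (r : R) : measurable_fun [set: R] (section_vol k r).
Proof.
rewrite (_ : section_vol k r = fun s => \int[L k]_t
  (((s ^+ 2 + dot (trow t) (trow t) <= r ^+ 2)%R%:R : R))%:E); last first.
  by apply/funext => s; exact: section_volE.
apply: (measurable_fun_fubini_tonelli_F (m2 := L k) (fun z : mR * k.-tuple mR =>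
  (((z.1 ^+ 2 + dot (trow z.2) (trow z.2) <= r ^+ 2)%R%:R : R))%:E)).
- apply/measurable_EFinP.
  rewrite (_ : (fun z => _) = fun z : mR * k.-tuple mR =>
    if (z.1 ^+ 2 + dot (trow z.2) (trow z.2) <= r ^+ 2)%R then 1%R else 0%R); last first.
    by apply/funext => z; case: (_ <= _)%R.
  apply: measurable_fun_ifT => //; apply: measurable_fun_ler => //.
  apply: measurable_funD; first exact: measurable_funX.
  apply: measurable_dot => i;
    exact: (measurableT_comp (measurable_trow i) measurable_snd).
- by move=> z; rewrite lee_fin.
Qed.

Lemma integral_section_vol k (r : R) :
  \int[lam]_s section_vol k r s = L k.+1 (eball_tuple r).
Proof.
have mB := @measurable_eball_tuple R k.+1 r.
have -> : L k.+1 (eball_tuple r) = \int[L k.+1]_t (\1_(eball_tuple r) t)%:E.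
  by rewrite integral_indic ?setIT.
rewrite ge0_integral_tupleS//.
- apply: eq_integral => s _; rewrite section_volE; apply: eq_integral => t _.
  rewrite indicE; congr ((nat_of_bool _)%:R%:E).
  by apply/idP/idP; rewrite inE /eball_tuple/= dot_trow_cons.
- by apply/measurable_EFinP; exact: measurable_indic.
Qed.

Lemma sum_cube_coefs n m (c : 'rV[R]_(n + m)) :
  (\sum_(a <- cube_coefs c) a ^+ 2 + enorm (rsubmx c) ^+ 2 = dot c c)%R.
Proof.
rewrite /cube_coefs big_map big_enum/= sqr_sqrtr ?dot_ge0//.
rewrite [RHS]/dot big_split_ord/=; congr (_ + _)%R.
by apply: eq_bigr => j _; rewrite !mxE.
Qed.

Lemma slab_volume_le n k (c : 'rV[R]_(n + k.+1)) (r eps Q B : R) :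
  (0 < r)%R -> (0 < eps)%R -> dot c c = 1%R ->
  L k.+1 (eball_tuple r) = Q%:E -> L k (eball_tuple r) = B%:E ->
  L (n + k.+1) (slab c r eps) <= (2 * eps * (Num.max Q B * Num.sqrt 2))%:E.
Proof.
move=> r0 eps0 c1 LQ LB.
have Q0 : (0 < Q)%R.
  by have [q q0] := lebesgue_eball_tuple_fin k.+1 r0; rewrite LQ => -[->].
have B0 : (0 < B)%R.
  by have [q q0] := lebesgue_eball_tuple_fin k r0; rewrite LB => -[->].
set M := Num.max Q B.
have M0 : (0 < M)%R by rewrite lt_max Q0.
have QM : (Q <= M)%R by rewrite le_max lexx.
have BM : (B <= M)%R by rewrite le_max lexx orbT.
set b := enorm (rsubmx c); set s := cube_coefs c.
have mb := @measurable_ball_indic R eps; have b0 := @ball_indic_ge0 R eps.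
pose W y := foldr unif_avg (ball_indic eps) s y.
have W0 y : 0 <= W y by exact: foldr_unif_avg_ge0.
have W1 y : W y <= 1.
  rewrite -[leRHS](foldr_unif_avg_cst s y ler01); apply: le_foldr_unif_avg => //.
  exact: ball_indic_le1.
have mW : measurable_fun [set: R] W by exact: measurable_foldr_unif_avg.
have Wfin y : W y \is a fin_num by rewrite ge0_fin_numE// (le_lt_trans (W1 y)) ?ltry.
pose w y := fine (W (b * y)%R).
have wE y : (w y)%:E = W (b * y)%R by rewrite /w fineK.
have mkap := measurable_section_vol k r.
have kapfin y : section_vol k r y \is a fin_num.
  rewrite ge0_fin_numE; last exact: measure_ge0.
  by rewrite (le_lt_trans (section_vol_le k r y))// LB ltry.
pose kap y := fine (section_vol k r y).
have kapE y : (kap y)%:E = section_vol k r y by rewrite /kap fineK.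
have kap0 y : (0 <= kap y)%R by rewrite fine_ge0// measure_ge0.
(* Chosen so that [M] times the indicator of [[-l, l]] has the same mass [Q] as [kap]. *)
pose l := (Q / (2 * M))%R.
have l0 : (0 < l)%R by rewrite divr_gt0// mulr_gt0.
have l2 : (2 * l = Q / M)%R by rewrite /l; field; rewrite gt_eqF.
rewrite slab_volume// foldr_unif_avg_mixture//.
rewrite -/b -/s.
have -> : \int[lam]_y (section_vol k r y * foldr unif_avg (ball_indic eps) s (0 + b * y)%R) =
    \int[lam]_y (kap y * w y)%:E.
  by apply: eq_integral => y _; rewrite EFinM kapE wE add0r.
apply: le_trans (@bathtub R kap w M Q l l0 _ _ _ _ _ _ _) _.
- by rewrite l2 mulfVK// gt_eqF.
- apply/measurable_EFinP.
  by rewrite (_ : EFin \o kap = section_vol k r)//; apply/funext => y; exact: kapE.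
- move=> y; rewrite kap0/= (le_trans _ BM)// -lee_fin kapE -LB.
  exact: section_vol_le.
- by under eq_integral do rewrite kapE; rewrite integral_section_vol.
- apply/measurable_EFinP.
  rewrite (_ : EFin \o w = fun y => W (b * y)%R); last by apply/funext => y; exact: wE.
  by apply: (measurableT_comp mW); exact: measurable_funM.
- by move=> y; rewrite fine_ge0.
- move=> x y xy; rewrite -lee_fin !wE.
  have uW : unimodal W.
    by apply: unimodal_foldr_unif_avg => //; exact: unimodal_ball_indic.
  apply: uW.
  by rewrite !normrM ler_wpM2l.
(* Rescaled to unit length, the interval is one more cube coordinate, with coefficient
   [2 l b = (Q / M) b]. *)
have -> : \int[lam]_(x in `[(- l)%R, l]) (w x)%:E =
    (2 * l)%:E * foldr unif_avg (ball_indic eps) ((2 * l * b)%R :: s) 0%R.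
  rewrite [foldr _ _ (_ :: _) _]/= -/(W) /unif_avg -/unif_avg.
  rewrite integral_mkcond [in RHS]integral_mkcond.
  have ll0 : (0 < 2 * l)%R by rewrite mulr_gt0.
  have mh : measurable_fun [set: R] ((fun x => (w x)%:E) \_ `[(- l)%R, l]).
    apply/(measurable_restrictT _ _).1; first exact: measurable_itv.
    apply: measurable_funTS; under eq_fun do rewrite wE.
    by apply: (measurableT_comp mW); exact: measurable_funM.
  have h0 x : 0 <= ((fun x => (w x)%:E) \_ `[(- l)%R, l]) x.
    by rewrite patchE; case: ifPn => // _; rewrite wE.
  have := ge0_integral_affine 0 ll0 mh h0.
  move=> /(congr1 (fun z => (2 * l)%:E * z)).
  rewrite muleA -EFinM mulfV ?mul1e ?gt_eqF// => <-; congr (_ * _).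
  apply: eq_integral => u _; rewrite !patchE !mem_setE !in_itv/= addr0.
  have -> : (- l <= 2 * l * u <= l)%R = (- (1 / 2) <= u <= 1 / 2)%R.
    by apply/idP/idP => /andP[u1 u2]; apply/andP; split; nra.
  case: ifP => // _; rewrite wE add0r; congr (W _); ring.
(* With [q = Q / M <= 1] the sum is [q^2 (1 - T) + T], and [q^2 T <= T]. *)
have S2 : ((Q / M) ^+ 2 <= \sum_(a <- (2 * l * b)%R :: s) a ^+ 2)%R.
  have q1 : ((Q / M) ^+ 2 <= 1)%R.
    by rewrite expr_le1 ?divr_ge0 ?(ltW Q0) ?(ltW M0)// ler_pdivrMr// mul1r.
  rewrite big_cons l2; move: (Q / M)%R q1 => q q1; rewrite exprMn.
  have := sum_cube_coefs c; rewrite c1 -/b -/s => S1.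
  have S0 : (0 <= \sum_(a <- s) a ^+ 2)%R by apply: sumr_ge0 => a _; exact: sqr_ge0.
  set T := (\sum_(a <- s) a ^+ 2)%R in S1 S0 *.
  have qT : (q ^+ 2 * T <= T)%R by rewrite ler_piMl.
  have -> : (b ^+ 2 = 1 - T)%R by rewrite -S1 addrAC subrr add0r.
  by rewrite mulrBr mulr1; lra.
have QM0 : (0 < Q / M)%R by rewrite divr_gt0.
have S0 : (0 < \sum_(a <- (2 * l * b)%R :: s) a ^+ 2)%R.
  by apply: lt_le_trans S2; rewrite exprn_gt0.
have cb := cube_small_ball eps0 S0.
apply: (@le_trans _ _ (M%:E * ((2 * l)%:E * (2 * Num.sqrt 2 * eps / (Q / M))%:E))).
  apply: lee_wpmul2l; first by rewrite lee_fin ltW.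
  apply: lee_wpmul2l; first by rewrite lee_fin l2 ltW.
  apply: le_trans cb _; rewrite lee_fin ler_wpM2l ?mulr_ge0 ?sqrtr_ge0 ?(ltW eps0)//.
  rewrite lef_pV2 ?posrE ?sqrtr_gt0//.
  by rewrite -[leLHS](ger0_norm (ltW QM0)) -sqrtr_sqr ler_sqrt// ltW.
rewrite -!EFinM lee_fin l2 le_eqVlt; apply/orP; left; apply/eqP.
by field; rewrite !gt_eqF.
Qed.

End SlabBound.

(** * The volume of the Euclidean ball *)

Section BallVolume.
Context {R : realType}.
Local Notation mR := (measurableTypeR R).
Local Notation lam := (@lebesgue_measure R).
Local Notation L k := (@lebesgue_tuple R k).
Local Open Scope ereal_scope.

Lemma measurable_dot_trow k :
  measurable_fun setT (fun t : k.-tuple mR => dot (trow t) (trow t)).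
Proof. by apply: measurable_dot => i; exact: measurable_trow. Qed.

Lemma integral_gauss_tuple k :
  \int[L k]_t (expR (- dot (trow t) (trow t)))%:E = ((Num.sqrt pi : R) ^+ k)%:E.
Proof.
have mg j : measurable_fun setT (fun t : j.-tuple mR => (expR (- dot (trow t) (trow t)))%:E).
  apply/measurable_EFinP; apply: measurable_fun_expR; apply: measurable_funN.
  exact: measurable_dot_trow.
elim: k => [|k IH].
  rewrite ge0_integral_tuple0//.
  by rewrite /dot big_ord0 oppr0 expR0 expr0.
rewrite ge0_integral_tupleS//.
have s0 : (0 <= Num.sqrt pi ^+ k :> R)%R by rewrite exprn_ge0// sqrtr_ge0.
transitivity (\int[lam]_x ((gauss_fun x)%:E * ((Num.sqrt pi : R) ^+ k)%:E)).
  apply: eq_integral => x _; rewrite -IH -ge0_integralZl//.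
  - apply: eq_integral => t _; rewrite dot_trow_cons opprD expRD EFinM.
    by rewrite /gauss_fun.
  - exact: mg.
  - by rewrite lee_fin gauss_fun_ge0.
rewrite ge0_integralZr//.
- by rewrite integralT_gauss -EFinM exprS.
- by apply/measurable_EFinP; exact: measurable_gauss_fun.
- by move=> x _; rewrite lee_fin gauss_fun_ge0.
Qed.

Lemma expRN_layer_cake (y : R) : (0 <= y)%R ->
  \int[lam]_(s in `]0%R, +oo[) ((y <= s)%R%:R * expR (- s))%:E = (expR (- y))%:E.
Proof.
move=> y0; rewrite integral_itv_obnd_cbnd; last first.
  apply: measurable_funTS; apply/measurable_EFinP.
  rewrite (_ : (fun s => _) = fun s : R => (if (y <= s)%R then 1%R else 0%R) * expR (- s))%R.
    apply: measurable_funM.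
      by apply: measurable_fun_ifT => //; exact: measurable_fun_ler.
    by apply: measurable_fun_expR; exact: measurable_funN.
  by apply/funext => s; case: (_ <= _)%R.
transitivity (\int[lam]_(s in `[y, +oo[) (expR (- s))%:E).
  rewrite integral_mkcond [RHS]integral_mkcond; apply: eq_integral => s _.
  rewrite !patchE !mem_setE !in_itv/= !andbT.
  have [ys|sy] := leP y s; first by rewrite (le_trans y0 ys) mul1r.
  by case: ifP => // _; rewrite mul0r.
have dF (s : R) : (y <= s)%R -> is_derive s (1%R : R) (fun s => - expR (- s))%R (expR (- s)).
  by move=> _; apply: is_derive_eq; rewrite /GRing.scale/=; ring.
apply: (integral_itvy_derive (l := 0%R) dF).
- by move=> s _; apply: is_derive_continuous; apply: is_derive_eq.
- by move=> s _; exact: expR_ge0.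
- by rewrite -oppr0; apply: cvgN; exact: cvgr_expR.
- by rewrite sub0r opprK.
Qed.

Lemma sqrt_powR_half (s : R) k : (0 <= s)%R -> (Num.sqrt s ^+ k = s `^ (k%:R / 2))%R.
Proof.
by move=> s0; rewrite -powR12_sqrt// -powR_mulrn ?powR_ge0// -powRrM mulrC.
Qed.

(** The integral of [exp (- |t|^2)] is computed twice: as a product it is [pi^(k/2)], and by layers
    it is the unit ball's volume times [Gamma (k / 2 + 1)]. One identity yields the value and the
    positivity, without the functional equation of [Gamma]. *)
Lemma ball_volume k : (0 < Gamma (k%:R / 2 + 1 : R))%R /\
  L k (eball_tuple 1) = ((pi `^ (k%:R / 2))%R / Gamma (k%:R / 2 + 1 : R))%:E.
Proof.
have [v v0 vE] := lebesgue_eball_tuple_fin k (ltr01 : (0 < 1 :> R)%R).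
have mJ : measurable (`]0%R, +oo[%classic : set R) by exact: measurable_itv.
pose f (z : k.-tuple mR * mR) : \bar R :=
  ((dot (trow z.1) (trow z.1) <= z.2)%R%:R * expR (- z.2))%:E.
have f0 t s : 0 <= f (t, s) by rewrite lee_fin mulr_ge0 ?expR_ge0.
have mf : measurable_fun setT f.
  apply/measurable_EFinP; apply: measurable_funM; last first.
    by apply: measurable_fun_expR; apply: measurable_funN.
  rewrite (_ : (fun z => _) = fun z : k.-tuple mR * mR =>
    if (dot (trow z.1) (trow z.1) <= z.2)%R then 1%R else 0%R); last first.
    by apply/funext => z; case: (_ <= _)%R.
  apply: measurable_fun_ifT => //; apply: measurable_fun_ler => //.
  apply: measurable_dot => i;
    exact: (measurableT_comp (measurable_trow i) measurable_fst).
have := integral_gauss_tuple k.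
under eq_integral do rewrite -(expRN_layer_cake (dot_ge0 _)).
have /= -> := restricted_tonelli (L k) lam measurableT mJ mf (fun t s _ _ => f0 t s).
have gE : \int[lam]_(s in `]0%R, +oo[) \int[L k]_t f (t, s) =
    v%:E * \int[lam]_(s in `]0%R, +oo[) (s `^ (k%:R / 2 + 1 - 1) * expR (- s))%:E.
  rewrite -ge0_integralZl_EFin ?(ltW v0)//; last 2 first.
  - by move=> s _; rewrite lee_fin mulr_ge0 ?powR_ge0 ?expR_ge0.
  - apply: measurable_funTS; apply/measurable_EFinP; apply: measurable_funM.
      exact: measurable_powR.
    by apply: measurable_fun_expR; exact: measurable_funN.
  apply: eq_integral => s; rewrite inE/= in_itv/= andbT => s0.
  have r0 : (0 < Num.sqrt s)%R by rewrite sqrtr_gt0.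
  have : L k (eball_tuple (Num.sqrt s)) = (Num.sqrt s ^+ k * v)%:E.
    by rewrite lebesgue_eball_tuple_scale// vE -EFinM.
  have -> : L k (eball_tuple (Num.sqrt s)) =
      \int[L k]_t (\1_(eball_tuple (Num.sqrt s)) t)%:E.
    by rewrite integral_indic ?setIT//; exact: measurable_eball_tuple.
  move=> E; rewrite addrK -sqrt_powR_half ?ltW//.
  transitivity ((expR (- s))%:E * (Num.sqrt s ^+ k * v)%:E); last first.
    by rewrite -!EFinM; congr EFin; ring.
  rewrite -E -ge0_integralZl_EFin ?expR_ge0//; last first.
    by apply/measurable_EFinP; apply: measurable_indic; exact: measurable_eball_tuple.
  apply: eq_integral => t _; rewrite /f/= indicE mulrC EFinM.
  congr (_ * (nat_of_bool _)%:R%:E).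
  by apply/idP/idP; rewrite inE /eball_tuple/= sqr_sqrtr ?(ltW s0).
rewrite gE => E.
have E2 : \int[lam]_(s in `]0%R, +oo[) (s `^ (k%:R / 2 + 1 - 1) * expR (- s))%:E =
    (Num.sqrt pi ^+ k / v)%:E.
  have := congr1 (fun z => (v^-1)%:E * z) E.
  by rewrite /= muleA -EFinM mulVf ?gt_eqF// mul1e => ->; rewrite -EFinM mulrC.
(* [Gamma] is the real part of an extended integral, which [E2] has shown to be finite. *)
have GE : Gamma (k%:R / 2 + 1 : R) = (Num.sqrt pi ^+ k / v)%R.
  by rewrite /Gamma /Rintegral E2.
rewrite GE; split.
  by rewrite divr_gt0// exprn_gt0// sqrtr_gt0 pi_gt0.
rewrite vE -sqrt_powR_half ?pi_ge0//; congr EFin.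
rewrite invf_div mulrCA mulfV ?mulr1// gt_eqF// exprn_gt0// sqrtr_gt0.
exact: pi_gt0.
Qed.

End BallVolume.

(** * Sections *)

Section SectionVolume.
Context {R : realType}.
Local Notation mR := (measurableTypeR R).
Local Notation lam := (@lebesgue_measure R).
Local Notation L k := (@lebesgue_tuple R k).

Lemma enorm1_dot k (a : 'rV[R]_k) : enorm a = 1 -> dot a a = 1.
Proof. by move=> a1; rewrite -[LHS](@sqr_sqrtr R) ?dot_ge0// -/(enorm a) a1 expr1n. Qed.

(** The rows other than the first of an orthogonal matrix whose first row is [a]. Existence
    guarantees that the choice in [vol] is a basis and not the default value 0. *)
Lemma hyperplane_basis k (a : 'rV[R]_k.+1) : dot a a = 1 ->
  exists U : 'M[R]_(k, k.+1), orthonormal_basis (hyperplane a) U.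
Proof.
move=> a1; have [A AA Aa] := householder a1.
have AA' := mulmx1C AA.
pose U : 'M[R]_(k, k.+1) := row' 0 A.
have rowAA i j : row i A *m (row j A)^T = (i == j)%:R%:M.
  rewrite [LHS]mx11_scalar; congr (_%:M).
  have := congr1 (fun M : 'M[R]_k.+1 => M i j) AA; rewrite !mxE => <-.
  by apply: eq_bigr => l _; rewrite !mxE.
exists U; split.
  apply/matrixP => i j; rewrite !mxE.
  have := congr1 (fun M : 'M[R]_1 => M 0 0) (rowAA (lift 0 i) (lift 0 j)).
  rewrite !mxE eqxx mulr1n (inj_eq lift_inj) => <-.
  by apply: eq_bigr => l _; rewrite !mxE.
apply/seteqP; split => [x [c _ <-]|x].
  rewrite /hyperplane/= dotE trmx_mul.
  suff -> : a *m (U^T *m c^T) = 0 by rewrite mxE.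
  rewrite mulmxA; suff -> : a *m U^T = 0 by rewrite mul0mx.
  apply/rowP => i; rewrite [LHS]mxE [RHS]mxE.
  have h := congr1 (fun M : 'M[R]_1 => M 0 0) (rowAA 0 (lift 0 i)).
  rewrite [in LHS]mxE [in RHS]mxE mulr0n in h; rewrite -[RHS]h.
  by apply: eq_bigr => l _; rewrite -Aa !mxE.
rewrite /hyperplane/= => ax; exists (x *m U^T) => //.
have : x *m A^T *m A = x by rewrite -mulmxA AA' mulmx1.
move=> {2}<-; apply/rowP => j; rewrite !mxE big_ord_recl.
have -> : (x *m A^T) 0 0 = 0.
  rewrite -[RHS]ax mxE /dot; apply: eq_bigr => l _.
  by rewrite -Aa !mxE mulrC.
rewrite mul0r add0r; apply: eq_bigr => i _; rewrite !mxE; congr (_ * _).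
by apply: eq_bigr => l _; rewrite !mxE.
Qed.

Lemma trow_cons_mul k (a : 'rV[R]_k.+1) (U : 'M[R]_(k, k.+1)) s (t : k.-tuple mR) :
  trow [tuple of s :: t] *m (col_mx a U : 'M[R]_(1 + k, k.+1)) = s *: a + trow t *m U.
Proof.
have -> : trow [tuple of s :: t] = row_mx (s%:M : 'rV[R]_1) (trow t) :> 'rV[R]_(1 + k).
  apply/rowP => i; rewrite [LHS]mxE [RHS]mxE; case: (splitP i) => j ij.
    by rewrite (tnth_nth 0) ij (ord1 j)/= mxE eqxx mulr1n.
  by rewrite (tnth_nth 0) ij/= mxE (tnth_nth 0).
by rewrite -mul_scalar_mx; exact: (mul_row_col s%:M (trow t) a U).
Qed.

Local Open Scope ereal_scope.

Lemma lebesgue_tuple_scale_set k (c : R) (A : set (k.-tuple mR)) : (0 < c)%R ->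
  measurable A ->
  L k [set t | A (rowt (c *: trow t)%R)] = (c ^- k)%:E * L k A.
Proof.
move=> c0 mA.
have mS : measurable_fun setT (fun t : k.-tuple mR => rowt (c *: trow t)%R).
  apply: measurable_rowt => i; under eq_fun do rewrite mxE.
  by apply: measurable_funM => //; exact: measurable_trow.
have mB : measurable [set t | A (rowt (c *: trow t)%R)].
  by rewrite -[X in measurable X]setTI; exact: mS.
have E (B : set (k.-tuple mR)) : measurable B -> L k B = \int[L k]_t (\1_B t)%:E.
  by move=> mB'; rewrite integral_indic ?setIT.
rewrite !E// -(ge0_integral_tuple_scale c0)//.
by apply/measurable_EFinP; exact: measurable_indic.
Qed.

(** The closure condition on [S] stands for convexity. Within the slab every parallel section
    contains a copy of the central section shrunk by [c], and conversely; integrating over the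
    height gives both inequalities. *)
Lemma slab_hyperplane_vol k (a : 'rV[R]_k.+1) (S : set 'rV[R]_k.+1) (eps c : R) :
  dot a a = 1%R -> (0 < eps)%R -> (0 < c <= 1)%R ->
  measurable [set t : k.+1.-tuple mR | S (trow t)] ->
  (forall (z : 'rV[R]_k.+1) s, (`|s| <= eps)%R -> S z -> S (c *: z + s *: a)%R) ->
  let V := vol k (hyperplane a) (hyperplane a `&` S) in
  let W := L k.+1 [set t | S (trow t) /\ (`|dot a (trow t)| <= eps)%R] in
  (c ^+ k * (2 * eps))%:E * V <= W /\ (c ^+ k)%:E * W <= (2 * eps)%:E * V.
Proof.
move=> a1 eps0 /andP[c0 c1] mS Sc V W.
have [U0 U0b] := hyperplane_basis a1.
pose U : 'M[R]_(k, k.+1) := xget 0%R (orthonormal_basis (hyperplane a)).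
have [UU UH] : orthonormal_basis (hyperplane a) U by rewrite /U; case: xgetP => [y -> //|/(_ U0)].
have HU (x : 'rV[R]_k) : dot a (x *m U) = 0%R.
  suff : hyperplane a (x *m U) by [].
  by rewrite -UH; exists x.
have aU : a *m U^T = 0%R.
  apply/rowP => i; rewrite [RHS]mxE -[RHS](HU (delta_mx 0%R i)) dotE trmx_mul mulmxA trmx_delta.
  by rewrite -colE [RHS]mxE.
have aa : a *m a^T = 1%:M by rewrite [LHS]mx11_scalar -dotE a1.
pose O : 'M[R]_k.+1 := (col_mx a U : 'M[R]_(1 + k, k.+1)).
have OO : O *m O^T = 1%:M.
  suff : col_mx a U *m (col_mx a U)^T = 1%:M :> 'M[R]_(1 + k) by [].
  rewrite tr_col_mx mul_col_row aa aU UU.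
  have -> : U *m a^T = 0%R by rewrite -[LHS]trmxK trmx_mul trmxK aU trmx0.
  by rewrite -scalar_mx_block.
have dotU s (x : 'rV[R]_k) : dot a (s *: a + x *m U)%R = s.
  rewrite dotE linearD/= mulmxDr linearZ/= -scalemxAr aa mxE -dotE HU addr0.
  by rewrite !mxE eqxx mulr1.
pose G s := L k [set t | S (s *: a + trow t *m U)%R].
have mcomb d (T : measurableType d) (f : T -> R) (g : T -> k.-tuple mR) :
    measurable_fun setT f -> measurable_fun setT g ->
    measurable_fun setT (fun z => rowt (f z *: a + trow (g z) *m U)%R).
  move=> mf mg; apply: measurable_rowt => i; under eq_fun do rewrite mxE mxE.
  apply: measurable_funD; first exact: measurable_funM.
  by apply: measurable_mulmxr => j; exact: (measurableT_comp (measurable_trow j)).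
have setE s : [set t : k.-tuple mR | S (s *: a + trow t *m U)%R] =
    (fun t => rowt (s *: a + trow t *m U)%R) @^-1` [set t | S (trow t)].
  by apply/seteqP; split => t /=; rewrite rowtK.
have mset s : measurable [set t : k.-tuple mR | S (s *: a + trow t *m U)%R].
  rewrite setE -[X in measurable X]setTI.
  by apply: (mcomb _ _ (fun=> s) id).
have GE s : G s = \int[L k]_t (\1_[set t | S (trow t)] (rowt (s *: a + trow t *m U)%R))%:E.
  have -> : G s = \int[L k]_t (\1_[set t | S (s *: a + trow t *m U)%R] t)%:E.
    by rewrite integral_indic ?setIT.
  apply: eq_integral => t _; rewrite !indicE; congr ((nat_of_bool _)%:R%:E).
  by apply/idP/idP; rewrite !inE/= rowtK.
have mG : measurable_fun [set: R] G.
  rewrite (_ : G = fun s => \int[L k]_t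
    (\1_[set t | S (trow t)] (rowt (s *: a + trow t *m U)%R))%:E); last first.
    by apply/funext => s; exact: GE.
  apply: (measurable_fun_fubini_tonelli_F (m2 := L k) (fun z : mR * k.-tuple mR =>
    (\1_[set t | S (trow t)] (rowt (z.1 *: a + trow z.2 *m U)%R))%:E)).
  - apply/measurable_EFinP; apply: measurableT_comp; first exact: measurable_indic.
    exact: mcomb.
  - by move=> z; rewrite lee_fin.
have VE : V = L k [set t | S (trow t *m U)].
  congr (L k _); apply/seteqP; split => t /=; first by case.
  by split => //; exact: HU.
have mV : measurable [set t : k.-tuple mR | S (trow t *m U)].
  rewrite (_ : [set t | _] = [set t : k.-tuple mR | S (0 *: a + trow t *m U)%R])//.
  by apply/funext => t /=; rewrite scale0r add0r.
have WE : W = \int[lam]_s (ball_indic eps s * G s).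
  pose T := [set t : k.+1.-tuple mR | S (trow t) /\ (`|dot a (trow t)| <= eps)%R].
  have mT : measurable T.
    rewrite (_ : T = [set t | S (trow t)] `&`
      (fun t : k.+1.-tuple mR => dot a (trow t)) @^-1` `[(- eps)%R, eps]%classic).
      apply: measurableI => //; rewrite -[X in measurable X]setTI.
      have mdot : measurable_fun setT (fun t : k.+1.-tuple mR => dot a (trow t)).
        by apply: measurable_dot => i; [exact: measurable_cst|exact: measurable_trow].
      by apply: mdot => //; exact: measurable_itv.
    by apply/seteqP; split => t; rewrite /T/= in_itv/= ler_norml.
  have mI : measurable_fun setT (fun t : k.+1.-tuple mR => (\1_T t)%:E : \bar R).
    by apply/measurable_EFinP; exact: measurable_indic.
  have -> : W = \int[L k.+1]_t (\1_T t)%:E by rewrite integral_indic ?setIT.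
  rewrite -(ge0_integral_tuple_orthogonal OO mI)//.
  rewrite ge0_integral_tupleS//; last first.
    have mO : measurable_fun setT (fun t : k.+1.-tuple mR => rowt (trow t *m O)).
      apply: measurable_rowt => i.
      by apply: measurable_mulmxr => j; exact: measurable_trow.
    exact: (measurableT_comp mI mO).
  apply: eq_integral => s _; under eq_integral do rewrite trow_cons_mul.
  rewrite /ball_indic; have [se|se] := boolP (`|s| <= eps)%R.
    rewrite mul1e GE; apply: eq_integral => t _; rewrite !indicE.
    congr ((nat_of_bool _)%:R%:E).
    apply/idP/idP; rewrite !inE /T/= rowtK; first by case.
    by move=> ?; rewrite dotU.
  rewrite mul0e integral0_eq// => t _; rewrite indicE memNset// /T/= rowtK dotU.
  by case => _; exact/negP.
have lowG s : (`|s| <= eps)%R -> (c ^+ k)%:E * V <= G s.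
  move=> se; have ci : (0 < c^-1)%R by rewrite invr_gt0.
  (* [c^k] times the volume of a set is the volume of the points [t] with [t / c] in the set. *)
  rewrite VE -[c in (c ^+ k)%R]invrK exprVn -lebesgue_tuple_scale_set//.
  apply: le_measure; rewrite ?inE//.
    rewrite -[X in measurable X]setTI.
    apply: (measurable_rowt (f := fun t : k.-tuple mR => c^-1 *: trow t)%R) => // i.
    under eq_fun do rewrite mxE.
    by apply: measurable_funM => //; exact: measurable_trow.
  move=> t /=; rewrite rowtK => /(Sc _ _ se).
  by rewrite -scalemxAl scalerA mulfV ?gt_eqF// scale1r addrC.
have upG s : (`|s| <= eps)%R -> (c ^+ k)%:E * G s <= V.
  move=> se; have ci : (0 < c^-1)%R by rewrite invr_gt0.
  rewrite VE -[c in (c ^+ k)%R]invrK exprVn -lebesgue_tuple_scale_set//.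
  apply: le_measure; rewrite ?inE//.
    rewrite -[X in measurable X]setTI.
    apply: (measurable_rowt (f := fun t : k.-tuple mR => c^-1 *: trow t)%R) => // i.
    under eq_fun do rewrite mxE.
    by apply: measurable_funM => //; exact: measurable_trow.
  move=> t /=; rewrite rowtK.
  (* Shrinking by [c] lowers the height from [s] to [c s], so the shift by [- c s] returns to the
     central section. *)
  have cse : (`|- (c * s)| <= eps)%R.
    by rewrite normrN normrM (gtr0_norm c0) (le_trans _ se)// ler_piMl.
  move=> /(Sc _ _ cse); rewrite scalerDr scalerA addrAC -scalerDl subrr scale0r add0r.
  by rewrite -scalemxAl scalerA mulfV ?gt_eqF// scale1r.
have V0 : 0 <= V by exact: measure_ge0.
have b0 := @ball_indic_ge0 R eps; have mb := @measurable_ball_indic R eps.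
have eps0' := ltW eps0.
have ck : (0 <= c ^+ k)%R by rewrite exprn_ge0// ltW.
have ck0 : 0 <= (c ^+ k)%:E * V by rewrite mule_ge0.
rewrite WE; split.
  rewrite mulrC EFinM -muleA -integral_ball_indic// -ge0_integralZr//.
  apply: ge0_le_integral => //.
  - by move=> s _; rewrite mule_ge0.
  - exact: emeasurable_funM.
  - exact: emeasurable_funM.
  move=> s _; rewrite /ball_indic; have [se|se] := boolP (`|s| <= eps)%R.
    by rewrite !mul1e; exact: lowG.
  by rewrite !mul0e.
rewrite -integral_ball_indic// -ge0_integralZr// -ge0_integralZl_EFin//; last 2 first.
- by move=> s _; rewrite mule_ge0.
- exact: emeasurable_funM.
apply: ge0_le_integral => //.
- by move=> s _; rewrite !mule_ge0.
- by apply: emeasurable_funM => //; exact: emeasurable_funM.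
- exact: emeasurable_funM.
move=> s _; rewrite /ball_indic; have [se|se] := boolP (`|s| <= eps)%R.
  by rewrite !mul1e; exact: upG.
by rewrite !mul0e mule0.
Qed.

End SectionVolume.

(** * Sections and thin slabs of the cylinder *)

Section SectionBounds.
Context {R : realType}.
Local Notation mR := (measurableTypeR R).
Local Notation lam := (@lebesgue_measure R).
Local Notation L k := (@lebesgue_tuple R k).

Lemma measurable_cylinder n k (r : R) : 0 < r ->
  measurable [set t : (n + k.+1).-tuple mR | cylinder r (trow t)].
Proof.
(* The slab with normal vector 0 and width 0 is the whole cylinder. *)
move=> r0; have := @measurable_slab R n k 0 r 0 r0.
congr measurable; apply/seteqP; split => t /=; first by case.
split => //; rewrite /dot big1 ?normr0// => i _.
by rewrite mxE mul0r.
Qed.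

Lemma sqr_convex_le (d u v : R) : 0 <= d <= 1 ->
  ((1 - d) * u + d * v) ^+ 2 <= (1 - d) * u ^+ 2 + d * v ^+ 2.
Proof.
move=> /andP[d0 d1]; rewrite -subr_ge0.
have -> : (1 - d) * u ^+ 2 + d * v ^+ 2 - ((1 - d) * u + d * v) ^+ 2 =
    d * (1 - d) * (u - v) ^+ 2 by ring.
by rewrite mulr_ge0 ?sqr_ge0// mulr_ge0// subr_ge0.
Qed.

Lemma normr_coord_le1 k (a : 'rV[R]_k) i : dot a a = 1 -> `|a 0 i| <= 1.
Proof.
move=> a1; rewrite -(@expr_le1 _ 2)// real_normK ?num_real// -a1.
rewrite /dot (bigD1 i)//= expr2 lerDl.
by apply: sumr_ge0 => j _; rewrite -expr2 sqr_ge0.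
Qed.

(** A convex combination of [z] and [(s / d) a]; the second point lies in the cylinder, which
    contains the ball of radius [min (1/2, r)]. *)
Lemma cylinder_shrink n m (r d s : R) (a z : 'rV[R]_(n + m)) :
  0 < r -> dot a a = 1 -> 0 < d <= 1 -> `|s| <= d * Num.min (1 / 2) r ->
  cylinder r z -> cylinder r ((1 - d) *: z + s *: a).
Proof.
move=> r0 a1 /andP[d0 d1] sd [zc zb].
pose s' := s / d; have sE : s = d * s' by rewrite mulrC divfK ?gt_eqF.
clearbody s'.
have : `|s'| <= Num.min (1 / 2) r.
  by move: sd; rewrite sE normrM (gtr0_norm d0) ler_pM2l.
rewrite le_min => /andP[s2 sr]; split.
  move=> i; have := zc i; rewrite !mxE !in_itv/= -!ler_norml => zi.
  apply: (le_trans (ler_normD _ _)).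
  rewrite sE !normrM (gtr0_norm d0) ger0_norm ?subr_ge0//.
  have ai := normr_coord_le1 (lshift m i) a1.
  have sa : `|s'| * `|a 0 (lshift m i)| <= 1 / 2.
    by rewrite -[leRHS]mulr1 ler_pM.
  have d1' : 0 <= 1 - d by rewrite subr_ge0.
  have := ler_wpM2l d1' zi; have := ler_wpM2l (ltW d0) sa.
  lra.
move: zb; rewrite /eball/= !(enorm_le _ (ltW r0)) => zb.
have b1 : dot (rsubmx a) (rsubmx a) <= 1.
  rewrite -a1 [leRHS]/dot big_split_ord/= [leLHS](_ : _ =
    \sum_(i < m) a 0 (rshift n i) * a 0 (rshift n i)) ?lerDr; last first.
    by apply: eq_bigr => i _; rewrite mxE.
  by apply: sumr_ge0 => i _; rewrite -expr2 sqr_ge0.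
apply: (@le_trans _ _ ((1 - d) * dot (rsubmx z) (rsubmx z) +
    d * (s' ^+ 2 * dot (rsubmx a) (rsubmx a)))).
  rewrite /dot !mulr_sumr -big_split/=; apply: ler_sum => i _.
  have := @sqr_convex_le d (rsubmx z 0 i) (s' * rsubmx a 0 i).
  rewrite (ltW d0) d1 => /(_ isT); rewrite !mxE sE -!expr2 exprMn.
  by rewrite mulrA.
have sr2 : s' ^+ 2 * dot (rsubmx a) (rsubmx a) <= r ^+ 2.
  rewrite -[leRHS]mulr1 ler_pM ?sqr_ge0 ?dot_ge0//.
  by rewrite -real_normK ?num_real// lerXn2r ?nnegrE// ltW.
have d1' : 0 <= 1 - d by rewrite subr_ge0.
have := ler_wpM2l d1' zb; have := ler_wpM2l (ltW d0) sr2; lra.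
Qed.

(** The limit [e -> 0+]. The power is the loss from shrinking; the factor [1 - C e] absorbs the loss
    in the small ball estimate from below, and [C = 0] serves the upper bound. *)
Lemma le_of_shrink d (C x y : R) :
  (forall e, 0 < e < 1 / 2 -> (1 - e) ^+ d * (1 - C * e) * x <= y) -> x <= y.
Proof.
move=> H; pose f (e : R) := (1 - e) ^+ d * (1 - C * e) * x.
have fx : f e @[e --> 0^'+] --> x.
  apply: cvg_at_right_filter.
  have -> : x = (1 - 0) ^+ d * (1 - C * 0) * x by rewrite subr0 expr1n mulr0 subr0 !mul1r.
  apply: cvgMl; apply: cvgM.
    have : (fun u : R => u ^+ d) x0 @[x0 --> (1 - 0 : R)] --> (1 - 0 : R) ^+ d.
      exact: exprn_continuous.
    by apply: cvg_comp; apply: cvgB; [exact: cvg_cst|exact: cvg_id].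
  by apply: cvgB; [exact: cvg_cst|apply: cvgMr; exact: cvg_id].
apply: (cvgr_to_le fx); near=> e; apply: H.
apply/andP; split; near: e; first exact: nbhs_right_gt.
by apply: nbhs_right_lt; lra.
Unshelve. all: by end_near. Qed.

Local Open Scope ereal_scope.

(** [n + k.+1] does not reduce to a successor, hence the dimension [N] with an equation. *)
Lemma slab_hyperplane_vol_size N k (a : 'rV[R]_N) (S : set 'rV[R]_N) (eps c : R) :
  N = k.+1 -> dot a a = 1%R -> (0 < eps)%R -> (0 < c <= 1)%R ->
  measurable [set t : N.-tuple mR | S (trow t)] ->
  (forall (z : 'rV[R]_N) s, (`|s| <= eps)%R -> S z -> S (c *: z + s *: a)%R) ->
  let V := vol k (hyperplane a) (hyperplane a `&` S) in
  let W := L N [set t | S (trow t) /\ (`|dot a (trow t)| <= eps)%R] in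
  (c ^+ k * (2 * eps))%:E * V <= W /\ (c ^+ k)%:E * W <= (2 * eps)%:E * V.
Proof. by move=> Nk; subst N; exact: slab_hyperplane_vol. Qed.

Lemma cylinder_section_slab n k (a : 'rV[R]_(n + k.+1)) (r e : R) :
  (0 < r)%R -> dot a a = 1%R -> (0 < e < 1)%R ->
  let eps := (e * Num.min (1 / 2) r)%R in
  let V := vol (n + k.+1 - 1) (hyperplane a) (hyperplane a `&` cylinder r) in
  ((1 - e) ^+ (n + k.+1 - 1) * (2 * eps))%:E * V <= L (n + k.+1) (slab a r eps) /\
  ((1 - e) ^+ (n + k.+1 - 1))%:E * L (n + k.+1) (slab a r eps) <= (2 * eps)%:E * V.
Proof.
move=> r0 a1 /andP[e0 e1] eps.
have rho0 : (0 < Num.min (1 / 2) r)%R by rewrite lt_min r0 andbT; lra.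
apply: slab_hyperplane_vol_size => //.
- by rewrite addnS subn1.
- by rewrite mulr_gt0.
- by rewrite subr_gt0 e1/= gerBl ltW.
- exact: measurable_cylinder.
- by move=> z s se; apply: cylinder_shrink => //; rewrite e0 ltW.
Qed.

Lemma unif_avg0 (g : R -> R) x : unif_avg 0 (EFin \o g) x = (g x)%:E.
Proof.
rewrite /unif_avg; under eq_integral do rewrite mul0r addr0.
have mI : measurable (`[(- (1 / 2))%R, (1 / 2)%R]%classic : set R) by [].
rewrite (integral_cst lam mI (g x)%:E).
by rewrite [X in _ * X]lebesgue_unit_itv mule1.
Qed.

Lemma foldr_unif_avg0 s (g : R -> R) x : all (pred1 0%R) s ->
  foldr unif_avg (EFin \o g) s x = (g x)%:E.
Proof.
elim: s x => //= a s IH x /andP[/eqP -> s0].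
rewrite [foldr _ _ _](_ : _ = EFin \o g) ?unif_avg0//.
by apply/funext => y; exact: IH.
Qed.

Lemma unif_avg_ball_indic (c eps x : R) : (0 < c)%R -> (0 <= eps)%R ->
  (`|x| + eps <= c / 2)%R -> unif_avg c (ball_indic eps) x = (2 * eps / c)%:E.
Proof.
move=> c0 eps0 xc; have mb := @measurable_ball_indic R eps.
have b0 := @ball_indic_ge0 R eps.
rewrite mulrC EFinM -integral_ball_indic// -(ge0_integral_affine x c0)//.
rewrite /unif_avg integral_mkcond; apply: eq_integral => u _.
rewrite patchE mem_setE in_itv/= -ler_norml addrC.
case: ifPn => //; rewrite -ltNge => u2.
rewrite /ball_indic leNgt (_ : (_ < _)%R)//.
have := ler_normB (c * u + x)%R x; rewrite addrK normrM (gtr0_norm c0) => h.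
have : (c * (1 / 2) < c * `|u|)%R by rewrite ltr_pM2l.
lra.
Qed.

(** The density of the sum of two uniform variables scaled by [c] is [1 / c] at 0. For [|u| <= h]
    the interval of radius [eps] around [c u] stays inside [[-c/2, c/2]], where the inner average is
    exactly [2 eps / c]; the length [2 h] is the loss factor. *)
Lemma unif_avg2_ball_indic_ge (c eps : R) : (0 < eps)%R -> (2 * eps < c)%R ->
  (2 * eps / c * (1 - 2 * eps / c))%:E <=
  unif_avg c (unif_avg c (ball_indic eps)) 0.
Proof.
move=> eps0 ec; have c0 : (0 < c)%R by lra.
have mb := @measurable_ball_indic R eps; have b0 := @ball_indic_ge0 R eps.
set q := (2 * eps / c)%R.
have q0 : (0 < q)%R by rewrite divr_gt0// mulr_gt0.
have q1 : (q < 1)%R by rewrite ltr_pdivrMr// mul1r.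
have epsE : (2 * eps = q * c)%R by rewrite /q divfK// gt_eqF.
pose h := ((1 - q) / 2)%R.
have mJ : measurable (`[(- h)%R, h]%classic : set R) by exact: measurable_itv.
apply: (@le_trans _ _ (\int[lam]_(u in `[(- h)%R, h]) unif_avg c (ball_indic eps) (0 + c * u)%R)).
  rewrite (eq_integral (fun=> q%:E)).
    rewrite (integral_cst lam mJ q%:E) [X in _ * X]lebesgue_measure_itv/= lte_fin ifT; last by rewrite /h; lra.
    by rewrite -EFinD -EFinM lee_fin /h le_eqVlt; apply/orP; left; apply/eqP; field.
  move=> u; rewrite inE/= in_itv/= -ler_norml => uh.
  rewrite unif_avg_ball_indic ?(ltW eps0)// add0r normrM (gtr0_norm c0).
  have := ler_wpM2l (ltW c0) uh; rewrite /h; lra.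
apply: ge0_subset_integral => //.
- apply: measurable_funTS; apply: measurable_shift.
  exact: measurable_unif_avg.
- by move=> u _; apply: unif_avg_ge0.
- by move=> u; rewrite /= !in_itv/= => /andP[u1 u2]; apply/andP; split; rewrite /h in u1 u2; lra.
Qed.

End SectionBounds.

Section CylinderSections.
Context {R : realType}.
Local Notation L k := (@lebesgue_tuple R k).
Local Open Scope ereal_scope.

Lemma cylinder_section_le n k (a : 'rV[R]_(n + k.+1)) (r Q B : R) :
  (0 < r)%R -> dot a a = 1%R ->
  L k.+1 (eball_tuple r) = Q%:E -> L k (eball_tuple r) = B%:E ->
  vol (n + k.+1 - 1) (hyperplane a) (hyperplane a `&` cylinder r) <=
    (Num.max Q B * Num.sqrt 2)%:E.
Proof.
move=> r0 a1 LQ LB; set d := (n + k.+1 - 1)%N; set V := vol _ _ _.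
set M := (Num.max Q B * Num.sqrt 2)%R.
have rho0 : (0 < Num.min (1 / 2) r)%R by rewrite lt_min r0 andbT; lra.
have H (e : R) : (0 < e < 1)%R -> exists2 eps : R, (0 < eps)%R &
    ((1 - e) ^+ d * (2 * eps))%:E * V <= (2 * eps * M)%:E.
  move=> e01; exists (e * Num.min (1 / 2) r)%R; first by rewrite mulr_gt0//; case/andP: e01.
  have [h _] := cylinder_section_slab r0 a1 e01; apply: le_trans h _.
  apply: slab_volume_le => //.
  by rewrite mulr_gt0//; case/andP: e01.
have V0 : 0 <= V by exact: measure_ge0.
have c0 (e eps : R) : (0 < e < 1)%R -> (0 < eps)%R -> (0 < (1 - e) ^+ d * (2 * eps))%R.
  by move=> /andP[_ e1] eps0; rewrite !mulr_gt0// exprn_gt0// subr_gt0.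
(* An infinite [V] is refuted by the single value [e = 1 / 2]. *)
move: V V0 H => [v| |]// V0 H; last first.
  have h : (0 < (1 / 2 : R) < 1)%R by apply/andP; split; lra.
  have [eps eps0] := H _ h.
  by rewrite gt0_muley ?lte_fin ?c0.
rewrite lee_fin; apply: (@le_of_shrink R d 0) => e /andP[e0 e1].
have e01 : (0 < e < 1)%R by rewrite e0/=; lra.
have [eps eps0] := H _ e01; rewrite -EFinM lee_fin mul0r subr0 mulr1.
by rewrite mulrAC mulrC ler_pM2l// mulr_gt0.
Qed.

(** The ball part of [a] is 0, so the slab volume is [Q] times the probability that
    [|U1 + U2| / sqrt 2 <= eps]; the density of this sum at 0 is [sqrt 2]. *)
Lemma cylinder_section_ge n k (r Q : R) :
  (0 < r)%R -> L k.+1 (eball_tuple r) = Q%:E ->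
  let a : 'rV[R]_(n.+2 + k.+1) := (\row_(i < n.+2 + k.+1) (if (i < 2)%N then 1 / Num.sqrt 2 else 0))%R in
  dot a a = 1%R /\ forall v : R,
  vol (n.+2 + k.+1 - 1) (hyperplane a) (hyperplane a `&` cylinder r) = v%:E ->
  (Q * Num.sqrt 2 <= v)%R.
Proof.
move=> r0 LQ a; set c : R := (1 / Num.sqrt 2)%R.
have s20 : (0 < Num.sqrt 2 :> R)%R by rewrite sqrtr_gt0.
have ss : (Num.sqrt 2 * Num.sqrt 2 = 2 :> R)%R by rewrite -expr2 sqr_sqrtr.
have c0 : (0 < c)%R by rewrite divr_gt0.
have cc : (c * c = 1 / 2)%R.
  by rewrite /c mulf_div mulr1 ss.
have aE i : a 0%R i = (if (i < 2)%N then c else 0)%R by rewrite mxE.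
have a1 : dot a a = 1%R.
  rewrite /dot /= !big_ord_recl big1 => [|i _]; first by rewrite !aE/= addr0 cc; field.
  by rewrite !aE /= mul0r.
split => // v vE.
have Q0 : (0 < Q)%R.
  by have [q q0] := lebesgue_eball_tuple_fin k.+1 r0; rewrite LQ => -[->].
have ab : enorm (rsubmx a) = 0%R.
  rewrite /enorm /dot big1 ?sqrtr0// => i _.
  by rewrite !mxE /= mul0r.
have [s sE s0] : exists2 s, cube_coefs a = [:: c, c & s] & all (pred1 0%R) s.
  rewrite /cube_coefs !enum_ordSl/= !aE/=; eexists; first by [].
  by apply/allP => x /mapP[i /mapP[j /mapP[l _ ->] ->] ->]; rewrite aE /= eqxx.
have mb e := @measurable_ball_indic R e; have b0 e := @ball_indic_ge0 R e.
have slabE e : L (n.+2 + k.+1) (slab a r e) =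
    Q%:E * unif_avg c (unif_avg c (ball_indic e)) 0.
  rewrite slab_volume// ab sE foldr_unif_avg_mixture//; last first.
    exact: measurable_section_vol.
  have fE : foldr unif_avg (ball_indic e) s = ball_indic e.
    by apply/funext => x; exact: (foldr_unif_avg0 (fun x => (`|x| <= e)%R%:R) x s0).
  under eq_integral do rewrite mul0r addr0.
  rewrite [foldr _ _ _]/= fE -LQ -integral_section_vol -ge0_integralZr//.
  - exact: measurable_section_vol.
  - by apply: unif_avg_ge0 => y; apply: unif_avg_ge0.
have rho0 : (0 < Num.min (1 / 2) r)%R by rewrite lt_min r0 andbT; lra.
set rho := (Num.min (1 / 2) r)%R in rho0.
(* As [eps = e rho], the relative loss [2 eps / c] is this constant times [e]. *)
apply: (@le_of_shrink R (n.+2 + k.+1 - 1) (2 * rho / c)%R) => e /andP[e0 e1].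
have e01 : (0 < e < 1)%R by rewrite e0/=; lra.
have [_] := cylinder_section_slab r0 a1 e01; rewrite -/rho vE slabE.
set eps := (e * rho)%R.
have eps0 : (0 < eps)%R by rewrite mulr_gt0.
have ec : (2 * eps < c)%R.
  have rh : (rho <= 1 / 2)%R by rewrite ge_min lexx.
  have : (eps <= 1 / 2 * (1 / 2))%R by rewrite /eps ler_pM// ltW.
  have : (1 / 2 < c)%R.
    by rewrite ltNge; apply/negP => h; have := ler_pM (ltW c0) (ltW c0) h h; lra.
  lra.
have low := unif_avg2_ball_indic_ge eps0 ec.
move=> h.
set D := ((1 - e) ^+ _)%R in h *.
have D0 : (0 < D)%R by rewrite exprn_gt0// subr_gt0; lra.
have : D%:E * (Q%:E * (2 * eps / c * (1 - 2 * eps / c))%:E) <= (2 * eps)%:E * v%:E.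
  apply: le_trans h; rewrite lee_wpmul2l ?lee_fin ?(ltW D0)//.
  by rewrite lee_wpmul2l ?lee_fin ?(ltW Q0).
rewrite -!EFinM lee_fin.
have -> : (D * (Q * (2 * eps / c * (1 - 2 * eps / c))) =
  2 * eps * (D * (1 - 2 * rho / c * e) * (Q * Num.sqrt 2)))%R.
  have -> : (Num.sqrt 2 = c^-1)%R by rewrite /c invf_div divr1.
  by rewrite /eps; field; rewrite gt_eqF.
by rewrite ler_pM2l// mulr_gt0.
Qed.

(** The threshold is the radius at which the two ball volumes agree: [Q / B] equals [r sqrt pi Gamma
    (m / 2 + 1) / Gamma ((m + 1) / 2 + 1)], that is [r / threshold]. *)
Lemma max_cylinder_bound m (r : R) : (0 < r)%R ->
  let threshold := (Gamma (m.+1%:R / 2 + 1) / Gamma (m.+1%:R / 2 + 1 / 2)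
                   * (1 / Num.sqrt pi))%R in
  let Q := (r ^+ m.+1 * (pi `^ (m.+1%:R / 2) / Gamma (m.+1%:R / 2 + 1)))%R in
  let B := (r ^+ m * (pi `^ ((m.+1%:R - 1) / 2) / Gamma ((m.+1%:R - 1) / 2 + 1)))%R in
  [/\ L m.+1 (eball_tuple r) = Q%:E, L m (eball_tuple r) = B%:E &
      (Num.max Q B = if threshold <= r then Q else B)%R].
Proof.
move=> r0 threshold Q B.
have mE : (m.+1%:R - 1 = m%:R :> R)%R by rewrite -natr1 addrK.
have hE : (m.+1%:R / 2 + 1 / 2 = m%:R / 2 + 1 :> R)%R by rewrite -natr1; field.
have [G1 v1] := @ball_volume R m.+1; have [G0 v0] := @ball_volume R m.
split.
- by rewrite lebesgue_eball_tuple_scale// v1 -EFinM.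
- by rewrite lebesgue_eball_tuple_scale// v0 -EFinM /B mE.
have p0 : (0 < Num.sqrt pi :> R)%R by rewrite sqrtr_gt0 pi_gt0.
have BQ : (B <= Q)%R = (threshold <= r)%R.
  rewrite /B /Q /threshold mE hE -!sqrt_powR_half ?pi_ge0// !exprS.
  move: (Gamma (m%:R / 2 + 1)) (Gamma (m.+1%:R / 2 + 1)) (Num.sqrt pi) G0 G1 p0.
  move=> g0 g1 p g0p g1p p0.
  have -> : (g1 / g0 * (1 / p) = g1 / (p * g0))%R by field; rewrite !gt_eqF.
  rewrite ler_pdivrMr ?mulr_gt0//.
  have -> : (r ^+ m * (p ^+ m / g0) = g1 * ((r * p) ^+ m / (g0 * g1)))%R.
    by rewrite exprMn; field; rewrite !gt_eqF.
  have -> : (r * r ^+ m * (p * p ^+ m / g1) = r * (p * g0) * ((r * p) ^+ m / (g0 * g1)))%R.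
    by rewrite exprMn; field; rewrite !gt_eqF.
  by rewrite ler_pM2r// divr_gt0 ?mulr_gt0// exprn_gt0// mulr_gt0.
rewrite -BQ; case: ifPn => [|]; first by move/max_idPl.
by rewrite -ltNge => /ltW/max_idPr.
Qed.

End CylinderSections.

Theorem theorem2 (R : realType) (n m : nat) (r : R) :
  (1 < n)%N -> (1 < m)%N -> 0 < r ->
  let Z := @cylinder R n m r in
  let threshold := Gamma (m%:R / 2 + 1) / Gamma (m%:R / 2 + 1 / 2)
                   * (1 / Num.sqrt pi) in
  let bound_large := r ^+ m * (pi `^ (m%:R / 2) / Gamma (m%:R / 2 + 1))
                     * Num.sqrt 2 in
  let bound_small := r ^+ (m - 1) *
                     (pi `^ ((m%:R - 1) / 2) / Gamma ((m%:R - 1) / 2 + 1))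
                     * Num.sqrt 2 in
  (forall a : 'rV[R]_(n + m), enorm a = 1 ->
    (vol (n + m - 1) (hyperplane a) (hyperplane a `&` Z)
     <= (if threshold <= r then bound_large else bound_small)%:E)%E) /\
  (threshold <= r ->
    let a := \row_(i < n + m) (if (i < 2)%N then 1 / Num.sqrt 2 else 0) in
    vol (n + m - 1) (hyperplane a) (hyperplane a `&` Z) = bound_large%:E).
Proof.
move=> n1; case: m => // m _ r0 Z threshold bl bs.
have [LQ LB maxE] := max_cylinder_bound m r0.
have upper (a : 'rV[R]_(n + m.+1)) : enorm a = 1 ->
    (vol (n + m.+1 - 1) (hyperplane a) (hyperplane a `&` Z)
     <= (if threshold <= r then bl else bs)%:E)%E.
  move=> /enorm1_dot a1; apply: le_trans (cylinder_section_le r0 a1 LQ LB) _.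
  by rewrite maxE /bl /bs subn1 lee_fin; case: ifP.
split => // tr; case: n n1 @Z upper => [//|[//|n]] _ Z upper a.
have [a1 low] := cylinder_section_ge n r0 LQ.
have ea : enorm a = 1 by rewrite /enorm a1 sqrtr1.
have := upper a ea; rewrite tr; move: low; rewrite -/a -/Z.
have : (0 <= vol (n.+2 + m.+1 - 1) (hyperplane a) (hyperplane a `&` Z))%E.
  exact: measure_ge0.
(* The upper bound excludes an infinite volume, so the lower bound for real values applies. *)
case: (vol _ _ _) => [v| |]// _ low; rewrite lee_fin => vb.
by congr EFin; apply/eqP; rewrite eq_le vb; exact: low.
Qed.
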